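(* Let $s,s_1,s_2\in\mathbb{R}$, $1<p,p_1,p_2<\infty$ and $0<\theta<1$. Put $s_*=(1-\theta)s_1+\theta s_2$ and $\frac1{p_*}=\frac{1-\theta}{p_1}+\frac{\theta}{p_2}$. If there is a constant $C>0$ such that $$\|f\|_{B^{s,1}_{p,1}}\le C\,\|f\|_{B^{s_1,\infty}_{p_1,\infty}}^{1-\theta}\|f\|_{B^{s_2,\infty}_{p_2,\infty}}^{\theta}\quad\text{for all } f\in B^{s_1,\infty}_{p_1,\infty}\cap B^{s_2,\infty}_{p_2,\infty},$$ then one of the following conditions is satisfied: (i) $s_*=s$, $p_*=p$, $s_1\ne s_2$, $p_1\ne p_2$, $s_2-s_1\ne n/p_2-n/p_1$; (ii) $s_*>s$, $p_*=p$, $p_1\ne p_2$; (iii) $s_*-s=n/p_*-n/p>0$, $s_2-s_1\ne n/p_2-n/p_1$; (iv) $s_*-s>n/p_*-n/p>0$.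
   Context: All spaces are on $\mathbb{R}^n$; $\mathscr{S}$ is the Schwartz class and $\mathscr{S}'$ its dual. Lorentz spaces: for $1\le p<\infty$, $1\le q\le\infty$, $L^{p,q}$ is the space of measurable $f$ on $\mathbb{R}^n$ with finite quasi-norm $\|f\|_{L^{p,q}}=\left(p\int_0^\infty[\alpha\mu_f(\alpha)^{1/p}]^q\frac{d\alpha}{\alpha}\right)^{1/q}$ if $q<\infty$, and $\sup_{\alpha>0}\alpha\mu_f(\alpha)^{1/p}$ if $q=\infty$, where $\mu_f(\alpha)=|\{x:|f(x)|>\alpha\}|$. Inhomogeneous Besov-Lorentz spaces: fix $\{\psi_j\}_{j\ge0}\subset C_c^\infty(\mathbb{R}^n)$ with $\operatorname{supp}\psi_0\subset\{|\xi|\le2\}$, $\operatorname{supp}\psi_j\subset\{2^{j-1}\le|\xi|\le2^{j+1}\}$ for $j\ge1$, $\sup_{j,\xi}2^{j|\alpha|}|D^\alpha\psi_j(\xi)|<\infty$ for every multi-index $\alpha$, and $\sum_{j\ge0}\psi_j=1$ on $\mathbb{R}^n$. Let $\Delta_jf=(\psi_j\hat f)^\vee$ for $f\in\mathscr{S}'$. Then $B^{s,r}_{p,q}$ is the space of $f\in\mathscr{S}'$ with $$\|f\|_{B^{s,r}_{p,q}}=\Big\|\big\{2^{js}\|\Delta_jf\|_{L^{p,q}}\big\}_{j\ge0}\Big\|_{l^r}<\infty .$$ *)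

(* Defs.v *)
From HB Require Import structures.
From mathcomp Require Import all_boot all_order all_algebra.
From mathcomp Require Import complex.
From mathcomp Require Import all_classical all_reals all_analysis.

Set Implicit Arguments.
Unset Strict Implicit.
Unset Printing Implicit Defensive.
Import Order.TTheory GRing.Theory Num.Theory.
Import numFieldNormedType.Exports.
Local Open Scope classical_set_scope.
Local Open Scope ring_scope.

(* The Borel sigma-algebra of R^n, generated by the coordinate maps. *)
Section measurable_rV.
Context {R : realType} {n : nat}.

Let coors (i : 'I_n) (x : 'rV[R]_n) : measurableTypeR R := x ord0 i.

Let rV_set0 : g_sigma_preimage coors set0.
Proof. exact: sigma_algebra0. Qed.

Let rV_setC A : g_sigma_preimage coors A -> g_sigma_preimage coors (~` A).
Proof. exact: sigma_algebraC. Qed.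

Let rV_bigcup (F : (set 'rV[R]_n)^nat) :
  (forall i, g_sigma_preimage coors (F i)) ->
  g_sigma_preimage coors (\bigcup_i (F i)).
Proof. exact: sigma_algebra_bigcup. Qed.

HB.instance Definition _ := @isMeasurable.Build default_measure_display
  'rV[R]_n (g_sigma_preimage coors) rV_set0 rV_setC rV_bigcup.

End measurable_rV.

Section lebesgue_rV.
Context {R : realType}.
Local Open Scope ereal_scope.

Definition rV_cons n (p : measurableTypeR R * 'rV[R]_n) : 'rV[R]_n.+1 :=
  \row_(i < n.+1) if unlift ord0 i is Some j then p.2 ord0 j else p.1.

(* lebesgue_rV is Lebesgue measure on R^n, as the n-fold product of Lebesgue measure on R. *)
Fixpoint lebesgue_rV (n : nat) : set 'rV[R]_n -> \bar R :=
  if n is m.+1 then pushforward (lebesgue_measure \x @lebesgue_rV m) (@rV_cons m)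
  else dirac (0%R : 'rV[R]_0).

Lemma measurable_coord n (i : 'I_n) :
  measurable_fun [set: 'rV[R]_n] (fun x : 'rV[R]_n => x ord0 i : measurableTypeR R).
Proof.
move=> _ Y mY; rewrite setTI; apply: sub_sigma_algebra => /=.
rewrite -bigcup_seq/=; exists i => /=; first by rewrite mem_index_enum.
by exists Y => //; rewrite setTI.
Qed.

Lemma measurable_fun_coordP d (T : measurableType d) n (f : T -> 'rV[R]_n) :
  (forall i, measurable_fun [set: T] (fun x => f x ord0 i : measurableTypeR R)) ->
  measurable_fun [set: T] f.
Proof.
move=> mf _ A mA; rewrite setTI.
suff : g_sigma_preimage (fun i x => f x ord0 i : measurableTypeR R)
    `<=` (@measurable _ T).
  apply; rewrite (g_sigma_preimage_comp
    (fun i (x : 'rV[R]_n) => x ord0 i : measurableTypeR R) f).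
  by exists A => //; rewrite setTI.
apply: smallest_sub; first exact: sigma_algebra_measurable.
rewrite -bigcup_seq; apply: bigcup_sub => i _ _ [B mB <-].
exact: mf.
Qed.

Lemma measurable_rV_cons n : measurable_fun setT (@rV_cons n).
Proof.
apply: measurable_fun_coordP => i; rewrite /rV_cons.
case: (unliftP ord0 i) => [j|] ->.
  under eq_fun do rewrite mxE liftK.
  exact: (measurableT_comp (measurable_coord j) measurable_snd).
under eq_fun do rewrite mxE unlift_none.
exact: measurable_fst.
Qed.

Let measurable_box n (A : 'I_n -> set R) :
  (forall i, measurable (A i : set (measurableTypeR R))) ->
  measurable [set x : 'rV[R]_n | forall i, A i (x ord0 i)].
Proof.
move=> mA; rewrite [X in measurable X](_ : _ =
    \bigcap_i ((fun x : 'rV[R]_n => x ord0 i) @^-1` A i)).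
  apply: fin_bigcap_measurable => [|i _]; first exact: finite_finset.
  by rewrite -[X in measurable X]setTI; exact: measurable_coord.
by apply/seteqP; split => x h i; [move=> _|]; exact: h.
Qed.

Let rV_cons_box n (A : 'I_n.+1 -> set R) :
  (@rV_cons n) @^-1` [set x : 'rV[R]_n.+1 | forall i, A i (x ord0 i)] =
  A ord0 `*` [set x : 'rV[R]_n | forall i, A (lift ord0 i) (x ord0 i)].
Proof.
apply/seteqP; split => -[a x] /= h.
  split => /=; first by have := h ord0; rewrite mxE unlift_none.
  by move=> i; have := h (lift ord0 i); rewrite mxE liftK.
case: h => /= ha hx i; rewrite mxE.
by case: (unliftP ord0 i) => [j|] ->.
Qed.

Let box_formula n (mu : set 'rV[R]_n -> \bar R) := forall A : 'I_n -> set R,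
  (forall i, measurable (A i : set (measurableTypeR R))) ->
  mu [set x : 'rV[R]_n | forall i, A i (x ord0 i)] =
  \prod_(i < n) lebesgue_measure (A i).

Let box_sigma_finite n (mu : set 'rV[R]_n -> \bar R) :
  box_formula mu -> sigma_finite setT mu.
Proof.
move=> muE.
exists (fun k => [set x : 'rV[R]_n | forall i, `[(- k%:R)%R, k%:R%R]%classic (x ord0 i)]).
  apply/seteqP; split => // x _.
  exists (Num.truncn (\sum_(i < n) `|x ord0 i|)%R).+1 => // i /=.
  rewrite in_itv/= -ler_norml; apply: le_trans (ltW (truncnS_gt _)).
  by rewrite (bigD1 i)//= lerDl sumr_ge0.
move=> k; split; first by apply: (@measurable_box n (fun=> _)) => i; exact: measurable_itv.
rewrite (muE (fun=> `[(- k%:R)%R, k%:R%R]%classic)); last by move=> i; exact: measurable_itv.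
apply: (@proj2 (0 <= \prod_(i < n) lebesgue_measure (`[(- k%:R)%R, k%:R%R]%classic : set R))).
elim/big_ind : _ => [|x y [x0 xoo] [y0 yoo]|i _].
- by rewrite ltry.
- by split; [exact: mule_ge0 | rewrite lte_mul_pinfty// ge0_fin_numE].
- by rewrite measure_ge0 lebesgue_measure_itv/=; case: ifP => _; rewrite ltry.
Qed.

Let lebesgue_rV_props n :
  [/\ @lebesgue_rV n set0 = 0, forall A, 0 <= @lebesgue_rV n A,
      semi_sigma_additive (@lebesgue_rV n) & box_formula (@lebesgue_rV n)].
Proof.
elim: n => [|n [h0 hge hsa hbox]].
  split; [exact: measure0 | by move=> A; exact: measure_ge0 | | ].
    exact: measure_semi_sigma_additive.
  by move=> A mA; rewrite big_ord0 /= diracE mem_set// => -[].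
pose mm := isMeasure.Build _ _ _ (@lebesgue_rV n) h0 hge hsa.
pose mu1 : {measure set 'rV[R]_n -> \bar R} := HB.pack (@lebesgue_rV n) mm.
pose ms := Measure_isSigmaFinite.Build _ _ _ mu1 (box_sigma_finite hbox).
pose mu : {sigma_finite_measure set 'rV[R]_n -> \bar R} :=
  HB.pack (@lebesgue_rV n) mm ms.
pose Q : {measure set 'rV[R]_n.+1 -> \bar R} :=
  measure_function_pushforward__canonical__measure_function_Measure
    (lebesgue_measure \x mu) (@measurable_rV_cons n).
rewrite -[@lebesgue_rV n.+1]/(Q : set _ -> \bar R).
split; [exact: measure0 | by move=> A; exact: measure_ge0 |
  exact: measure_semi_sigma_additive | ].
move=> A mA; rewrite big_ord_recl -hbox// /Q/= /pushforward rV_cons_box.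
apply: (product_measure1E lebesgue_measure mu (mA ord0)).
by apply: (@measurable_box n (fun i => A (lift ord0 i))) => i; exact: mA.
Qed.

HB.instance Definition _ n := let: And4 h0 hge hsa _ := lebesgue_rV_props n in
  isMeasure.Build _ _ _ (@lebesgue_rV n) h0 hge hsa.

Lemma lebesgue_rV_box n (A : 'I_n -> set R) :
  (forall i, measurable (A i : set (measurableTypeR R))) ->
  lebesgue_rV [set x : 'rV[R]_n | forall i, A i (x ord0 i)] =
  \prod_(i < n) lebesgue_measure (A i).
Proof. by have [_ _ _] := lebesgue_rV_props n; apply. Qed.

HB.instance Definition _ n := Measure_isSigmaFinite.Build _ _ _
  (@lebesgue_rV n) (box_sigma_finite (@lebesgue_rV_box n)).

End lebesgue_rV.

Section analysis_rV.
Context {R : realType} {n : nat}.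
Local Notation V := 'rV[R]_n.
Local Notation C := R[i].
Local Notation Re := (@complex.Re R).
Local Notation Im := (@complex.Im R).
Local Notation normc := (@Normc.normc R).
Implicit Types (f g phi psi : V -> C) (x y xi : V) (a : 'I_n -> nat).

(* The library norm on 'rV[R]_n is the sup norm. *)
Definition enorm x : R := Num.sqrt (\sum_(i < n) x ord0 i ^+ 2).

Definition dotp x y : R := \sum_(i < n) x ord0 i * y ord0 i.

Definition partial (i : 'I_n) f : V -> C := fun x =>
  Complex ('D_(delta_mx ord0 i) (Re \o f) x) ('D_(delta_mx ord0 i) (Im \o f) x).

Definition partials (w : seq 'I_n) f : V -> C := foldr partial f w.

Definition smooth f := forall w : seq 'I_n,
  [/\ continuous (Re \o partials w f), continuous (Im \o partials w f) &
      forall i x, derivable (Re \o partials w f) x (delta_mx ord0 i) /\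
                  derivable (Im \o partials w f) x (delta_mx ord0 i)].

(* D^a f for a multi-index a. *)
Definition mderiv a f : V -> C :=
  partials (flatten [seq nseq (a i) i | i <- enum 'I_n]) f.

Definition mlen a : nat := (\sum_(i < n) a i)%N.

Definition supp f : set V := closure [set x | f x != 0].

Definition test_function f := smooth f /\ compact (supp f).

Definition schwartz_seminorm (k : nat) a f : \bar R :=
  ereal_sup [set ((1 + enorm x) ^+ k * normc (mderiv a f x))%:E | x in setT].

Definition schwartz f :=
  smooth f /\ forall k a, (schwartz_seminorm k a f < +oo)%E.

(* A tempered distribution is represented by a functional on all functions, of
   which only the values on Schwartz functions matter; continuity is for the
   locally convex topology defined by the Schwartz seminorms. *)
Definition distr := (V -> C) -> C.

Definition tempered (u : distr) :=
  (forall (c : C) phi psi, schwartz phi -> schwartz psi ->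
     u (fun x => c * phi x + psi x) = c * u phi + u psi) /\
  (forall phi, schwartz phi -> forall e : R, 0 < e ->
     exists N : nat, exists2 d : R, 0 < d & forall psi, schwartz psi ->
       (forall k a, (k <= N)%N -> (mlen a <= N)%N ->
          (schwartz_seminorm k a (fun x => psi x - phi x)%R < d%:E)%E) ->
       normc (u psi - u phi) < e).

Definition cmeasurable f :=
  measurable_fun setT (Re \o f) /\ measurable_fun setT (Im \o f).

Definition cintegrable f :=
  (@lebesgue_rV R n).-integrable setT (EFin \o (Re \o f)) /\
  (@lebesgue_rV R n).-integrable setT (EFin \o (Im \o f)).

Definition cintegral f : C :=
  Complex (\int[@lebesgue_rV R n]_x Re (f x)) (\int[@lebesgue_rV R n]_x Im (f x)).

Definition expi (t : R) : C := Complex (cos t) (sin t).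

(* Convention: \int f(x) e^{-i x.xi} dx, inverted with the factor (2 pi)^{-n}. *)
Definition fourier f : V -> C := fun xi =>
  cintegral (fun x => f x * expi (- dotp x xi)).

Definition inv_fourier f : V -> C := fun x =>
  real_complex R ((2 * pi) ^- n) * cintegral (fun xi => f xi * expi (dotp x xi)).

Definition distr_fourier (u : distr) : distr := fun phi => u (fourier phi).

Definition distr_inv_fourier (u : distr) : distr := fun phi => u (inv_fourier phi).

Definition distr_mul psi (u : distr) : distr := fun phi => u (fun x => psi x * phi x).

Definition distr_of_fun (u : distr) g := cmeasurable g /\
  forall phi, schwartz phi ->
    cintegrable (fun x => g x * phi x) /\ u phi = cintegral (fun x => g x * phi x).

Definition distribution_fun f (t : R) : \bar R :=
  lebesgue_rV [set x | t < normc (f x)].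

Local Open Scope ereal_scope.

Definition lorentz_norm (p : R) (q : \bar R) f : \bar R :=
  match q with
  | r%:E => (p%:E * \int[lebesgue_measure]_(t in `]0%R, +oo[)
      ((t%:E * distribution_fun f t `^ p^-1) `^ r * (t^-1)%:E)) `^ r^-1
  | +oo => ereal_sup [set t%:E * distribution_fun f t `^ p^-1 | t in `]0%R, +oo[]
  | -oo => 0
  end.

(* +oo when u is not given by a function; otherwise the infimum is over a single value, as
   the function is unique up to null sets. *)
Definition distr_lorentz_norm (p : R) (q : \bar R) (u : distr) : \bar R :=
  ereal_inf [set lorentz_norm p q g | g in [set g | distr_of_fun u g]].

(* (psi_j u^)^v, all operations being defined by transposition. *)
Definition lp_block (psi : nat -> V -> C) (j : nat) (u : distr) : distr :=
  distr_inv_fourier (distr_mul (psi j) (distr_fourier u)).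

Definition lp_decomposition (psi : nat -> V -> C) : Prop :=
  [/\ forall j, test_function (psi j),
      supp (psi 0%N) `<=` [set xi | enorm xi <= 2]%R,
      forall j, (1 <= j)%N -> supp (psi j) `<=`
        [set xi | 2 ^+ j.-1 <= enorm xi <= 2 ^+ j.+1]%R,
      forall a, (ereal_sup
        [set ((2 ^+ (jxi.1 * mlen a)%N * normc (mderiv a (psi jxi.1) jxi.2))%R)%:E |
           jxi in [set: (nat * V)%type]] < +oo) &
      forall xi, (series (fun j => Re (psi j xi)) @ \oo --> (1 : R)%R) /\
                 (series (fun j => Im (psi j xi)) @ \oo --> (0 : R)%R)].

(* The norm of B^{s,r}_{p,q}: r is the exponent of the sequence space, and p, q
   those of the Lorentz space. *)
Definition besov_norm (psi : nat -> V -> C) (s : R) (r : \bar R) (p : R)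
    (q : \bar R) (u : distr) : \bar R :=
  Lnorm (@counting nat R) r (fun j : nat =>
    ((2 `^ (j%:R * s))%R)%:E * distr_lorentz_norm p q (lp_block psi j u)).

Definition besov (psi : nat -> V -> C) (s : R) (r : \bar R) (p : R)
    (q : \bar R) (u : distr) : Prop :=
  tempered u /\ besov_norm psi s r p q u < +oo.

End analysis_rV.

(* Main.v *)
Require Import Defs.
From HB Require Import structures.
From mathcomp Require Import all_boot all_order all_algebra.
From mathcomp Require Import complex.
From mathcomp Require Import all_classical all_reals all_analysis.
From mathcomp Require Import measurable_realfun.
From mathcomp Require Import ring lra zify.

Set Implicit Arguments.
Unset Strict Implicit.
Unset Printing Implicit Defensive.
Import Order.TTheory GRing.Theory Num.Theory.
Import numFieldNormedType.Exports.
Local Open Scope classical_set_scope.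
Local Open Scope ring_scope.

(** The conditions are necessary because wave packets violate the inequality otherwise.
    A packet [f] of frequency about [2^j], spatial scale [1 / mu] (with [mu] at most
    [2^j / 8]) and amplitude 1 has norm comparable to [2^(j s) mu^(-n/p)] in each
    space [B^s_p], whatever the other two indices: in frequency it meets only the blocks
    [j] and [j + 1], where it is a bump of height 1 and mass [mu^(-n)]. Write
    [A = 1/p_* - 1/p] and [S = s_* - s]. A single packet with [j = 0] and [mu -> 0] gives
    [A >= 0]; one with [mu = 2^j / 8] and [j -> oo] gives [S >= n A] ([single_packet]).

    The strict inequalities and exclusions come from sums of [N] packets, on which the
    third index matters. If their frequencies are separated, the weak norms are suprema
    and the strong norm is a sum ([separated_weak_le], [separated_strong_ge]). When
    [s - n/p], [s1 - n/p1], [s2 - n/p2] coincide, packets with [mu = 2^j / 8] and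
    suitable amplitudes make the terms constant in the three norms, so that the strong one
    is at least of order [N]; when [s = s1 = s2] the same happens with [mu = 1/8]
    ([not_collinear]). If [p = p1 = p2], packets at one frequency, with [mu = 2^(-k) / 8]
    and amplitude [mu^(n/p)], are bounded in weak [L^p] uniformly in [N] by a geometric
    series ([geometric_min_sum]), while their norm in [L^(p,1)] is at least of order [N]
    ([not_all_equal_exponents]). These facts leave exactly the cases listed.

    Upper bounds: by [osc_decay] the blocks of a packet decay like a Poisson kernel at
    scale [1 / mu], uniformly in [j], because the symbols satisfy uniform estimates; then
    the integral of a block over a set [E] is at most a constant times
    [min(|E|, mu^(-n))], and [lorentz_weak_le] turns bounds over sets into weak norms.
    Lower bounds: the blocks are paired with Schwartz functions of the same shape as the
    packets, and [lorentz1_duality] bounds the pairing by the norm in [L^(p,1)]. The sum of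
    the two blocks which see a packet returns the packet itself, so that the pairing is
    computed exactly; it does not vanish by [pairing_ge].

    The blocks are defined by transposition. That they are given by the expected functions
    ([lp_block_regdistr]) rests on Fubini's theorem ([osc_duality]) and on Fourier
    inversion ([osc_inversion]). *)

(** * Complex numbers and complex-valued integrals *)

(** The modulus with values in [R] itself rather than in one of its algebraic
    reducts, so that it can be measured and integrated. *)
Definition cabs {R : realType} (z : R[i]) : R := Normc.normc z.

Section complex_basics.
Context {R : realType}.
Local Notation C := R[i].
Local Notation Re := (@complex.Re R).
Local Notation Im := (@complex.Im R).
Implicit Types z w : C.

Lemma cabs_ge0 z : 0 <= cabs z.
Proof. by rewrite /cabs; case: z => a b; exact: sqrtr_ge0. Qed.

Lemma cabs0 : cabs (0 : C) = 0.
Proof. exact: Normc.normc0. Qed.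

Lemma cabsM z w : cabs (z * w) = cabs z * cabs w.
Proof. exact: Normc.normcM. Qed.

Lemma cabsN z : cabs (- z) = cabs z.
Proof. exact: normcN. Qed.

Lemma le_Re_cabs z : `|Re z| <= cabs z.
Proof.
rewrite /cabs; case: z => a b /=; rewrite -sqrtr_sqr ler_wsqrtr// lerDl sqr_ge0//.
Qed.

Lemma le_Im_cabs z : `|Im z| <= cabs z.
Proof.
rewrite /cabs; case: z => a b /=; rewrite -sqrtr_sqr ler_wsqrtr// lerDr sqr_ge0//.
Qed.

Lemma le_cabs_ReIm z : cabs z <= `|Re z| + `|Im z|.
Proof.
rewrite /cabs; case: z => a b /=.
have h : 0 <= `|a| + `|b| by rewrite addr_ge0.
rewrite -[leRHS]ger0_norm// -sqrtr_sqr ler_wsqrtr// sqrrD !real_normK ?num_real//.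
by rewrite addrAC lerDl mulrn_wge0// mulr_ge0.
Qed.

Lemma ler_cabsD z w : cabs (z + w) <= cabs z + cabs w.
Proof. exact: le_normcD. Qed.

Lemma cabs_real (a : R) : cabs (real_complex R a) = `|a|.
Proof. by rewrite /cabs/= expr0n/= addr0 sqrtr_sqr. Qed.

Lemma cReD z w : Re (z + w) = Re z + Re w.
Proof. by case: z w => a b [c d]. Qed.
Lemma cImD z w : Im (z + w) = Im z + Im w.
Proof. by case: z w => a b [c d]. Qed.
Lemma cReM z w : Re (z * w) = Re z * Re w - Im z * Im w.
Proof. by case: z w => a b [c d]. Qed.
Lemma cImM z w : Im (z * w) = Re z * Im w + Im z * Re w.
Proof. by case: z w => a b [c d]. Qed.

Lemma cReRM (a : R) z : Re (real_complex R a * z) = a * Re z.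
Proof. by case: z => b c /=; rewrite mul0r subr0. Qed.

Lemma cImRM (a : R) z : Im (real_complex R a * z) = a * Im z.
Proof. by case: z => b c /=; rewrite mul0r addr0. Qed.

Lemma RC_prod (I : Type) (r : seq I) (f : I -> R) :
  real_complex R (\prod_(i <- r) f i) = \prod_(i <- r) real_complex R (f i).
Proof.
apply: (big_morph (real_complex R)) => // a b; exact: (rmorphM (real_complex R)).
Qed.

Lemma complexP z w : Re z = Re w -> Im z = Im w -> z = w.
Proof. by case: z w => a b [c d] /= -> ->. Qed.

Lemma expi0 : @expi R 0 = 1.
Proof. by rewrite /expi cos0 sin0. Qed.

Lemma expiD (s t : R) : expi (s + t) = expi s * expi t.
Proof.
apply: complexP; rewrite ?cReM ?cImM /= ?cosD// sinD [RHS]addrC; congr (_ + _).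
Qed.

Lemma cabs_expi (t : R) : cabs (expi t) = 1.
Proof. by rewrite /cabs/= cos2Dsin2 sqrtr1. Qed.

Lemma expiNpi : @expi R (- pi) = -1.
Proof. by rewrite /expi cosN sinN cospi sinpi oppr0; apply: complexP => //=; rewrite oppr0. Qed.

End complex_basics.

Section complex_integral.
Context {R : realType} {d : measure_display} {T : measurableType d}.
Local Notation C := R[i].
Local Notation Re := (@complex.Re R).
Local Notation Im := (@complex.Im R).

(** Stated for an arbitrary measurable space, since Fubini's theorem needs it on
    products; on R^n these three notions unfold to those of the statement. *)
Definition cmeas (f : T -> C) :=
  measurable_fun setT (Re \o f) /\ measurable_fun setT (Im \o f).

Lemma cmeas_cst (c : C) : cmeas (fun=> c).
Proof. by split; exact: measurable_cst. Qed.

Lemma cmeasD f g : cmeas f -> cmeas g -> cmeas (fun x => f x + g x).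
Proof.
move=> [f1 f2] [g1 g2]; split.
  by rewrite (_ : _ \o _ = (Re \o f) \+ (Re \o g)); [exact: measurable_funD|apply/funext => x /=; rewrite cReD].
by rewrite (_ : _ \o _ = (Im \o f) \+ (Im \o g)); [exact: measurable_funD|apply/funext => x /=; rewrite cImD].
Qed.

Lemma cmeasM f g : cmeas f -> cmeas g -> cmeas (fun x => f x * g x).
Proof.
move=> [f1 f2] [g1 g2]; split.
  rewrite (_ : _ \o _ = ((Re \o f) \* (Re \o g)) \- ((Im \o f) \* (Im \o g))).
    by apply: measurable_funB; exact: measurable_funM.
  by apply/funext => x /=; rewrite cReM.
rewrite (_ : _ \o _ = ((Re \o f) \* (Im \o g)) \+ ((Im \o f) \* (Re \o g))).
  by apply: measurable_funD; exact: measurable_funM.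
by apply/funext => x /=; rewrite cImM.
Qed.

Lemma cmeas_sum (I : Type) (r : seq I) (f : I -> T -> C) :
  (forall i, cmeas (f i)) -> cmeas (fun x => \sum_(i <- r) f i x).
Proof.
move=> mf; elim: r => [|i r IH].
  by under eq_fun do rewrite big_nil; exact: cmeas_cst.
by under eq_fun do rewrite big_cons; exact: cmeasD.
Qed.

Lemma cmeas_prod (I : Type) (r : seq I) (f : I -> T -> C) :
  (forall i, cmeas (f i)) -> cmeas (fun x => \prod_(i <- r) f i x).
Proof.
move=> mf; elim: r => [|i r IH].
  by under eq_fun do rewrite big_nil; exact: cmeas_cst.
by under eq_fun do rewrite big_cons; exact: cmeasM.
Qed.

Lemma cmeas_comp d' (T' : measurableType d') (phi : T' -> T) (f : T -> C) :
  measurable_fun setT phi -> cmeas f ->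
  measurable_fun setT (Re \o (f \o phi)) /\ measurable_fun setT (Im \o (f \o phi)).
Proof. by move=> mphi [f1 f2]; split; [exact: (measurableT_comp f1)|exact: (measurableT_comp f2)]. Qed.

Lemma cmeas_expi (f : T -> R) : measurable_fun setT f -> cmeas (fun x => expi (f x)).
Proof.
move=> mf; split; apply: (measurableT_comp _ mf);
  apply: continuous_measurable_fun; [exact: continuous_cos | exact: continuous_sin].
Qed.

Lemma measurable_cabs f : cmeas f -> measurable_fun setT (cabs \o f).
Proof.
move=> [f1 f2].
rewrite (_ : _ \o _ = Num.sqrt \o (fun x => Re (f x) ^+ 2 + Im (f x) ^+ 2)); last first.
  by apply/funext => x; rewrite /cabs/=; case: (f x).
apply: measurableT_comp.
  by apply: continuous_measurable_fun; exact: sqrt_continuous.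
by apply: measurable_funD; exact: measurable_funX.
Qed.

Lemma measurable_cabs_EFin f : cmeas f -> measurable_fun setT (fun x => (cabs (f x))%:E).
Proof. by move=> mf; apply/measurable_EFinP; exact: measurable_cabs. Qed.

Variable mu : {measure set T -> \bar R}.

Definition cintb (f : T -> C) :=
  mu.-integrable setT (EFin \o (Re \o f)) /\ mu.-integrable setT (EFin \o (Im \o f)).

Definition cint (f : T -> C) : C :=
  Complex (\int[mu]_x Re (f x)) (\int[mu]_x Im (f x)).

Lemma cintb_cmeas f : cintb f -> cmeas f.
Proof. by move=> [/measurable_int/measurable_EFinP f1 /measurable_int/measurable_EFinP f2]. Qed.

Lemma cintb_norm_integrable f : cintb f -> mu.-integrable setT (fun x => (cabs (f x))%:E).
Proof.
move=> If; have mf := cintb_cmeas If; case: If => f1 f2.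
apply: (@le_integrable _ _ _ _ _ measurableT _
  ((abse \o (EFin \o (Re \o f))) \+ (abse \o (EFin \o (Im \o f))))%E).
- exact: measurable_cabs_EFin.
- move=> x _ /=; rewrite !lee_fin (ger0_norm (cabs_ge0 _)).
  by rewrite ger0_norm ?addr_ge0// le_cabs_ReIm.
- by apply: integrableD => //; exact: integrable_abse.
Qed.

Lemma cintb_le f (g : T -> R) : cmeas f -> (forall x, cabs (f x) <= g x) ->
  mu.-integrable setT (EFin \o g) -> cintb f.
Proof.
move=> [f1 f2] fg ig; split; apply: (le_integrable _ _ _ ig) => //.
- exact/measurable_EFinP.
- by move=> x _ /=; rewrite lee_fin (le_trans (le_Re_cabs _))// (le_trans (fg x))// ler_norm.
- exact/measurable_EFinP.
- by move=> x _ /=; rewrite lee_fin (le_trans (le_Im_cabs _))// (le_trans (fg x))// ler_norm.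
Qed.

Lemma cintbP f : cintb f <-> cmeas f /\ (\int[mu]_x (cabs (f x))%:E < +oo)%E.
Proof.
split=> [If|[mf foo]].
  split; first exact: cintb_cmeas.
  by apply: (integrable_lty _ (cintb_norm_integrable If)).
apply: (cintb_le mf (fun x => lexx _)); apply/integrableP; split.
  exact: measurable_cabs_EFin.
by under eq_integral do rewrite /= ger0_norm ?cabs_ge0//.
Qed.

Lemma cintb_cst0 : cintb (fun=> 0).
Proof. by split; exact: integrable0. Qed.

Lemma cintbD f g : cintb f -> cintb g -> cintb (fun x => f x + g x).
Proof.
move=> [f1 f2] [g1 g2]; split.
  rewrite (_ : _ \o _ = (EFin \o (Re \o f)) \+ (EFin \o (Re \o g)))%E; first exact: integrableD.
  by apply/funext => x /=; rewrite cReD.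
rewrite (_ : _ \o _ = (EFin \o (Im \o f)) \+ (EFin \o (Im \o g)))%E; first exact: integrableD.
by apply/funext => x /=; rewrite cImD.
Qed.

Lemma cintbM_bounded (M : R) f g : cmeas f -> (forall x, cabs (f x) <= M) ->
  cintb g -> cintb (fun x => f x * g x).
Proof.
move=> mf fM Ig.
apply: (@cintb_le _ (fun x => M * cabs (g x))).
- by apply: cmeasM => //; exact: cintb_cmeas.
- by move=> x; rewrite cabsM ler_wpM2r// cabs_ge0.
- by apply: (integrableZl measurableT M (cintb_norm_integrable Ig)).
Qed.

Lemma cintbMr_bounded (M : R) f g : cmeas f -> (forall x, cabs (f x) <= M) ->
  cintb g -> cintb (fun x => g x * f x).
Proof. by move=> mf fM Ig; under eq_fun do rewrite mulrC; exact: cintbM_bounded fM Ig. Qed.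

Lemma cintbZ c f : cintb f -> cintb (fun x => c * f x).
Proof. by apply: (@cintbM_bounded (cabs c)) => //; exact: cmeas_cst. Qed.

Lemma cintb_sum (I : Type) (r : seq I) (f : I -> T -> C) :
  (forall i, cintb (f i)) -> cintb (fun x => \sum_(i <- r) f i x).
Proof.
move=> mf; elim: r => [|i r IH].
  by under eq_fun do rewrite big_nil; exact: cintb_cst0.
by under eq_fun do rewrite big_cons; exact: cintbD.
Qed.

Lemma cintD f g : cintb f -> cintb g -> cint (fun x => f x + g x) = cint f + cint g.
Proof.
move=> [f1 f2] [g1 g2]; apply: complexP; rewrite ?cReD ?cImD/= -RintegralD//.
  by congr Rintegral; apply/funext => x; rewrite cReD.
by congr Rintegral; apply/funext => x; rewrite cImD.
Qed.

Lemma cintZ c f : cintb f -> cint (fun x => c * f x) = c * cint f.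
Proof.
move=> [f1 f2].
have Z (a : R) (g : T -> R) : mu.-integrable setT (EFin \o g) -> mu.-integrable setT (EFin \o (fun x => a * g x)).
  by move=> ig; exact: (integrableZl measurableT a ig).
apply: complexP; rewrite ?cReM ?cImM/= -!RintegralZl//.
  rewrite -RintegralB//; [|exact: Z..].
  by congr Rintegral; apply/funext => x; rewrite cReM.
rewrite -RintegralD//; [|exact: Z..].
by congr Rintegral; apply/funext => x; rewrite cImM.
Qed.

Lemma eq_cint f g : f =1 g -> cint f = cint g.
Proof. by move=> /funext ->. Qed.

Lemma cint0 : cint (fun=> 0) = 0.
Proof. by apply: complexP; rewrite /= /Rintegral integral0_eq. Qed.

Lemma cint_sum (I : Type) (r : seq I) (f : I -> T -> C) :
  (forall i, cintb (f i)) ->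
  cint (fun x => \sum_(i <- r) f i x) = \sum_(i <- r) cint (f i).
Proof.
move=> mf; elim: r => [|i r IH].
  by rewrite big_nil -[RHS]cint0; apply: eq_cint => x; rewrite big_nil.
rewrite big_cons -IH -cintD//; last exact: cintb_sum.
by apply: eq_cint => x; rewrite big_cons.
Qed.

(** The factor 2 comes from treating the real and imaginary parts separately; it
    avoids choosing a phase and is harmless below. *)
Lemma le_cabs_cint f : cintb f ->
  ((cabs (cint f))%:E <= 2%:E * \int[mu]_x (cabs (f x))%:E)%E.
Proof.
move=> If; have mf := cintb_cmeas If; have [f1 f2] := If.
have Ni := cintb_norm_integrable If.
have key (g : T -> R) : mu.-integrable setT (EFin \o g) -> (forall x, `|g x| <= cabs (f x)) ->
  (`| \int[mu]_x g x |%:E <= \int[mu]_x (cabs (f x))%:E)%E.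
  move=> ig gf; rewrite /Rintegral -abse_EFin fineK; last exact: integrable_fin_num.
  apply: (le_trans (le_abse_integral _ _ _)) => //; first exact: measurable_int ig.
  apply: ge0_le_integral => //.
  - by apply: measurableT_comp => //; exact: measurable_int ig.
  - exact: measurable_cabs_EFin.
  by move=> x _; rewrite lee_fin.
apply: (@le_trans _ _ (`|Re (cint f)|%:E + `|Im (cint f)|%:E)%E).
  by rewrite -EFinD lee_fin le_cabs_ReIm.
rewrite mule_natl mule2n.
by apply: leeD; apply: key => // x; [exact: le_Re_cabs|exact: le_Im_cabs].
Qed.

Lemma le_cabs_cint_bound f (B : R) : cintb f ->
  (\int[mu]_x (cabs (f x))%:E <= B%:E)%E -> cabs (cint f) <= 2 * B.
Proof.
move=> If fB; rewrite -lee_fin (le_trans (le_cabs_cint If))// EFinM.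
by rewrite lee_wpmul2l.
Qed.

Lemma cint_dominated (f_ : nat -> T -> C) (f : T -> C) (g : T -> R) :
  (forall k, cmeas (f_ k)) -> cmeas f ->
  (forall x, (fun k => Re (f_ k x)) @ \oo --> Re (f x)) ->
  (forall x, (fun k => Im (f_ k x)) @ \oo --> Im (f x)) ->
  mu.-integrable setT (EFin \o g) ->
  (forall k x, cabs (f_ k x) <= g x) ->
  (fun k => Re (cint (f_ k))) @ \oo --> Re (cint f) /\
  (fun k => Im (cint (f_ k))) @ \oo --> Im (cint f).
Proof.
move=> mf_ mf cR cI ig fg.
have key (h_ : nat -> T -> R) (h : T -> R) : (forall k, measurable_fun setT (h_ k)) ->
    measurable_fun setT h -> (forall x, (fun k => h_ k x) @ \oo --> h x) ->
    (forall k x, `|h_ k x| <= g x) ->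
    (fun k => \int[mu]_x (h_ k x)) @ \oo --> \int[mu]_x h x.
  move=> mh_ mh hc hg.
  have hc' x : (fun k => (h_ k x)%:E) @ \oo --> (h x)%:E.
    by apply: cvg_EFin; [exact: nearW|exact: hc].
  have [ih _ c] := @dominated_convergence _ _ _ mu setT measurableT
    (fun k => EFin \o h_ k) (EFin \o h) (EFin \o g)
    (fun k => (measurable_EFinP _ _).2 (mh_ k)) ((measurable_EFinP _ _).2 mh)
    (aeW _ (fun x _ => hc' x)) ig
    (aeW _ (fun x k _ => hg k x)).
  apply: fine_cvg; rewrite fineK//; last exact: integrable_fin_num.
split; apply: key => //.
- by move=> k; have [] := mf_ k.
- by have [] := mf.
- by move=> k x; rewrite (le_trans (le_Re_cabs _)).
- by move=> k; have [] := mf_ k.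
- by have [] := mf.
- by move=> k x; rewrite (le_trans (le_Im_cabs _)).
Qed.

End complex_integral.

Section complex_fubini.
Context {R : realType} {d1 d2 : measure_display}
  {T1 : measurableType d1} {T2 : measurableType d2}.
Variables (m1 : {sigma_finite_measure set T1 -> \bar R})
          (m2 : {sigma_finite_measure set T2 -> \bar R}).
Local Notation C := R[i].
Local Notation Re := (@complex.Re R).
Local Notation Im := (@complex.Im R).

Variable f : T1 * T2 -> C.
Hypothesis mf : cmeas f.
Hypothesis fin : (\int[m1]_x \int[m2]_y (cabs (f (x, y)))%:E < +oo)%E.
Hypothesis fx : forall x, cintb m2 (fun y => f (x, y)).

Let part_integrable (h : T1 * T2 -> R) : measurable_fun setT h ->
  (forall z, `|h z| <= cabs (f z)) -> (m1 \x m2)%E.-integrable setT (EFin \o h).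
Proof.
move=> mh hf; apply/integrable12ltyP; first exact/measurable_EFinP.
apply: le_lt_trans fin; apply: ge0_le_integral => //.
- by move=> x _; exact: integral_ge0.
- apply: (measurable_fun_fubini_tonelli_F (abse \o (EFin \o h))) => [|z].
    by apply: measurableT_comp => //; exact/measurable_EFinP.
  exact: abse_ge0.
- apply: (measurable_fun_fubini_tonelli_F (fun z => (cabs (f z))%:E)) => [|z].
    exact: measurable_cabs_EFin.
  by rewrite lee_fin cabs_ge0.
move=> x _; apply: ge0_le_integral => //.
- apply: measurableT_comp => //; apply/measurable_EFinP.
  exact: (measurableT_comp mh (pair1_measurable x)).
- apply/measurable_EFinP.
  exact: (measurableT_comp (measurable_cabs mf) (pair1_measurable x)).
- by move=> y _; rewrite lee_fin.
Qed.

Let intRe : (m1 \x m2)%E.-integrable setT (EFin \o (Re \o f)).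
Proof. by apply: part_integrable => [|z]; [case: mf|exact: le_Re_cabs]. Qed.
Let intIm : (m1 \x m2)%E.-integrable setT (EFin \o (Im \o f)).
Proof. by apply: part_integrable => [|z]; [case: mf|exact: le_Im_cabs]. Qed.

Lemma cintb_prod : cintb (m1 \x m2)%E f.
Proof. by split. Qed.

Lemma cint12 : cint (m1 \x m2)%E f = cint m1 (fun x => cint m2 (fun y => f (x, y))).
Proof.
apply: complexP; rewrite /= /Rintegral; congr fine.
  rewrite -(integral12_prod_meas1 intRe); apply: eq_integral => x _.
  by rewrite /fubini_F fineK//; apply: integrable_fin_num => //; have [] := fx x.
rewrite -(integral12_prod_meas1 intIm); apply: eq_integral => x _.
by rewrite /fubini_F fineK//; apply: integrable_fin_num => //; have [] := fx x.
Qed.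

Lemma cintb_fubini : cintb m1 (fun x => cint m2 (fun y => f (x, y))).
Proof.
split.
  apply: (eq_integrable measurableT) (integrable_fubini_F intRe) => x _ /=.
  by rewrite /fubini_F /Rintegral fineK//; apply: integrable_fin_num => //; have [] := fx x.
apply: (eq_integrable measurableT) (integrable_fubini_F intIm) => x _ /=.
by rewrite /fubini_F /Rintegral fineK//; apply: integrable_fin_num => //; have [] := fx x.
Qed.

Hypothesis fy : forall y, cintb m1 (fun x => f (x, y)).

Lemma cint_fubini : cint m1 (fun x => cint m2 (fun y => f (x, y))) =
  cint m2 (fun y => cint m1 (fun x => f (x, y))).
Proof.
apply: complexP => /=.
  rewrite /Rintegral; congr fine.
  rewrite -[RHS](_ : \int[m2]_y \int[m1]_x (Re (f (x, y)))%:E = _)%E; last first.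
    apply: eq_integral => y _; rewrite fineK//.
    by apply: integrable_fin_num => //; have [] := fy y.
  rewrite -(Fubini intRe); apply: eq_integral => x _; rewrite fineK//.
  by apply: integrable_fin_num => //; have [] := fx x.
rewrite /Rintegral; congr fine.
rewrite -[RHS](_ : \int[m2]_y \int[m1]_x (Im (f (x, y)))%:E = _)%E; last first.
  apply: eq_integral => y _; rewrite fineK//.
  by apply: integrable_fin_num => //; have [] := fy y.
rewrite -(Fubini intIm); apply: eq_integral => x _; rewrite fineK//.
by apply: integrable_fin_num => //; have [] := fx x.
Qed.

End complex_fubini.

Section complex_product.
Context {R : realType} {d1 d2 : measure_display}
  {T1 : measurableType d1} {T2 : measurableType d2}.
Variables (m1 : {sigma_finite_measure set T1 -> \bar R})
          (m2 : {sigma_finite_measure set T2 -> \bar R}).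

Lemma cint_tensor_fin (a : T1 -> R[i]) (b : T2 -> R[i]) : cintb m1 a -> cintb m2 b ->
  (\int[m1]_x \int[m2]_y (cabs (a x * b y))%:E < +oo)%E.
Proof.
move=> Ia Ib.
have b0 : (0 <= \int[m2]_y (cabs (b y))%:E)%E.
  by apply: integral_ge0 => y _; rewrite lee_fin cabs_ge0.
under eq_integral => x _.
  under eq_integral do rewrite cabsM EFinM.
  rewrite ge0_integralZl//; last 3 first.
  - by apply: measurable_cabs_EFin; exact: cintb_cmeas Ib.
  - by move=> y _; rewrite lee_fin cabs_ge0.
  - by rewrite lee_fin cabs_ge0.
  over.
rewrite ge0_integralZr//; last 2 first.
- by apply: measurable_cabs_EFin; exact: cintb_cmeas Ia.
- by move=> x _; rewrite lee_fin cabs_ge0.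
apply: lte_mul_pinfty.
- by apply: integral_ge0 => y _; rewrite lee_fin cabs_ge0.
- by apply: integrable_fin_num => //; exact: cintb_norm_integrable.
- by have /cintbP[] := Ib.
Qed.

Lemma cint_tensor (a : T1 -> R[i]) (b : T2 -> R[i]) : cintb m1 a -> cintb m2 b ->
  cintb (m1 \x m2)%E (fun z => a z.1 * b z.2) /\
  cint (m1 \x m2)%E (fun z => a z.1 * b z.2) = cint m1 a * cint m2 b.
Proof.
move=> Ia Ib.
have mf : cmeas (fun z : T1 * T2 => a z.1 * b z.2).
  apply: cmeasM.
    exact: (cmeas_comp measurable_fst (cintb_cmeas Ia)).
  exact: (cmeas_comp measurable_snd (cintb_cmeas Ib)).
have fin := cint_tensor_fin Ia Ib.
split; first exact: (cintb_prod mf fin).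
rewrite (cint12 mf fin)/=; last by move=> x; exact: cintbZ.
rewrite mulrC -cintZ//; apply: eq_cint => x.
by rewrite cintZ// mulrC.
Qed.

End complex_product.

(** * Lebesgue measure on R^n *)

Section measurability_rV.
Context {R : realType} {n : nat}.
Local Notation V := 'rV[R]_n.

(** The sigma-algebra is generated by the coordinates; a countable basis of rational
    cubes is what relates it to the topology. *)
Lemma measurable_open_rV (U : set V) : open U -> measurable U.
Proof.
move=> oU.
pose B (i : 'rV[rat]_n * nat) : set V :=
  [set x | forall j, `|x ord0 j - ratr (i.1 ord0 j)| < i.2.+1%:R^-1].
have mB i : measurable (B i).
  rewrite [X in measurable X](_ : _ =
      \bigcap_j ((fun x : V => x ord0 j) @^-1` (ball (ratr (i.1 ord0 j) : R) i.2.+1%:R^-1))).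
    apply: fin_bigcap_measurable => [|j _]; first exact: finite_finset.
    rewrite -[X in measurable X]setTI; apply: measurable_coord => //.
    exact: measurable_ball.
  by apply/seteqP; split => x h j; [move=> _; rewrite /preimage/= /ball/= distrC; exact: h
    |have := h j I; rewrite /preimage/= /ball/= distrC].
rewrite (_ : U = \bigcup_i (if `[< B i `<=` U >] then B i else set0)).
  apply: countable_bigcupT_measurable => [|i]; first exact: countableP.
  by case: ifP.
apply/seteqP; split => [x Ux|x [i _]]; last by case: ifPn => // /asboolP; apply.
have /nbhs_ballP[e /= e0 xe] := open_nbhs_nbhs (conj oU Ux).
have [k ke] : exists k : nat, k.+1%:R^-1 < e / 2.
  exists (Num.truncn (e / 2)^-1); rewrite invf_plt ?posrE ?divr_gt0//.
  exact: truncnS_gt.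
have kp : (0 : R) < k.+1%:R^-1 by rewrite invr_gt0.
have [q Hq] : exists q : 'rV[rat]_n, forall j, `|x ord0 j - ratr (q ord0 j)| < k.+1%:R^-1.
  have /= h (j : 'I_n) : exists q : rat, `|x ord0 j - ratr q| < k.+1%:R^-1.
    have /rat_in_itvoo[q] : x ord0 j - k.+1%:R^-1 < x ord0 j + k.+1%:R^-1.
      by rewrite ltrBlDr -addrA ltrDl addr_gt0.
    rewrite in_itv/= => /andP[q1 q2]; exists q.
    move: kp q1 q2; move: (k.+1%:R^-1) => h _ q1 q2.
    by rewrite ltr_distl; apply/andP; split; lra.
  by have [f Hf] := choice h; exists (\row_j f j) => j; rewrite mxE.
have Bx : B (q, k) x by exact: Hq.
suff BU : B (q, k) `<=` U by exists (q, k) => //; rewrite asboolT.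
move=> y By.
apply: xe; rewrite mx_norm_ball /ball_/= /Num.Def.normr/= mx_normrE.
apply: (@lt_le_trans _ _ (e/2 + e/2)); last by rewrite -splitr.
apply/bigmax_ltP; split => [|[i j] _ /=]; first by rewrite addr_gt0// divr_gt0.
rewrite !mxE ord1 (_ : _ - _ = (x ord0 j - ratr (q ord0 j)) - (y ord0 j - ratr (q ord0 j))).
  rewrite (le_lt_trans (ler_normB _ _))// ltrD//; first exact: lt_trans (Hq j) ke.
  exact: lt_trans (By j) ke.
by rewrite opprB addrA subrK.
Qed.

Lemma continuous_measurable_rV (f : V -> R) : continuous f -> measurable_fun setT f.
Proof.
move=> cf; apply: (measurability _ (RGenOpens.measurableE R)).
move=> _ [_ [a [b ->] <-]]; rewrite setTI; apply: measurable_open_rV.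
apply: open_comp; last exact: interval_open.
by move=> x _; exact: cf.
Qed.

Lemma measurable_affine (a : R) (y : V) : measurable_fun setT (fun x : V => a *: x + y).
Proof.
apply: measurable_fun_coordP => i.
under eq_fun do rewrite !mxE.
apply: measurable_funD => //; apply: measurable_funM => //.
exact: measurable_coord.
Qed.

Lemma measurable_dotp_l (c : V) : measurable_fun setT (fun x : V => dotp c x).
Proof.
apply: (@measurable_sum _ _ _ setT _ _ (fun i (x : V) => c ord0 i * x ord0 i)) => i.
by apply: measurable_funM => //; exact: measurable_coord.
Qed.

Lemma measurable_dotp : measurable_fun setT (fun z : V * V => dotp z.1 z.2).
Proof.
apply: (@measurable_sum _ _ _ setT _ _ (fun i (z : V * V) => z.1 ord0 i * z.2 ord0 i)) => i.
apply: measurable_funM => //.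
- exact: (measurableT_comp (measurable_coord i) measurable_fst).
- exact: (measurableT_comp (measurable_coord i) measurable_snd).
Qed.

End measurability_rV.

Section lebesgue_rV_theory.
Context {R : realType}.
Local Open Scope ereal_scope.
Local Notation leb := (@lebesgue_measure R).

Lemma ge0_integral_rVS n (f : 'rV[R]_n.+1 -> \bar R) :
  measurable_fun setT f -> (forall x, 0 <= f x) ->
  \int[@lebesgue_rV R n.+1]_x f x =
  \int[leb]_t \int[@lebesgue_rV R n]_x f (rV_cons (t, x)).
Proof.
move=> mf f0.
transitivity (\int[leb \x @lebesgue_rV R n]_z (f \o @rV_cons R n) z).
  have := ge0_integral_pushforward (@measurable_rV_cons R n)
    (leb \x @lebesgue_rV R n) measurableT mf (fun y _ => f0 y).
  by rewrite preimage_setT.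
rewrite fubini_tonelli1//; last by move=> z; exact: f0.
apply: measurableT_comp => //; exact: measurable_rV_cons.
Qed.

Lemma integral_rV0 (f : 'rV[R]_0 -> \bar R) : measurable_fun setT f ->
  \int[@lebesgue_rV R 0]_x f x = f 0%R.
Proof. by move=> mf; rewrite /= integral_dirac// diracT mul1e. Qed.

(** Both sides are measures in [A] which agree on half-open intervals. *)
Lemma lebesgue_measure_affine (a b : R) (A : set R) : (0 < a)%R ->
  measurable (A : set (measurableTypeR R)) ->
  leb A = a%:E * leb ((fun t => a * t + b)%R @^-1` A).
Proof.
move=> a0 mA.
have mphi : measurable_fun setT ((fun t => a * t + b)%R : measurableTypeR R -> measurableTypeR R).
  by apply: measurable_funD => //; exact: measurable_funM.
pose Q : {measure set (measurableTypeR R) -> \bar R} :=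
  measure_function_pushforward__canonical__measure_function_Measure leb mphi.
pose m : {measure set (measurableTypeR R) -> \bar R} := mscale (NngNum (ltW a0)) Q.
rewrite -[RHS]/(m A); apply: lebesgue_measure_unique => // _ [[u v]] /= _ <-.
rewrite /m /mscale/= /Q/= /pushforward.
have -> : (fun t => a * t + b)%R @^-1` `]u, v] = `]((u - b) / a)%R, ((v - b) / a)%R]%classic.
  by apply/seteqP; split => t /=; rewrite !in_itv/= ltr_pdivrMr// ler_pdivlMr// ltrBlDr lerBrDr mulrC.
rewrite !lebesgue_measure_itv/= !lte_fin ltr_pM2r ?invr_gt0// ltrD2r.
case: ifP => _; last by rewrite mule0.
rewrite -!EFinD -EFinM; congr (_%:E); field; exact: lt0r_neq0.
Qed.

Definition box n (A : 'I_n -> set R) : set 'rV[R]_n := [set x | forall i, A i (x ord0 i)].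

Lemma measurable_box n (A : 'I_n -> set R) :
  (forall i, measurable (A i : set (measurableTypeR R))) -> measurable (box A).
Proof.
move=> mA; rewrite [X in measurable X](_ : _ =
    \bigcap_i ((fun x : 'rV[R]_n => x ord0 i) @^-1` A i)).
  apply: fin_bigcap_measurable => [|i _]; first exact: finite_finset.
  by rewrite -[X in measurable X]setTI; exact: measurable_coord.
by apply/seteqP; split => x h i; [move=> _|]; exact: h.
Qed.

Let box_gen n := [set box A | A in [set A : 'I_n -> set R |
  forall i, measurable (A i : set (measurableTypeR R))]].

Let box_genE n : (@measurable _ 'rV[R]_n) = <<s @box_gen n >>.
Proof.
apply/seteqP; split; last first.
  by apply: smallest_sub => [|_ [A mA <-]]; [exact: sigma_algebra_measurable|exact: measurable_box].
apply: smallest_sub; first exact: smallest_sigma_algebra.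
rewrite -bigcup_seq; apply: bigcup_sub => i _ _ [B mB <-].
apply: sub_sigma_algebra; exists (fun j => if j == i then B else setT).
  by move=> j /=; case: ifP.
apply/seteqP; split => x /=; rewrite /box/=.
  by move=> /(_ i); rewrite eqxx.
by move=> [_ Bx] j; case: eqP => // ->.
Qed.

Lemma lebesgue_rV_cube n (c : 'rV[R]_n) (r : R) : (0 <= r)%R ->
  lebesgue_rV (box (fun i => `[(c ord0 i - r)%R, (c ord0 i + r)%R]%classic)) = ((2 * r) ^+ n)%:E.
Proof.
move=> r0; rewrite lebesgue_rV_box; last by move=> i; exact: measurable_itv.
rewrite (eq_bigr (fun=> (2 * r)%:E)).
  by rewrite -(big_morph EFin EFinM erefl) prodr_const card_ord.
move=> i _; rewrite lebesgue_measure_itv/= lte_fin -EFinD.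
case: ltP => h; first by congr (_%:E); ring.
by congr (_%:E); apply/eqP; lra.
Qed.

(** As on the line, by uniqueness of a measure on the boxes, where it is a product. *)
Lemma lebesgue_rV_affine n (a : R) (y : 'rV[R]_n) (A : set 'rV[R]_n) : (0 < a)%R ->
  measurable A ->
  lebesgue_rV A = (a ^+ n)%:E * lebesgue_rV ((fun x => a *: x + y)%R @^-1` A).
Proof.
move=> a0 mA.
pose Q : {measure set 'rV[R]_n -> \bar R} :=
  measure_function_pushforward__canonical__measure_function_Measure
    (@lebesgue_rV R n) (measurable_affine a y).
pose m : {measure set 'rV[R]_n -> \bar R} := mscale (NngNum (ltW (exprn_gt0 n a0))) Q.
rewrite -[RHS]/(m A).
pose g (k : nat) : set 'rV[R]_n := box (fun i => `[(- k%:R)%R, k%:R%R]%classic).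
have mg k (i : 'I_n) : measurable (`[(- k%:R)%R, k%:R%R]%classic : set (measurableTypeR R)).
  exact: measurable_itv.
apply: (@measure_unique _ _ _ (@box_gen n) g) => //.
- exact: box_genE.
- move=> _ _ [A1 mA1 <-] [A2 mA2 <-]; exists (fun i => A1 i `&` A2 i).
    by move=> i /=; exact: measurableI.
  by apply/seteqP; split => x; rewrite /box/=; [move=> h; split => i; have [] := h i|move=> [h1 h2] i; split].
- by move=> k; exists (fun=> `[(- k%:R)%R, k%:R%R]%classic) => // i; exact: mg.
- apply/seteqP; split => // x _.
  exists (Num.truncn (\sum_(i < n) `|x ord0 i|)%R).+1 => // i /=.
  rewrite in_itv/= -ler_norml; apply: le_trans (ltW (truncnS_gt _)).
  by rewrite (bigD1 i)//= lerDl sumr_ge0.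
- move=> _ [B mB <-]; rewrite -[RHS]/((a ^+ n)%:E * lebesgue_rV ((fun x => a *: x + y)%R @^-1` box B)).
  rewrite (_ : _ @^-1` _ = box (fun i => (fun t => a * t + y ord0 i)%R @^-1` B i)); last first.
    by apply/seteqP; split => x; rewrite /box/= => h i; have := h i; rewrite !mxE.
  rewrite -[LHS]/(lebesgue_rV (box B)) (lebesgue_rV_box mB) lebesgue_rV_box//; last first.
    move=> i; rewrite -[X in measurable X]setTI.
    suff mphi : measurable_fun setT ((fun t => a * t + y ord0 i)%R : measurableTypeR R -> measurableTypeR R) by exact: mphi.
    by apply: measurable_funD => //; exact: measurable_funM.
  transitivity (\prod_(i < n) (a%:E * leb ((fun t : R => a * t + y ord0 i)%R @^-1` B i))).
    by apply: eq_bigr => i _; exact: lebesgue_measure_affine.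
  rewrite big_split/=; congr (_ * _).
  by rewrite -(big_morph EFin EFinM erefl) prodr_const card_ord.
- move=> k; have := @lebesgue_rV_cube n 0%R k%:R (ler0n _ _).
  rewrite (_ : box _ = g k); first by move=> h; rewrite -[X in X < _]/(lebesgue_rV (g k)) h ltry.
  by apply/seteqP; split => x h i; have := h i; rewrite /= mxE sub0r add0r.
Qed.

Lemma ge0_integral_affine n (a : R) (y : 'rV[R]_n) (f : 'rV[R]_n -> \bar R) : (0 < a)%R ->
  measurable_fun setT f -> (forall x, 0 <= f x) ->
  \int[@lebesgue_rV R n]_x f x = (a ^+ n)%:E * \int[@lebesgue_rV R n]_x f (a *: x + y)%R.
Proof.
move=> a0 mf f0.
pose Q : {measure set 'rV[R]_n -> \bar R} :=
  measure_function_pushforward__canonical__measure_function_Measure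
    (@lebesgue_rV R n) (measurable_affine a y).
pose m : {measure set 'rV[R]_n -> \bar R} := mscale (NngNum (ltW (exprn_gt0 n a0))) Q.
transitivity (\int[m]_x f x).
  by apply: eq_measure_integral => A mA _; exact: lebesgue_rV_affine.
rewrite /m ge0_integral_mscale//=; congr (_ * _).
have := ge0_integral_pushforward (measurable_affine a y) (@lebesgue_rV R n) measurableT mf (fun y _ => f0 y).
by rewrite preimage_setT.
Qed.

Lemma integrable_affine n (a : R) (y : 'rV[R]_n) (f : 'rV[R]_n -> \bar R) : (0 < a)%R ->
  (@lebesgue_rV R n).-integrable setT f ->
  (@lebesgue_rV R n).-integrable setT (fun x => f (a *: x + y)%R).
Proof.
move=> a0 /integrableP[mf fi]; apply/integrableP; split.
  exact: (measurableT_comp mf (measurable_affine a y)).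
have := @ge0_integral_affine n a y (abse \o f) a0 (measurableT_comp (@abse_measurable R setT) mf) (fun x => abse_ge0 _).
move=> E; rewrite /= in E; move: fi; rewrite E.
case: (\int[@lebesgue_rV R n]_x `|f (a *: x + y)%R|) => [r _|/=|_ //]; first by rewrite ltry.
by rewrite gt0_muley// lte_fin exprn_gt0.
Qed.

Lemma integral_affine n (a : R) (y : 'rV[R]_n) (f : 'rV[R]_n -> \bar R) : (0 < a)%R ->
  (@lebesgue_rV R n).-integrable setT f ->
  \int[@lebesgue_rV R n]_x f x = (a ^+ n)%:E * \int[@lebesgue_rV R n]_x f (a *: x + y)%R.
Proof.
move=> a0 fi; have fai := integrable_affine y a0 fi.
have mf := measurable_int _ fi.
rewrite integralE [in RHS]integralE.
rewrite (@ge0_integral_affine n a y (f^\+))//; last exact: measurable_funepos.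
rewrite (@ge0_integral_affine n a y (f^\-))//; last exact: measurable_funeneg.
pose g (x : 'rV[R]_n) : \bar R := f (a *: x + y)%R.
have gB : \int[@lebesgue_rV R n]_x g^\- x \is a fin_num.
  by apply: (integrable_fin_num measurableT); exact: (integrable_funeneg measurableT fai).
have gD : \int[@lebesgue_rV R n]_x g^\+ x +? - \int[@lebesgue_rV R n]_x g^\- x.
  by apply: fin_num_adde_defl; rewrite fin_numN.
have := @muleBr R (a ^+ n)%:E _ _ isT gD.
move=> /esym E; rewrite -[RHS]/((a ^+ n)%:E *
  (\int[@lebesgue_rV R n]_x g^\+ x - \int[@lebesgue_rV R n]_x g^\- x)) -E.
by congr (_ * _ - _ * _); apply: eq_integral => x _; rewrite ?funeposE ?funenegE.
Qed.

End lebesgue_rV_theory.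

Section complex_integral_rV.
Context {R : realType}.
Local Notation C := R[i].
Local Notation Re := (@complex.Re R).
Local Notation Im := (@complex.Im R).
Local Notation leb := (@lebesgue_measure R).
Local Notation lebV n := (@lebesgue_rV R n).

Lemma cintb_affine n (a : R) (y : 'rV[R]_n) (f : 'rV[R]_n -> C) : 0 < a ->
  cintb (lebV n) f -> cintb (lebV n) (fun x => f (a *: x + y)).
Proof. by move=> a0 [f1 f2]; split; [exact: integrable_affine f1|exact: integrable_affine f2]. Qed.

Lemma cint_affine n (a : R) (y : 'rV[R]_n) (f : 'rV[R]_n -> C) : 0 < a ->
  cintb (lebV n) f ->
  cint (lebV n) f = real_complex R (a ^+ n) * cint (lebV n) (fun x => f (a *: x + y)).
Proof.
move=> a0 fi; have [g1 g2] := cintb_affine y a0 fi; have [f1 f2] := fi.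
apply: complexP; rewrite ?cReM ?cImM/= ?mul0r ?subr0 ?addr0 /Rintegral.
  by rewrite (@integral_affine _ n a y _ a0 f1) fineM//; exact: integrable_fin_num.
by rewrite (@integral_affine _ n a y _ a0 f2) fineM//; exact: integrable_fin_num.
Qed.

Lemma ge0_integral_prod_rV n (k : R -> R) (c : R) : measurable_fun setT k ->
  (forall t, 0 <= k t) -> (\int[leb]_t (k t)%:E)%E = c%:E ->
  (\int[lebV n]_x (\prod_(i < n) k (x ord0 i))%:E)%E = (c ^+ n)%:E.
Proof.
move=> mk k0 kc.
have m n' : measurable_fun setT (fun x : 'rV[R]_n' => (\prod_(i < n') k (x ord0 i))%:E).
  apply/measurable_EFinP; apply: measurable_prod => i _.
  by apply: measurableT_comp => //; exact: measurable_coord.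
elim: n => [|n IH].
  by rewrite integral_rV0// big_ord0 expr0.
rewrite ge0_integral_rVS//; last by move=> x; rewrite lee_fin prodr_ge0.
transitivity (\int[leb]_t ((k t)%:E * (c ^+ n)%:E))%E.
  apply: eq_integral => t _; rewrite -IH -ge0_integralZl ?lee_fin//; last first.
  - by move=> x _; rewrite lee_fin prodr_ge0.
  - exact: m.
  apply: eq_integral => x _; rewrite big_ord_recl -EFinM; congr (_ * _)%:E.
    by rewrite mxE unlift_none.
  by apply: eq_bigr => i _; rewrite mxE liftK.
rewrite ge0_integralZr//; last 3 first.
- exact/measurable_EFinP.
- by move=> t _; rewrite lee_fin.
- rewrite lee_fin exprn_ge0//; rewrite -lee_fin -kc; apply: integral_ge0 => t _.
  by rewrite lee_fin.
by rewrite kc -EFinM exprS.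
Qed.

Lemma cint_rVS n (f : 'rV[R]_n.+1 -> C) : cmeas f ->
  cintb (leb \x lebV n)%E (f \o @rV_cons R n) ->
  cintb (lebV n.+1) f /\
  cint (lebV n.+1) f = cint (leb \x lebV n)%E (f \o @rV_cons R n).
Proof.
move=> [mf1 mf2] [if1 if2]; have mc := @measurable_rV_cons R n.
have key (g : 'rV[R]_n.+1 -> R) : measurable_fun setT g ->
    (leb \x lebV n)%E.-integrable setT (EFin \o (g \o @rV_cons R n)) ->
    (lebV n.+1).-integrable setT (EFin \o g) /\
    (\int[lebV n.+1]_x (g x)%:E = \int[leb \x lebV n]_z (g (rV_cons z))%:E)%E.
  move=> mg ig; have mg' : measurable_fun setT (EFin \o g) by exact/measurable_EFinP.
  split; first exact: (@integrable_pushforward _ _ _ _ _ _ mc (leb \x lebV n)%E setT _ mg' ig measurableT).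
  exact: (@integral_pushforward _ _ _ _ _ _ mc (leb \x lebV n)%E setT _ mg' ig measurableT).
have [? E1] := key _ mf1 if1; have [? E2] := key _ mf2 if2.
by split; [split|apply: complexP; rewrite /= /Rintegral ?E1 ?E2].
Qed.

Lemma cint_prod_rV n (k : 'I_n -> R -> C) : (forall i, cintb leb (k i)) ->
  cintb (lebV n) (fun x => \prod_(i < n) k i (x ord0 i)) /\
  cint (lebV n) (fun x => \prod_(i < n) k i (x ord0 i)) = \prod_(i < n) cint leb (k i).
Proof.
elim: n k => [|n IH] k Ik.
  have E (x : 'rV[R]_0) : \prod_(i < 0) k i (x ord0 i) = 1 by rewrite big_ord0.
  split.
    apply/cintbP; split; first by under eq_fun do rewrite E; exact: cmeas_cst.
    under eq_integral do rewrite E.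
    by rewrite integral_rV0//= ltry.
  rewrite (eq_cint _ E) big_ord0; apply: complexP; rewrite /= /Rintegral integral_rV0//=.
have [I1 E1] := IH (fun i => k (lift ord0 i)) (fun i => Ik _).
have [I2 E2] := cint_tensor (Ik ord0) I1.
set f := fun x => _.
have fh : f \o @rV_cons R n =
    fun z => k ord0 z.1 * \prod_(i < n) k (lift ord0 i) (z.2 ord0 i).
  apply/funext => z; rewrite /f /= big_ord_recl; congr (_ * _); first by rewrite mxE unlift_none.
  by apply: eq_bigr => i _; rewrite mxE liftK.
have mf : cmeas f.
  apply: cmeas_prod => i.
  exact: (cmeas_comp (measurable_coord i) (cintb_cmeas (Ik i))).
rewrite -fh in I2 E2.
have [I3 ->] := cint_rVS mf I2.
by rewrite big_ord_recl -E1 -E2.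
Qed.

End complex_integral_rV.

(** * The one-dimensional kernel exp(-|t|) and its Fourier transform *)

Section exp_kernel.
Context {R : realType}.
Local Notation leb := (@lebesgue_measure R).
Local Notation C := R[i].

(** This kernel replaces the Gaussian: its transform needs only a primitive, and it is
    integrable together with it, which suffices for Fourier inversion. *)
Definition ekernel (t : R) : R := expR (- `|t|).

Lemma continuous_ekernel : continuous ekernel.
Proof.
move=> t; apply: continuous_comp; last exact: continuous_expR.
by apply: continuousN; exact: norm_continuous.
Qed.

Lemma ekernel_ge0 t : 0 <= ekernel t. Proof. exact: expR_ge0. Qed.

Lemma ekernelN t : ekernel (- t) = ekernel t.
Proof. by rewrite /ekernel normrN. Qed.

Lemma ekernel_le1 t : ekernel t <= 1.
Proof. by rewrite /ekernel -[leRHS]expR0 ler_expR oppr_le0. Qed.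

Lemma measurable_ekernel : measurable_fun setT ekernel.
Proof. by apply: continuous_measurable_fun; exact: continuous_ekernel. Qed.

Lemma continuous_mulr_cst (s : R) : continuous (fun u : R => u * s).
Proof. by move=> t; apply: cvgM; [exact: cvg_id|exact: cvg_cst]. Qed.

Let cvg_expRN_bounded (g : R -> R) (M : R) : (forall t, `|g t| <= M) ->
  (fun t => expR (- t) * g t) @ +oo --> (0 : R).
Proof.
move=> gM; have h (c : R) : (fun t => expR (- t) * c) @ +oo --> (0 : R).
  by rewrite -[X in _ --> X](mul0r c); apply: cvgM; [exact: cvgr_expR|exact: cvg_cst].
apply: (squeeze_cvgr _ (h (- M)) (h M)); apply: nearW => t.
by rewrite !ler_pM2l ?expR_gt0// -ler_norml.
Qed.

Let den (s : R) : 1 + s ^+ 2 != 0.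
Proof. by rewrite gt_eqF// ltr_pwDl// sqr_ge0. Qed.

(* A primitive of [exp(-t) (1 + cos(ts))]; adding 1 to the cosine makes the integrand
   nonnegative, so that the fundamental theorem on a half-line applies. *)
Let prim (s t : R) : R := expR (- t) * ((s * sin (t * s) - cos (t * s)) / (1 + s ^+ 2) - 1).

Let prim_derive (s t : R) : is_derive t 1 (prim s) (expR (- t) * (1 + cos (t * s))).
Proof.
have d0 : is_derive t (1 : R) (fun u : R => expR (- u)) (- expR (- t)).
  by apply: is_derive_eq; rewrite mulrN1.
have ds : is_derive t (1 : R) (fun u : R => u * s) s.
  by apply: is_derive_eq; rewrite scaler0 add0r scaler1.
have d1 : is_derive t (1 : R) (fun u : R => sin (u * s)) (cos (t * s) * s).
  exact: (@is_derive1_comp _ _ _ _ _ _ (is_derive_sin _) ds).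
have d2 : is_derive t (1 : R) (fun u : R => cos (u * s)) (- sin (t * s) * s).
  exact: (@is_derive1_comp _ _ _ _ _ _ (is_derive_cos _) ds).
pose G u := (s * sin (u * s) - cos (u * s)) / (1 + s ^+ 2) - 1.
have d3 : is_derive t (1 : R) G ((s * (cos (t * s) * s) - (- sin (t * s) * s)) / (1 + s ^+ 2)).
  rewrite /G; apply: is_derive_eq.
  by rewrite /GRing.scale/= !mulr0 add0r subr0 mulrC.
rewrite (_ : prim s = (fun u => expR (- u)) * G)//; apply: is_derive_eq.
by rewrite /GRing.scale/= /G; field.
Qed.

Let fcos (s t : R) : R := ekernel t * (1 + cos (t * s)).

Let fcos_ge0 s t : 0 <= fcos s t.
Proof. by rewrite mulr_ge0 ?ekernel_ge0// -lerBlDl sub0r cos_geN1. Qed.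

Let continuous_fcos s : continuous (fcos s).
Proof.
move=> t; apply: cvgM; first exact: continuous_ekernel.
apply: cvgD; first exact: cvg_cst.
by apply: (continuous_comp (@continuous_mulr_cst s t)); exact: continuous_cos.
Qed.

Let int_half_fcos s :
  (\int[leb]_(t in `[0%R, +oo[) (fcos s t)%:E = (1 + (1 + s ^+ 2)^-1)%:E)%E.
Proof.
rewrite (@ge0_continuous_FTC2y _ (fcos s) (prim s) 0 0).
- rewrite /prim oppr0 expR0 mul0r sin0 cos0 -EFinB; congr (_%:E).
  by rewrite mulr0 sub0r mul1r; field.
- by move=> x _; exact: fcos_ge0.
- by apply: continuous_subspaceT; exact: continuous_fcos.
- apply: (@cvg_expRN_bounded _ (`|s| + 2)) => t.
  rewrite (le_trans (ler_normB _ _))// normr1 (_ : 2 = 1 + 1)// addrA lerD2r.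
  rewrite normrM normfV (@ger0_norm _ (1 + s ^+ 2)) ?addr_ge0 ?sqr_ge0//.
  rewrite ler_pdivrMr ?ltr_pwDl ?sqr_ge0//.
  apply: (@le_trans _ _ (`|s| + 1)).
    rewrite (le_trans (ler_normB _ _))// lerD ?cos_max//.
      by rewrite normrM ler_piMr// sin_max.
  by rewrite ler_peMr// ?addr_ge0// lerDl sqr_ge0.
- by move=> x _; have [] := prim_derive s x.
- apply: cvg_at_right_filter; apply: differentiable_continuous.
  by apply/derivable1_diffP; have [] := prim_derive s 0.
- move=> x; rewrite in_itv/= andbT => x0; rewrite derive1E.
  by have [_ ->] := prim_derive s x; rewrite /fcos /ekernel gtr0_norm.
Qed.

Let int_fcos s : (\int[leb]_t (fcos s t)%:E = (2 + 2 / (1 + s ^+ 2))%:E)%E.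
Proof.
rewrite ge0_symfun_integralT//.
- rewrite (_ : [set x | _] = `[0, +oo[%classic); last first.
    by apply/seteqP; split => x/=; rewrite in_itv/= andbT.
  by rewrite int_half_fcos -EFinM; congr (_%:E); field.
- by move=> t; rewrite /fcos/= ekernelN mulNr cosN.
Qed.

Lemma integral_ekernel : (\int[leb]_t (ekernel t)%:E = 2%:E)%E.
Proof.
have := int_fcos 0; rewrite expr0n/= addr0 divr1 (_ : 2 + 2 = 2 * 2 :> R)%R; last by ring.
under eq_integral do rewrite /fcos mulr0 cos0 mulrC EFinM.
rewrite ge0_integralZl//; last 2 first.
- by apply/measurable_EFinP; exact: measurable_ekernel.
- by move=> t _; rewrite lee_fin ekernel_ge0.
rewrite EFinM (_ : (1 + 1 = 2 :> R)%R)//; move: (\int[leb]_t _)%E => [r| |]//=.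
- by move=> [h]; congr (_%:E); lra.
- by rewrite gt0_muley.
- by rewrite gt0_muleNy.
Qed.

Lemma integrable_ekernel : leb.-integrable setT (EFin \o ekernel).
Proof.
apply/integrableP; split; first by apply/measurable_EFinP; exact: measurable_ekernel.
under eq_integral do rewrite /= ger0_norm ?ekernel_ge0//.
by rewrite integral_ekernel ltry.
Qed.

Let ge0_integral_reflect (f : R -> \bar R) : measurable_fun setT f ->
  (forall t, 0 <= f t)%E -> (\int[leb]_t f t = \int[leb]_t f (- t)%R)%E.
Proof.
move=> mf f0.
have mN : measurable_fun setT (-%R : measurableTypeR R -> measurableTypeR R) by exact: oppr_measurable.
transitivity (\int[pushforward leb (-%R : _ -> measurableTypeR R)]_t f t)%E.
  by apply: eq_measure_integral => A mA _; rewrite [RHS]lebesgue_measureN.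
have := ge0_integral_pushforward mN leb measurableT mf (fun y _ => f0 y).
by rewrite preimage_setT.
Qed.

Lemma integral_reflect (f : R -> R) : measurable_fun setT f ->
  (\int[leb]_t (f t)%:E = \int[leb]_t (f (- t))%:E)%E.
Proof.
move=> mf; have mf' : measurable_fun setT (EFin \o f) by exact/measurable_EFinP.
rewrite integralE [in RHS]integralE.
rewrite (@ge0_integral_reflect (fun t => (f t)%:E)^\+)%E//; last exact: measurable_funepos.
rewrite (@ge0_integral_reflect (fun t => (f t)%:E)^\-)%E//; last exact: measurable_funeneg.
by congr (_ - _)%E; apply: eq_integral => x _; rewrite ?funeposE ?funenegE.
Qed.

(** The real part is read off [int_fcos], and the imaginary one vanishes by oddness. *)
Lemma cint_ekernel s : cintb leb (fun t => real_complex R (ekernel t) * expi (t * s)) /\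
  cint leb (fun t => real_complex R (ekernel t) * expi (t * s)) =
  real_complex R (2 / (1 + s ^+ 2)).
Proof.
have I1 : cintb leb (fun t => real_complex R (ekernel t) * expi (t * s)).
  refine (@cintb_le R _ _ leb _ ekernel _ _ _); last exact: integrable_ekernel.
    apply: cmeasM; first by split; [exact: measurable_ekernel|exact: measurable_cst].
    by apply: cmeas_expi; apply: continuous_measurable_fun; exact: continuous_mulr_cst.
  by move=> t; rewrite cabsM cabs_expi mulr1 cabs_real ger0_norm// ekernel_ge0.
split => //; have [i1 i2] := I1.
have ReE t : complex.Re (real_complex R (ekernel t) * expi (t * s)) = ekernel t * cos (t * s).
  by rewrite cReM /= mul0r subr0.
have ImE t : complex.Im (real_complex R (ekernel t) * expi (t * s)) = ekernel t * sin (t * s).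
  by rewrite cImM /= mul0r addr0.
have ic : leb.-integrable setT (EFin \o (fun t => ekernel t * cos (t * s))).
  by apply: (eq_integrable measurableT) i1 => t _; congr (_%:E); exact: ReE.
have isn : leb.-integrable setT (EFin \o (fun t => ekernel t * sin (t * s))).
  by apply: (eq_integrable measurableT) i2 => t _; congr (_%:E); exact: ImE.
apply: complexP => /=; rewrite /Rintegral.
  under eq_integral do rewrite mul0r subr0.
  have E : (\int[leb]_t (fcos s t)%:E =
      \int[leb]_t (ekernel t)%:E + \int[leb]_t (ekernel t * cos (t * s))%:E)%E.
    rewrite -integralD//; last exact: integrable_ekernel.
    by apply: eq_integral => t _; rewrite /fcos -EFinD; congr (_%:E); ring.
  move: E; rewrite int_fcos.
  rewrite integral_ekernel.
  have := integrable_fin_num measurableT ic.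
  move: (\int[leb]_t _)%E => [r| |]//= _ [] h.
  by rewrite -[RHS](addKr 2) h addKr.
under eq_integral do rewrite mul0r addr0.
have ms : measurable_fun setT (fun t : R => ekernel t * sin (t * s)).
  apply: measurable_funM; first exact: measurable_ekernel.
  apply: continuous_measurable_fun => t.
  by apply: (continuous_comp (@continuous_mulr_cst s t)); exact: continuous_sin.
have := integral_reflect ms.
under [in X in _ = X -> _]eq_integral do rewrite ekernelN mulNr sinN mulrN EFinN.
rewrite (integralN (integrable_add_def measurableT isn))/=.
have := integrable_fin_num measurableT isn.
move: (\int[leb]_t _)%E => [r| |]//= _ [].
by move=> h; lra.
Qed.

Lemma integral_poisson : (\int[leb]_t (2 / (1 + t ^+ 2))%:E = (2 * pi)%:E)%E.
Proof.
have c1 : continuous (fun t : R => (1 + t ^+ 2)^-1).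
  move=> t; apply: cvgV; first exact: den.
  by apply: cvgD; [exact: cvg_cst|exact: exprn_continuous].
under eq_integral do rewrite EFinM.
rewrite ge0_integralZl//; last 2 first.
- by apply/measurable_EFinP; apply: continuous_measurable_fun.
- by move=> t _; rewrite lee_fin invr_ge0 addr_ge0// sqr_ge0.
rewrite ge0_symfun_integralT//; last 2 first.
- by move=> t; rewrite invr_ge0 addr_ge0// sqr_ge0.
- by move=> t /=; rewrite sqrrN.
rewrite (_ : [set x | _] = `[0, +oo[%classic); last first.
  by apply/seteqP; split => x/=; rewrite in_itv/= andbT.
rewrite (@ge0_continuous_FTC2y _ _ atan 0 (pi / 2)).
- by rewrite atan0 -EFinB -!EFinM; congr (_%:E); rewrite subr0; field.
- by move=> t _; rewrite invr_ge0 addr_ge0// sqr_ge0.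
- exact: continuous_subspaceT.
- exact: cvgy_atan.
- by move=> t _; exact: derivable_atan.
- by apply: cvg_at_right_filter; exact: continuous_atan.
- by move=> t _; rewrite derive1_atan.
Qed.

End exp_kernel.

(** * The Fourier transform on R^n *)

Section dotp_theory.
Context {R : realType} {n : nat}.
Implicit Types x y : 'rV[R]_n.

Lemma dotpC x y : dotp x y = dotp y x.
Proof. by apply: eq_bigr => i _; rewrite mulrC. Qed.

Lemma dotpDl x y z : dotp (x + y) z = dotp x z + dotp y z.
Proof. by rewrite /dotp -big_split; apply: eq_bigr => i _; rewrite !mxE mulrDl. Qed.

Lemma dotpZl (a : R) x y : dotp (a *: x) y = a * dotp x y.
Proof. by rewrite /dotp mulr_sumr; apply: eq_bigr => i _; rewrite !mxE mulrA. Qed.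

Lemma dotpZr (a : R) x y : dotp x (a *: y) = a * dotp x y.
Proof. by rewrite dotpC dotpZl dotpC. Qed.

Lemma dotpDr x y z : dotp x (y + z) = dotp x y + dotp x z.
Proof. by rewrite dotpC dotpDl !(dotpC x). Qed.

Lemma dotpNl x y : dotp (- x) y = - dotp x y.
Proof. by rewrite -scaleN1r dotpZl mulN1r. Qed.

Lemma dotp_delta i (a : R) x : dotp (a *: delta_mx ord0 i) x = a * x ord0 i.
Proof.
rewrite dotpZl; congr (_ * _); rewrite /dotp (bigD1 i)//= mxE !eqxx mul1r big1 ?addr0// => j ji.
by rewrite mxE eqxx (negbTE ji) mul0r.
Qed.

Lemma expi_sum (I : Type) (r : seq I) (f : I -> R) :
  expi (\sum_(i <- r) f i) = \prod_(i <- r) expi (f i).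
Proof. by elim/big_ind2 : _ => [|a b c d <- <-|//]; [exact: expi0|exact: expiD]. Qed.

End dotp_theory.

Section product_kernels.
Context {R : realType} {n : nat}.
Local Notation V := 'rV[R]_n.
Local Notation lebV := (@lebesgue_rV R n).

Definition ekernelV (x : V) : R := \prod_(i < n) ekernel (x ord0 i).
Definition poissonV (x : V) : R := \prod_(i < n) (2 / (1 + x ord0 i ^+ 2)).

Lemma ekernelV_gt0 x : 0 < ekernelV x.
Proof. by apply: prodr_gt0 => i _; exact: expR_gt0. Qed.

Lemma ekernelV_le1 x : ekernelV x <= 1.
Proof.
by apply: prodr_ile1 => i _; rewrite ekernel_ge0 ekernel_le1.
Qed.

Lemma measurable_ekernelV : measurable_fun setT ekernelV.
Proof.
apply: measurable_prod => i _.
exact: (measurableT_comp measurable_ekernel (measurable_coord i)).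
Qed.

Lemma measurable_ekernelV_inv : measurable_fun setT (fun x => (ekernelV x)^-1).
Proof.
under eq_fun do rewrite /ekernelV -prodfV.
apply: measurable_prod => i _.
apply: (@measurableT_comp _ _ _ _ _ _ (fun t => (ekernel t)^-1)); last exact: measurable_coord.
apply: continuous_measurable_fun => t; apply: cvgV; first by rewrite gt_eqF// expR_gt0.
exact: continuous_ekernel.
Qed.

Lemma poissonV_ge0 x : 0 <= poissonV x.
Proof. by apply: prodr_ge0 => i _; rewrite divr_ge0// addr_ge0// sqr_ge0. Qed.

Lemma poissonV_le (x : V) : poissonV x <= 2 ^+ n.
Proof.
rewrite /poissonV -[X in 2 ^+ X](card_ord n) -prodr_const.
apply: ler_prod => i _; rewrite divr_ge0 ?addr_ge0 ?sqr_ge0//=.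
by rewrite ler_pdivrMr ?ler_peMr ?lerDl ?sqr_ge0// ltr_pwDl// sqr_ge0.
Qed.

Let measurable_p : measurable_fun setT (fun t : R => 2 / (1 + t ^+ 2)).
Proof.
apply: continuous_measurable_fun => t; apply: cvgM; first exact: cvg_cst.
apply: cvgV; first by rewrite gt_eqF// ltr_pwDl// sqr_ge0.
by apply: cvgD; [exact: cvg_cst|exact: exprn_continuous].
Qed.

Lemma measurable_poissonV : measurable_fun setT poissonV.
Proof.
apply: measurable_prod => i _.
exact: (measurableT_comp measurable_p (measurable_coord i)).
Qed.

Lemma integral_poissonV : (\int[lebV]_x (poissonV x)%:E)%E = ((2 * pi) ^+ n)%:E.
Proof.
apply: (@ge0_integral_prod_rV _ n (fun t => 2 / (1 + t ^+ 2))) => //; last exact: integral_poisson.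
by move=> t; rewrite divr_ge0// addr_ge0// sqr_ge0.
Qed.

Lemma integrable_poissonV : lebV.-integrable setT (EFin \o poissonV).
Proof.
apply/integrableP; split; first by apply/measurable_EFinP; exact: measurable_poissonV.
under eq_integral do rewrite /= ger0_norm ?poissonV_ge0//.
by rewrite integral_poissonV ltry.
Qed.

Lemma cintb_ekernelV : cintb lebV (fun x => real_complex R (ekernelV x)).
Proof.
refine (@cintb_le _ _ _ _ _ ekernelV _ _ _).
- by split; [exact: measurable_ekernelV|exact: measurable_cst].
- by move=> x; rewrite cabs_real ger0_norm// ltW// ekernelV_gt0.
apply/integrableP; split; first by apply/measurable_EFinP; exact: measurable_ekernelV.
under eq_integral do rewrite /= ger0_norm ?(ltW (ekernelV_gt0 _))//.
rewrite (ge0_integral_prod_rV n measurable_ekernel ekernel_ge0 integral_ekernel).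
by rewrite ltry.
Qed.

End product_kernels.

Section oscillatory.
Context {R : realType} {n : nat}.
Local Notation V := 'rV[R]_n.
Local Notation C := R[i].
Local Notation Re := (@complex.Re R).
Local Notation Im := (@complex.Im R).
Local Notation lebV := (@lebesgue_rV R n).

(** Both transforms at once: [osc (-1)] is the Fourier transform and [osc 1] is
    the inverse one up to the normalizing constant. *)
Definition osc (sg : R) (f : V -> C) (x : V) : C :=
  cint lebV (fun y => f y * expi (sg * dotp y x)).

Lemma fourier_osc f : fourier f = osc (-1) f.
Proof. by apply/funext => x; apply: eq_cint => y; rewrite mulN1r. Qed.

Lemma inv_fourier_osc f x : inv_fourier f x = real_complex R ((2 * pi) ^- n) * osc 1 f x.
Proof.
rewrite /inv_fourier /osc; congr (_ * _); rewrite -[LHS]/(cint lebV _).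
by apply: eq_cint => y; rewrite mul1r dotpC.
Qed.

Let cmeas_phase sg x : cmeas (fun y : V => expi (sg * dotp y x)).
Proof.
apply: cmeas_expi; apply: measurable_funM => //.
by under eq_fun do rewrite dotpC; exact: measurable_dotp_l.
Qed.

Lemma cintb_phase sg f x : cintb lebV f -> cintb lebV (fun y => f y * expi (sg * dotp y x)).
Proof.
by apply: (@cintbMr_bounded _ _ _ _ 1) => // y; rewrite cabs_expi.
Qed.

Lemma osc_bound sg f x (B : R) : cintb lebV f ->
  (\int[lebV]_y (cabs (f y))%:E <= B%:E)%E -> cabs (osc sg f x) <= 2 * B.
Proof.
move=> If fB; apply: le_cabs_cint_bound; first exact: cintb_phase.
by under eq_integral do rewrite cabsM cabs_expi mulr1.
Qed.

Lemma osc_bounded sg f : cintb lebV f -> exists B, forall x, cabs (osc sg f x) <= B.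
Proof.
move=> If; exists (2 * fine (\int[lebV]_y (cabs (f y))%:E)) => x.
apply: osc_bound => //; rewrite fineK//.
by apply: integrable_fin_num => //; exact: cintb_norm_integrable.
Qed.

Let tensor_meas sg f g : cintb lebV f -> cintb lebV g ->
  cmeas (fun z : V * V => f z.1 * g z.2 * expi (sg * dotp z.1 z.2)).
Proof.
move=> If Ig; apply: cmeasM; first apply: cmeasM.
- exact: (cmeas_comp measurable_fst (cintb_cmeas If)).
- exact: (cmeas_comp measurable_snd (cintb_cmeas Ig)).
- by apply: cmeas_expi; apply: measurable_funM => //; exact: measurable_dotp.
Qed.

Let tensor_fin sg f g : cintb lebV f -> cintb lebV g ->
  (\int[lebV]_x \int[lebV]_y (cabs (f x * g y * expi (sg * dotp x y)))%:E < +oo)%E.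
Proof.
move=> If Ig; have := cint_tensor_fin If Ig.
by under [in X in _ -> X]eq_integral do under eq_integral do rewrite cabsM cabs_expi mulr1.
Qed.

Let tensor_x sg f g x : cintb lebV g ->
  cintb lebV (fun y => f x * g y * expi (sg * dotp x y)).
Proof.
move=> Ig; under eq_fun do rewrite dotpC.
by apply: cintb_phase; exact: cintbZ.
Qed.

Let tensor_y sg f g y : cintb lebV f ->
  cintb lebV (fun x => f x * g y * expi (sg * dotp x y)).
Proof.
move=> If; apply: cintb_phase; under eq_fun do rewrite mulrC; exact: cintbZ.
Qed.

(** Fubini's theorem; all the identities between distributions below reduce to it. *)
Lemma osc_duality sg f g : cintb lebV f -> cintb lebV g ->
  cint lebV (fun x => osc sg f x * g x) = cint lebV (fun y => f y * osc sg g y).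
Proof.
move=> If Ig.
have := cint_fubini (tensor_meas sg If Ig) (tensor_fin sg If Ig) (fun x => tensor_x sg f x Ig) (fun y => tensor_y sg g y If).
move=> /= E; symmetry; transitivity (cint lebV (fun x => cint lebV (fun y => f x * g y * expi (sg * dotp x y)))).
  apply: eq_cint => x; rewrite -cintZ; last exact: cintb_phase.
  by apply: eq_cint => y; rewrite mulrA dotpC.
rewrite E; apply: eq_cint => y; rewrite mulrC -cintZ; last exact: cintb_phase.
by apply: eq_cint => x; ring.
Qed.

(** Measurability of the transform comes from Fubini's theorem, after inserting an
    integrable weight in the dual variable. *)
Lemma cmeas_osc sg f : cintb lebV f -> cmeas (osc sg f).
Proof.
move=> If; have Ig := @cintb_ekernelV R n.
have := cintb_fubini (tensor_meas sg Ig If) (tensor_fin sg Ig If) (fun x => tensor_x sg _ x If).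
move=> /= /cintb_cmeas h.
have E x : osc sg f x = real_complex R (ekernelV x)^-1 *
    cint lebV (fun y => real_complex R (ekernelV x) * f y * expi (sg * dotp x y)).
  rewrite -cintZ; last exact: (tensor_x sg (fun x => real_complex R (ekernelV x)) x If).
  apply: eq_cint => y; rewrite !mulrA -rmorphM mulVf ?gt_eqF ?ekernelV_gt0//.
  by rewrite rmorph1 mul1r dotpC.
rewrite (funext E); apply: cmeasM => //.
by split; [exact: measurable_ekernelV_inv|exact: measurable_cst].
Qed.

Lemma osc_affine sg f x (mu : R) (c : V) : 0 < mu -> cintb lebV f ->
  osc sg (fun y => f (mu^-1 *: (y - c))) x =
  real_complex R (mu ^+ n) * expi (sg * dotp c x) * osc sg f (mu *: x).
Proof.
move=> mu0 If.
have If' : cintb lebV (fun y => f (mu^-1 *: (y - c))).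
  have := cintb_affine (- (mu^-1 *: c)) _ If; rewrite -invr_gt0 in mu0.
  by move=> /(_ _ mu0); under eq_fun do rewrite -scalerBr.
rewrite /osc (cint_affine c mu0 (cintb_phase sg x If')) -mulrA; congr (_ * _).
rewrite -cintZ; last exact: cintb_phase.
apply: eq_cint => y; rewrite addrK scalerA mulVf ?gt_eqF// scale1r.
rewrite dotpDl mulrDr expiD dotpZl dotpZr; ring.
Qed.

Lemma osc_shift sg f x (h : V) : cintb lebV f ->
  osc sg (fun y => f (y + h)) x = expi (- (sg * dotp h x)) * osc sg f x.
Proof.
move=> If; have := @osc_affine sg f x 1 (- h) ltr01 If.
rewrite expr1n rmorph1 mul1r scale1r dotpNl mulrN => <-.
by apply: eq_cint => y; rewrite invr1 scale1r opprK.
Qed.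

Lemma oscD sg f g x : cintb lebV f -> cintb lebV g ->
  osc sg (fun y => f y + g y) x = osc sg f x + osc sg g x.
Proof.
move=> If Ig; rewrite /osc -cintD; [|exact: cintb_phase..].
by apply: eq_cint => y; rewrite mulrDl.
Qed.

Lemma oscZ sg c f x : cintb lebV f -> osc sg (fun y => c * f y) x = c * osc sg f x.
Proof.
move=> If; rewrite /osc -cintZ; last exact: cintb_phase.
by apply: eq_cint => y; rewrite mulrA.
Qed.

Lemma osc_sum sg (I : Type) (r : seq I) (f : I -> V -> C) x : (forall i, cintb lebV (f i)) ->
  osc sg (fun y => \sum_(i <- r) f i y) x = \sum_(i <- r) osc sg (f i) x.
Proof.
move=> If; rewrite /osc -cint_sum; last by move=> i; exact: cintb_phase.
by apply: eq_cint => y; rewrite mulr_suml.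
Qed.

(** A shift by [h] with [dotp h x = pi] changes the sign of the transform at [x]: this
    is how smoothness turns into decay without integrating by parts. *)
Definition diffop (h : V) (f : V -> C) : V -> C := fun y => f (y + h) - f y.

Lemma cintb_shift h f : cintb lebV f -> cintb lebV (fun y => f (y + h)).
Proof.
move=> If; rewrite (_ : (fun y => _) = (fun y => f (1 *: y + h))).
  exact: cintb_affine.
by apply/funext => y; rewrite scale1r.
Qed.

Lemma cintb_diffop h f : cintb lebV f -> cintb lebV (diffop h f).
Proof.
move=> If; apply: cintbD.
  exact: cintb_shift.
by under eq_fun do rewrite -mulN1r; exact: cintbZ.
Qed.

Lemma osc_diffop_iter h f x N : cintb lebV f -> dotp h x = pi ->
  osc 1 (iter N (diffop h) f) x = (-2) ^+ N * osc 1 f x.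
Proof.
move=> If hx; have II k : cintb lebV (iter k (diffop h) f).
  by elim: k => //= k; exact: cintb_diffop.
elim: N => [|N IH]; first by rewrite expr0 mul1r.
rewrite iterS exprS -mulrA -IH; set g := iter N _ f.
have Ig : cintb lebV g by exact: II.
have Ih : cintb lebV (fun y => g (y + h)) by exact: cintb_shift.
transitivity (osc 1 (fun y : V => g (y + h) + (-1) * g y) x).
  by apply: eq_cint => y; rewrite mulN1r.
rewrite oscD//; last exact: cintbZ.
rewrite oscZ// osc_shift// mul1r hx expiNpi; ring.
Qed.

End oscillatory.

Section inversion.
Context {R : realType} {n : nat}.
Local Notation V := 'rV[R]_n.
Local Notation C := R[i].
Local Notation Re := (@complex.Re R).
Local Notation Im := (@complex.Im R).
Local Notation lebV := (@lebesgue_rV R n).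
Local Notation RC := (real_complex R).

Let ek (k : nat) (x : V) : R := ekernelV (k.+1%:R^-1 *: x).

Let ek_bound k x : `|ek k x| <= 1.
Proof. by rewrite ger0_norm ?ekernelV_le1// ltW// ekernelV_gt0. Qed.

Let ek_meas k : cmeas (fun x => RC (ek k x)).
Proof.
split; last exact: measurable_cst.
apply: (measurableT_comp (@measurable_ekernelV R n)).
by rewrite (_ : ( *:%R _) = fun x : V => k.+1%:R^-1 *: x + 0); [exact: measurable_affine|apply/funext => x; rewrite addr0].
Qed.

Let ek_int k : cintb lebV (fun x => RC (ek k x)).
Proof.
have k0 : (0 : R) < k.+1%:R^-1 by rewrite invr_gt0.
have := cintb_affine 0 k0 (@cintb_ekernelV R n).
by under eq_fun do rewrite addr0.
Qed.

Let cvg_inv : (fun k : nat => k.+1%:R^-1 : R) @ \oo --> (0 : R).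
Proof. exact: cvg_harmonic. Qed.

Let ek_cvg x : (fun k => ek k x) @ \oo --> (1 : R).
Proof.
have E k : ek k x = expR (k.+1%:R^-1 * - (\sum_(i < n) `|x ord0 i|)).
  rewrite mulrN mulr_sumr -sumrN expR_sum; apply: eq_bigr => i _.
  by rewrite mxE /ekernel normrM ger0_norm.
rewrite (funext E); move: (- \sum_(i < n) `|x ord0 i|) => S.
have h : (fun k : nat => k.+1%:R^-1 * S) @ \oo --> 0 * S.
  by apply: cvgM; [exact: cvg_inv|exact: cvg_cst].
by have := cvg_comp _ _ h (@continuous_expR R _); rewrite mul0r expR0.
Qed.

Let cvg_mul1 (u : nat -> R) (c : R) : u @ \oo --> (1 : R) -> (fun k => u k * c) @ \oo --> c.
Proof.
move=> u1; rewrite -[X in _ --> X]mul1r; apply: cvgM => //; exact: cvg_cst.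
Qed.

Let poisson_meas (a : R) (y : V) : cmeas (fun w : V => RC (poissonV (a *: w + y))).
Proof.
split; last exact: measurable_cst.
exact: (measurableT_comp (@measurable_poissonV R n) (measurable_affine a y)).
Qed.

Let poisson_le (w : V) : cabs (RC (poissonV w)) <= 2 ^+ n.
Proof. by rewrite cabs_real ger0_norm ?poissonV_ge0// poissonV_le. Qed.

Let osc_ekernelV w : osc 1 (fun x : V => RC (ekernelV x)) w = RC (poissonV w).
Proof.
have [_ E] := @cint_prod_rV R n (fun i t => RC (ekernel t) * expi (t * w ord0 i))
  (fun i => (cint_ekernel (w ord0 i)).1).
rewrite /osc /poissonV RC_prod.
under [RHS]eq_bigr do rewrite -(cint_ekernel _).2.
rewrite -E; apply: eq_cint => x.
by rewrite /ekernelV RC_prod mul1r /dotp expi_sum -big_split.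
Qed.

Let osc_ek k w : osc 1 (fun x => RC (ek k x)) w =
  RC (k.+1%:R ^+ n) * RC (poissonV (k.+1%:R *: w)).
Proof.
have k0 : (0 : R) < k.+1%:R by [].
have := @osc_affine R n 1 (fun x : V => RC (ekernelV x)) w _ 0 k0 (@cintb_ekernelV R n).
rewrite osc_ekernelV mul1r (_ : dotp 0 w = 0) ?expi0 ?mulr1; last first.
  by rewrite /dotp big1// => i _; rewrite mxE mul0r.
by move=> <-; apply: eq_cint => y; rewrite subr0.
Qed.

(** Fourier inversion for a bounded continuous function with integrable transform,
    by Abel summation: inserting [ekernelV (x / (k + 1))] and moving the transform onto it
    averages [b] against a Poisson kernel concentrating at [y]; dominated convergence
    applies on both sides. *)
Lemma osc_inversion (b : V -> C) (M : R) (y : V) :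
  continuous (Re \o b) -> continuous (Im \o b) -> (forall x, cabs (b x) <= M) ->
  cintb lebV b -> cintb lebV (osc 1 b) ->
  osc (-1) (osc 1 b) y = RC ((2 * pi) ^+ n) * b y.
Proof.
move=> cR cI bM Ib If.
pose I_ k := cint lebV (fun x => RC (ek k x) * (osc 1 b x * expi (-1 * dotp x y))).
have Ife : cintb lebV (fun x => osc 1 b x * expi (-1 * dotp x y)) by exact: cintb_phase.
have mfe := cintb_cmeas Ife.
have IE k : I_ k = cint lebV (fun z => b (k.+1%:R^-1 *: z + y) * RC (poissonV z)).
  have k0 : (0 : R) < k.+1%:R^-1 by rewrite invr_gt0.
  pose G x := RC (ek k x) * expi (-1 * dotp x y).
  have IG : cintb lebV G by exact: cintb_phase.
  have oG w : osc 1 G w = RC (k.+1%:R ^+ n) * RC (poissonV (k.+1%:R *: (w - y))).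
    rewrite -osc_ek; apply: eq_cint => x; rewrite /G -mulrA -expiD; congr (_ * expi _).
    by rewrite dotpDr (dotpC x (- y)) dotpNl (dotpC y); ring.
  transitivity (cint lebV (fun x => osc 1 b x * G x)).
    by apply: eq_cint => x; rewrite /G; ring.
  rewrite osc_duality//.
  have Ibp : cintb lebV (fun w => b w * RC (poissonV (k.+1%:R *: (w - y)))).
    apply: (@cintbMr_bounded _ _ _ _ (2 ^+ n)) => //.
    by under eq_fun do rewrite scalerBr; exact: poisson_meas.
  transitivity (RC (k.+1%:R ^+ n) * cint lebV (fun w => b w * RC (poissonV (k.+1%:R *: (w - y))))).
    rewrite -cintZ//.
    by apply: eq_cint => w; rewrite oG; ring.
  rewrite (cint_affine y k0)//.
  rewrite mulrA -rmorphM -exprMn divff// expr1n rmorph1 mul1r.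
  apply: eq_cint => z; rewrite addrK scalerA divff// scale1r//.
have [cR1 cI1] : (fun k => Re (I_ k)) @ \oo --> Re (osc (-1) (osc 1 b) y) /\
    (fun k => Im (I_ k)) @ \oo --> Im (osc (-1) (osc 1 b) y).
  apply: (@cint_dominated _ _ _ _ _ _ (fun x => cabs (osc 1 b x * expi (-1 * dotp x y)))).
  - by move=> k; apply: cmeasM.
  - by [].
  - move=> x; under eq_fun do rewrite cReRM.
    by apply: cvg_mul1; exact: ek_cvg.
  - move=> x; under eq_fun do rewrite cImRM.
    by apply: cvg_mul1; exact: ek_cvg.
  - exact: cintb_norm_integrable.
  - by move=> k x; rewrite cabsM cabs_real ler_piMl ?cabs_ge0.
have mb := cintb_cmeas Ib.
have [cR2 cI2] : (fun k => Re (I_ k)) @ \oo --> Re (cint lebV (fun z => b y * RC (poissonV z))) /\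
    (fun k => Im (I_ k)) @ \oo --> Im (cint lebV (fun z => b y * RC (poissonV z))).
  rewrite (funext IE).
  have mp : cmeas (fun z : V => RC (poissonV z)).
    by split; [exact: measurable_poissonV|exact: measurable_cst].
  have cz z : (fun k : nat => (k.+1%:R^-1 : R) *: z + y) @ \oo --> y.
    rewrite -[X in _ --> X]add0r -(scale0r z); apply: cvgD; last exact: cvg_cst.
    by apply: cvgZr_tmp; exact: cvg_inv.
  apply: (@cint_dominated _ _ _ _ _ _ (fun z => M * poissonV z)).
  - move=> k; apply: cmeasM => //.
    exact: (cmeas_comp (measurable_affine _ _) mb).
  - by apply: cmeasM => //; exact: cmeas_cst.
  - move=> z; under eq_fun do rewrite mulrC cReRM mulrC.
    rewrite mulrC cReRM mulrC; apply: cvgM; last exact: cvg_cst.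
    exact: (cvg_comp _ _ (cz z) (cR y)).
  - move=> z; under eq_fun do rewrite mulrC cImRM mulrC.
    rewrite mulrC cImRM mulrC; apply: cvgM; last exact: cvg_cst.
    exact: (cvg_comp _ _ (cz z) (cI y)).
  - exact: (integrableZl measurableT M (@integrable_poissonV R n)).
  - move=> k z; rewrite cabsM cabs_real ger0_norm ?poissonV_ge0//.
    by rewrite ler_wpM2r ?poissonV_ge0.
have -> : osc (-1) (osc 1 b) y = cint lebV (fun z => b y * RC (poissonV z)).
  apply: complexP.
    by rewrite -(cvg_lim _ cR1)// -(cvg_lim _ cR2).
  by rewrite -(cvg_lim _ cI1)// -(cvg_lim _ cI2).
rewrite cintZ; last first.
  split; [exact: integrable_poissonV|exact: integrable0].
rewrite mulrC; congr (_ * _); apply: complexP; rewrite /= /Rintegral.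
  by rewrite integral_poissonV.
by rewrite integral0_eq.
Qed.

End inversion.

(** * Smooth functions *)

Section directional.
Context {R : realType} {n : nat}.
Local Notation V := 'rV[R]_n.
Implicit Types (F G : V -> R) (x v y : V).

Lemma is_derive_line F x v (d : R) :
  is_derive (0 : R) (1 : R) (fun h : R => F (h *: v + x)) d <-> is_derive x v F d.
Proof.
have E : (fun h : R => h^-1 *: (((fun h : R => F (h *: v + x)) \o shift (0 : R)) (h *: (1 : R)) - (fun h : R => F (h *: v + x)) 0)) =
    (fun h => h^-1 *: ((F \o shift x) (h *: v) - F x)).
  by apply/funext => h /=; rewrite addr0 scale0r add0r /GRing.scale/= mulr1.
split=> -[d1 d2].
  have d3 : derivable F x v by rewrite /derivable -E; exact: d1.
  by split => //; rewrite /derive -E; exact: d2.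
have d3 : derivable (fun h : R => F (h *: v + x)) 0 1 by rewrite /derivable E; exact: d1.
by split => //; rewrite /derive E; exact: d2.
Qed.

Lemma is_derive_along F x v t : derivable F (t *: v + x) v ->
  is_derive t (1 : R) (fun u : R => F (u *: v + x)) ('D_v F (t *: v + x)).
Proof.
move=> /derivableP/is_derive_line.
set G := (fun h : R => _) => dG.
have ds : is_derive t (1 : R) (fun u : R => u - t) 1.
  by apply: is_derive_eq; rewrite subr0.
have dG' : is_derive (t - t) 1 G ('D_v F (t *: v + x)) by rewrite subrr.
have := @is_derive1_comp _ G (fun u : R => u - t) t _ _ dG' ds.
rewrite mulr1; congr is_derive; apply/funext => u; rewrite /G/=.
by rewrite addrA -scalerDl subrK.
Qed.

Lemma is_derive_affine F x v (a : R) y : derivable F (a *: x + y) v ->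
  is_derive x v (fun x => F (a *: x + y)) (a * 'D_v F (a *: x + y)).
Proof.
move=> /derivableP/is_derive_line dF; apply/is_derive_line.
have ds : is_derive (0 : R) (1 : R) (fun u : R => a * u) a.
  by apply: is_derive_eq; rewrite /GRing.scale/= ?mulr1 ?mulr0 ?add0r ?addr0.
set G := (fun h : R => _) in dF.
have dG' : is_derive (a * 0) 1 G ('D_v F (a *: x + y)) by rewrite mulr0.
have := @is_derive1_comp _ G (fun u : R => a * u) 0 _ _ dG' ds.
rewrite mulrC; congr is_derive; apply/funext => u; rewrite /G/=.
by rewrite scalerDr scalerA addrA.
Qed.

Lemma directional_mvt F x v (h K : R) : (forall t, derivable F (t *: v + x) v) ->
  (forall t, `|'D_v F (t *: v + x)| <= K) -> `|F (h *: v + x) - F x| <= K * `|h|.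
Proof.
move=> dF FK; set g := fun u : R => F (u *: v + x).
have dg t : is_derive t (1 : R) g ('D_v F (t *: v + x)) by exact: is_derive_along.
have cg : continuous g.
  move=> t; apply: differentiable_continuous; apply/derivable1_diffP.
  by have [] := dg t.
have -> : F x = g 0 by rewrite /g scale0r add0r.
rewrite -/(g h).
have [h0|h0] := leP 0 h.
  have [c _ ->] := MVT_segment h0 (fun t _ => dg t) (continuous_subspaceT cg).
  by rewrite subr0 normrM ler_wpM2r.
have [c _ E] := MVT_segment (ltW h0) (fun t _ => dg t) (continuous_subspaceT cg).
by rewrite distrC E sub0r normrM normrN ler_wpM2r.
Qed.

End directional.

Section smooth_functions.
Context {R : realType} {n : nat}.
Local Notation V := 'rV[R]_n.
Local Notation C := R[i].
Local Notation Re := (@complex.Re R).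
Local Notation Im := (@complex.Im R).
Local Notation e_ i := (delta_mx ord0 i : V).
Implicit Types (f g : V -> C) (x y v : V).

(** What [smooth] asks of each iterated derivative. *)
Definition partially_derivable f := [/\ continuous (Re \o f), continuous (Im \o f) &
  forall i x, derivable (Re \o f) x (e_ i) /\ derivable (Im \o f) x (e_ i)].

(** The relational form of [partial], which composes without side conditions of
    derivability. *)
Definition ispart i f x (d : C) :=
  is_derive x (e_ i) (Re \o f) (Re d) /\ is_derive x (e_ i) (Im \o f) (Im d).

Lemma ispartE i f x d : ispart i f x d -> partial i f x = d.
Proof. by move=> [[_ h1] [_ h2]]; apply: complexP. Qed.

Lemma ispart_derivable i f x d : ispart i f x d ->
  derivable (Re \o f) x (e_ i) /\ derivable (Im \o f) x (e_ i).
Proof. by move=> [[h1 _] [h2 _]]. Qed.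

Lemma partially_derivable_ispart f i x : partially_derivable f -> ispart i f x (partial i f x).
Proof. by move=> [_ _ /(_ i x)[h1 h2]]; split; exact: derivableP. Qed.

Lemma ispartD i f g x c d : ispart i f x c -> ispart i g x d ->
  ispart i (fun x => f x + g x) x (c + d).
Proof.
move=> [f1 f2] [g1 g2]; split.
  rewrite cReD (_ : _ \o _ = (Re \o f) + (Re \o g)); first exact: is_deriveD.
  by apply/funext => z /=; rewrite cReD.
rewrite cImD (_ : _ \o _ = (Im \o f) + (Im \o g)); first exact: is_deriveD.
by apply/funext => z /=; rewrite cImD.
Qed.

Lemma ispartM i f g x c d : ispart i f x c -> ispart i g x d ->
  ispart i (fun x => f x * g x) x (c * g x + f x * d).
Proof.
have scE (a b : R) : a *: (b : R^o) = a * b by [].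
move=> [f1 f2] [g1 g2]; split.
  rewrite (_ : _ \o _ = (Re \o f) * (Re \o g) - (Im \o f) * (Im \o g)).
    apply: (is_derive_eq (is_deriveB (is_deriveM f1 g1) (is_deriveM f2 g2))).
    rewrite cReD !cReM !scE /comp.
    by move: (Re _) (Im _) (Re _) (Im _) (Re _) (Im _) (Re _) (Im _) => *; ring.
  by apply/funext => z /=; rewrite cReM.
rewrite (_ : _ \o _ = (Re \o f) * (Im \o g) + (Im \o f) * (Re \o g)).
  apply: (is_derive_eq (is_deriveD (is_deriveM f1 g2) (is_deriveM f2 g1))).
  rewrite cImD !cImM !scE /comp.
  by move: (Re _) (Im _) (Re _) (Im _) (Re _) (Im _) (Re _) (Im _) => *; ring.
by apply/funext => z /=; rewrite cImM.
Qed.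

Lemma ispart_cst i (c : C) x : ispart i (fun=> c) x 0.
Proof. by split; exact: is_derive_cst. Qed.

Lemma ispart_affine i f x (a : R) y : partially_derivable f ->
  ispart i (fun x => f (a *: x + y)) x (real_complex R a * partial i f (a *: x + y)).
Proof.
move=> [_ _ /(_ i (a *: x + y))[h1 h2]]; split; rewrite ?cReRM ?cImRM.
  exact: (is_derive_affine h1).
exact: (is_derive_affine h2).
Qed.

Lemma ispart_expi i x (c : V) :
  ispart i (fun x => expi (dotp c x)) x ((0 +i* c ord0 i)%C * expi (dotp c x)).
Proof.
have dd : is_derive (0 : R) (1 : R) (fun h : R => dotp c (h *: e_ i + x)) (c ord0 i).
  rewrite (_ : (fun h => _) = (fun h : R => h * c ord0 i + dotp c x)).
    by apply: is_derive_eq; rewrite scaler0 add0r addr0 scaler1.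
  by apply/funext => h; rewrite dotpDr dotpC dotp_delta.
split; apply/is_derive_line => /=.
  have := @is_derive1_comp _ cos _ 0 _ _ (is_derive_cos _) dd.
  by rewrite scale0r add0r mul0r sub0r mulrC -mulrN; congr is_derive.
have := @is_derive1_comp _ sin _ 0 _ _ (is_derive_sin _) dd.
by rewrite scale0r add0r mul0r add0r mulrC; congr is_derive.
Qed.

Lemma continuous_dotp (c : V) : continuous (fun x : V => dotp c x).
Proof.
have h (s : seq 'I_n) : continuous (fun x : V => \sum_(i <- s) c ord0 i * x ord0 i).
  elim: s => [|i s IH].
    rewrite (_ : (fun x => _) = (fun=> 0)); first exact: cst_continuous.
    by apply/funext => x; rewrite big_nil.
  rewrite (_ : (fun x => _) = (fun x : V => c ord0 i * x ord0 i + \sum_(i <- s) c ord0 i * x ord0 i)).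
    move=> x; exact: (cvgD (cvgM (cvg_cst _) (@coord_continuous _ _ _ ord0 i x)) (IH x)).
  by apply/funext => x; rewrite big_cons.
exact: h.
Qed.

Lemma continuous_affine (a : R) y : continuous (fun x : V => a *: x + y).
Proof.
by move=> x; apply: (cvgD (@scaler_continuous _ _ a x) (cvg_cst _)).
Qed.

(** The algebra generated by smooth functions, their affine changes of variable and
    the characters; it is stable under the partial derivatives, whence smoothness. *)
Inductive smalg : (V -> C) -> Prop :=
| smalg_cst c : smalg (fun=> c)
| smalg_affine f (a : R) y : smooth f -> smalg (fun x => f (a *: x + y))
| smalg_expi c : smalg (fun x => expi (dotp c x))
| smalg_add f g : smalg f -> smalg g -> smalg (fun x => f x + g x)
| smalg_mul f g : smalg f -> smalg g -> smalg (fun x => f x * g x).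

Lemma smooth_partially_derivable f : smooth f -> partially_derivable f.
Proof. by move=> /(_ [::]). Qed.

Lemma smooth_partial i f : smooth f -> smooth (partial i f).
Proof. by move=> sf w; have := sf (rcons w i); rewrite /partials foldr_rcons. Qed.

Lemma smooth_smalg f : smooth f -> smalg f.
Proof.
move=> sf; rewrite (_ : f = fun x => f (1 *: x + 0)); first exact: smalg_affine.
by apply/funext => x; rewrite scale1r addr0.
Qed.

Lemma smalg_stable f : smalg f -> partially_derivable f /\ forall i, smalg (partial i f).
Proof.
elim.
- move=> c; split; first split.
  + exact: cst_continuous.
  + exact: cst_continuous.
  + by move=> i x; exact: (ispart_derivable (ispart_cst i c x)).
  move=> i; rewrite (_ : partial i _ = fun=> 0); first exact: smalg_cst.
  by apply/funext => x; exact: ispartE (ispart_cst i c x).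
- move=> {}f a y sf; have cf := smooth_partially_derivable sf; have [c1 c2 _] := cf; split; first split.
  + by move=> x; exact: (@continuous_comp _ _ _ _ (Re \o f) _ (@continuous_affine a y x) (c1 _)).
  + by move=> x; exact: (@continuous_comp _ _ _ _ (Im \o f) _ (@continuous_affine a y x) (c2 _)).
  + by move=> i x; exact: (ispart_derivable (ispart_affine i x a y cf)).
  move=> i; rewrite (_ : partial i _ = fun x => real_complex R a * partial i f (a *: x + y)).
    by apply: smalg_mul; [exact: smalg_cst|apply: smalg_affine; exact: smooth_partial].
  by apply/funext => x; exact: ispartE (ispart_affine i x a y cf).
- move=> c; split; first split.
  + by move=> x; apply: (continuous_comp (@continuous_dotp c x)); exact: continuous_cos.
  + by move=> x; apply: (continuous_comp (@continuous_dotp c x)); exact: continuous_sin.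
  + by move=> i x; exact: (ispart_derivable (ispart_expi i x c)).
  move=> i; rewrite (_ : partial i _ = fun x => (0 +i* c ord0 i)%C * expi (dotp c x)).
    by apply: smalg_mul; [exact: smalg_cst|exact: smalg_expi].
  by apply/funext => x; exact: ispartE (ispart_expi i x c).
- move=> {}f g _ [cf pf] _ [cg pg].
  have [f1 f2 _] := cf; have [g1 g2 _] := cg; split; first split.
  + rewrite (_ : _ \o _ = (Re \o f) \+ (Re \o g)); last by apply/funext => x /=; rewrite cReD.
    by move=> x; exact: (cvgD (f1 x) (g1 x)).
  + rewrite (_ : _ \o _ = (Im \o f) \+ (Im \o g)); last by apply/funext => x /=; rewrite cImD.
    by move=> x; exact: (cvgD (f2 x) (g2 x)).
  + by move=> i x; exact: (ispart_derivable (ispartD (partially_derivable_ispart i x cf) (partially_derivable_ispart i x cg))).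
  move=> i; rewrite (_ : partial i _ = fun x => partial i f x + partial i g x); first exact: smalg_add.
  by apply/funext => x; exact: ispartE (ispartD (partially_derivable_ispart i x cf) (partially_derivable_ispart i x cg)).
- move=> {}f g sf [cf pf] sg [cg pg].
  have [f1 f2 _] := cf; have [g1 g2 _] := cg; split; first split.
  + rewrite (_ : _ \o _ = (fun x => Re (f x) * Re (g x) - Im (f x) * Im (g x))); last by apply/funext => x /=; rewrite cReM.
    by move=> x; exact: (cvgB (cvgM (f1 x) (g1 x)) (cvgM (f2 x) (g2 x))).
  + rewrite (_ : _ \o _ = (fun x => Re (f x) * Im (g x) + Im (f x) * Re (g x))); last by apply/funext => x /=; rewrite cImM.
    by move=> x; exact: (cvgD (cvgM (f1 x) (g2 x)) (cvgM (f2 x) (g1 x))).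
  + by move=> i x; exact: (ispart_derivable (ispartM (partially_derivable_ispart i x cf) (partially_derivable_ispart i x cg))).
  move=> i; rewrite (_ : partial i _ = fun x => partial i f x * g x + f x * partial i g x).
    by apply: smalg_add; apply: smalg_mul.
  by apply/funext => x; exact: ispartE (ispartM (partially_derivable_ispart i x cf) (partially_derivable_ispart i x cg)).
Qed.

Lemma smalg_smooth f : smalg f -> smooth f.
Proof.
move=> sf w; have [] : partially_derivable (partials w f) /\ forall i, smalg (partial i (partials w f)).
  apply: smalg_stable; elim: w => //= i w IH.
  by have [_] := smalg_stable IH; exact.
by [].
Qed.

Lemma smoothD f g : smooth f -> smooth g -> smooth (fun x => f x + g x).
Proof. by move=> sf sg; apply: smalg_smooth; apply: smalg_add; exact: smooth_smalg. Qed.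

Lemma smoothM f g : smooth f -> smooth g -> smooth (fun x => f x * g x).
Proof. by move=> sf sg; apply: smalg_smooth; apply: smalg_mul; exact: smooth_smalg. Qed.

Lemma smooth_affine f a y : smooth f -> smooth (fun x => f (a *: x + y)).
Proof. by move=> sf; apply: smalg_smooth; exact: smalg_affine. Qed.

Lemma smooth_cst (c : C) : smooth ((fun=> c) : V -> C).
Proof. by apply: smalg_smooth; exact: smalg_cst. Qed.

Lemma smooth_expi c : smooth (fun x => expi (dotp c x)).
Proof. by apply: smalg_smooth; exact: smalg_expi. Qed.

Lemma smooth_sum (I : Type) (r : seq I) (f : I -> V -> C) :
  (forall i, smooth (f i)) -> smooth (fun x => \sum_(i <- r) f i x).
Proof.
move=> sf; elim: r => [|i r IH].
  by under eq_fun do rewrite big_nil; exact: smooth_cst.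
by under eq_fun do rewrite big_cons; exact: smoothD.
Qed.

Lemma smooth_cmeas f : smooth f -> cmeas f.
Proof.
by move=> /smooth_partially_derivable[f1 f2 _]; split; exact: continuous_measurable_rV.
Qed.

Lemma partialD i f g : smooth f -> smooth g ->
  partial i (fun x => f x + g x) = fun x => partial i f x + partial i g x.
Proof.
move=> /smooth_partially_derivable cf /smooth_partially_derivable cg; apply/funext => x; apply: ispartE.
by apply: ispartD; exact: partially_derivable_ispart.
Qed.

Lemma partialM i f g : smooth f -> smooth g ->
  partial i (fun x => f x * g x) = fun x => partial i f x * g x + f x * partial i g x.
Proof.
move=> /smooth_partially_derivable cf /smooth_partially_derivable cg; apply/funext => x; apply: ispartE.
by apply: ispartM; exact: partially_derivable_ispart.
Qed.

Lemma partial_affine i f a y : smooth f ->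
  partial i (fun x => f (a *: x + y)) = fun x => real_complex R a * partial i f (a *: x + y).
Proof.
by move=> /smooth_partially_derivable cf; apply/funext => x; apply: ispartE; exact: ispart_affine.
Qed.

Lemma smooth_iter_partial i f k : smooth f -> smooth (iter k (partial i) f).
Proof. by move=> sf; elim: k => [|k IH]; [exact: sf|rewrite iterS; exact: smooth_partial]. Qed.

Lemma iter_partialD i f g k : smooth f -> smooth g ->
  iter k (partial i) (fun x => f x + g x) =
  fun x => iter k (partial i) f x + iter k (partial i) g x.
Proof.
move=> sf sg; elim: k => [|k IH]; first by [].
by rewrite !iterS IH partialD; [|exact: smooth_iter_partial..].
Qed.

(** The hypotheses and the conclusion have the same shape [A * r ^+ k], so that symbol
    estimates at scale [r^-1] multiply; [2 ^+ N] counts the terms of Leibniz' rule. *)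
Lemma leibniz_bound i N f g (A B r : R) : 0 <= r -> smooth f -> smooth g ->
  (forall k x, (k <= N)%N -> cabs (iter k (partial i) f x) <= A * r ^+ k) ->
  (forall k x, (k <= N)%N -> cabs (iter k (partial i) g x) <= B * r ^+ k) ->
  forall x, cabs (iter N (partial i) (fun x => f x * g x) x) <= 2 ^+ N * (A * B) * r ^+ N.
Proof.
move=> r0; elim: N f g A B => [|N IH] f g A B sf sg fA gB x.
  rewrite /= !expr0 mul1r mulr1 cabsM ler_pM ?cabs_ge0//.
    by have := fA 0%N x (leqnn _); rewrite expr0 mulr1.
  by have := gB 0%N x (leqnn _); rewrite expr0 mulr1.
have sf' := smooth_partial i sf; have sg' := smooth_partial i sg.
rewrite iterSr partialM// iter_partialD; [|exact: smoothM..].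
rewrite (le_trans (ler_cabsD _ _))//.
have h1 := IH (partial i f) g (A * r) B sf' sg.
have h2 := IH f (partial i g) A (B * r) sf sg'.
apply: (le_trans (lerD (h1 _ _ x) (h2 _ _ x))).
- by move=> k z kN; rewrite -iterSr -mulrA -exprS; exact: fA.
- by move=> k z kN; apply: gB; rewrite (leq_trans kN).
- by move=> k z kN; apply: fA; rewrite (leq_trans kN).
- by move=> k z kN; rewrite -iterSr -mulrA -exprS; exact: gB.
by rewrite le_eqVlt; apply/orP; left; apply/eqP; rewrite !exprS; ring.
Qed.

Lemma iter_partial_affine i f (a : R) y k : smooth f ->
  iter k (partial i) (fun x => f (a *: x + y)) =
  fun x => real_complex R (a ^+ k) * iter k (partial i) f (a *: x + y).
Proof.
move=> sf; elim: k => [|k IH].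
  by apply/funext => x; rewrite /= expr0 mul1r.
rewrite !iterS IH partialM; last 2 first.
- exact: smooth_cst.
- by apply: smooth_affine; exact: smooth_iter_partial.
rewrite partial_affine; last exact: smooth_iter_partial.
apply/funext => x; rewrite (ispartE (ispart_cst _ _ _)) mul0r add0r mulrA.
by rewrite exprSr (rmorphM (real_complex R)).
Qed.

Lemma smooth_diffop h f : smooth f -> smooth (diffop h f).
Proof.
move=> sf; rewrite (_ : diffop h f = fun x => f (1 *: x + h) + (-1) * f x).
  apply: smoothD; first exact: smooth_affine.
  by apply: smoothM; [exact: smooth_cst|exact: sf].
by apply/funext => x; rewrite scale1r mulN1r.
Qed.

Lemma partial_diffop i h f : smooth f -> partial i (diffop h f) = diffop h (partial i f).
Proof.
move=> sf; rewrite (_ : diffop h f = fun x => f (1 *: x + h) + (-1) * f x); last first.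
  by apply/funext => x; rewrite scale1r mulN1r.
have sc := @smooth_cst (-1).
rewrite partialD; [|exact: (smooth_affine _ _ sf)|exact: (smoothM sc sf)].
rewrite (partial_affine _ _ _ sf) (partialM _ sc sf); apply/funext => x.
by rewrite scale1r rmorph1 mul1r (ispartE (ispart_cst _ _ _)) mul0r add0r mulN1r.
Qed.

Lemma diffop_bound i (h : R) f (K : R) : smooth f ->
  (forall x, cabs (partial i f x) <= K) ->
  forall x, cabs (diffop (h *: e_ i) f x) <= 2 * `|h| * K.
Proof.
move=> /smooth_partially_derivable[_ _ df] fK x.
rewrite (le_trans (le_cabs_ReIm _))// (_ : 2 * _ * _ = K * `|h| + K * `|h|); last by ring.
have key (F : V -> R) : (forall z, derivable F z (e_ i)) -> (forall z, `|'D_(e_ i) F z| <= K) ->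
    `|F (x + h *: e_ i) - F x| <= K * `|h|.
  by move=> dF FK; rewrite (addrC x); apply: directional_mvt => t.
apply: lerD.
  rewrite (_ : Re _ = (Re \o f) (x + h *: e_ i) - (Re \o f) x).
    apply: key => z; first by have [] := df i z.
    exact: (le_trans (le_Re_cabs (partial i f z)) (fK z)).
  by rewrite /diffop /= cReD; case: (f x).
rewrite (_ : Im _ = (Im \o f) (x + h *: e_ i) - (Im \o f) x).
  apply: key => z; first by have [] := df i z.
  exact: (le_trans (le_Im_cabs (partial i f z)) (fK z)).
by rewrite /diffop /= cImD; case: (f x).
Qed.

Lemma iter_diffop_bound i (h : R) f (K : R) N : smooth f ->
  (forall x, cabs (iter N (partial i) f x) <= K) ->
  forall x, cabs (iter N (diffop (h *: e_ i)) f x) <= (2 * `|h|) ^+ N * K.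
Proof.
elim: N f K => [|N IH] f K sf fK x; first by rewrite expr0 mul1r fK.
rewrite iterSr exprSr -mulrA; apply: IH; first exact: smooth_diffop.
move=> z; have E k : iter k (partial i) (diffop (h *: e_ i) f) =
    diffop (h *: e_ i) (iter k (partial i) f).
  elim: k => [|k IHk]; first by [].
  by rewrite !iterS IHk partial_diffop; [|exact: smooth_iter_partial].
rewrite E; apply: diffop_bound; first exact: smooth_iter_partial.
exact: fK.
Qed.

Lemma mderiv_nseq i k f :
  mderiv (fun j => if j == i then k else 0%N) f = iter k (partial i) f.
Proof.
rewrite /mderiv (_ : flatten _ = nseq k i).
  by elim: k => //= k <-.
have : uniq (enum 'I_n) by exact: enum_uniq.
have : i \in enum 'I_n by rewrite mem_enum.
elim: (enum 'I_n) => //= j s IH; rewrite inE => /orP[/eqP <- /andP[js us]|js /andP[]].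
  rewrite eqxx [X in _ ++ X](_ : _ = [::]) ?cats0//.
  elim: s js {us IH} => //= l s IH; rewrite inE negb_or => /andP[il ls].
  by rewrite eq_sym (negbTE il) IH.
case: eqP => [->|_]; first by rewrite js.
by move=> _ us; rewrite IH.
Qed.

End smooth_functions.

(** * Compactly supported smooth functions, decay of their transforms *)

Section cubes.
Context {R : realType} {n : nat}.
Local Notation V := 'rV[R]_n.
Local Notation C := R[i].
Local Notation Re := (@complex.Re R).
Local Notation Im := (@complex.Im R).
Local Notation lebV := (@lebesgue_rV R n).
Implicit Types (f : V -> C) (c x : V) (r M : R).

(** Supports are confined to cubes rather than balls: as boxes these have a known measure
    and are compact. *)
Definition cube c r : set V := box (fun i => `[c ord0 i - r, c ord0 i + r]%classic).

Lemma cubeP c r x : cube c r x <-> forall i, `|x ord0 i - c ord0 i| <= r.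
Proof.
by split=> h i; have := h i; rewrite /= in_itv/= ler_distl.
Qed.

Lemma measurable_cube c r : measurable (cube c r).
Proof. by apply: measurable_box => i; exact: measurable_itv. Qed.

Lemma compact_cube c r : compact (cube c r).
Proof.
by apply: (@rV_compact R n (fun i => `[c ord0 i - r, c ord0 i + r]%classic)) => i; exact: segment_compact.
Qed.

Lemma closed_cube c r : closed (cube c r).
Proof. by apply: compact_closed; [exact: norm_hausdorff|exact: compact_cube]. Qed.

Definition vanish_out c r f := forall x, ~ cube c r x -> f x = 0.

(** The derivative is local and the complement of a cube is open. *)
Lemma vanish_partial i c r f : vanish_out c r f -> vanish_out c r (partial i f).
Proof.
move=> f0 x cx.
have nx : \forall z \near x, f z = 0.
  have : nbhs x (~` cube c r).
    by apply: open_nbhs_nbhs; split => //; apply: closed_openC; exact: closed_cube.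
  by apply: filterS => z; exact: f0.
apply: ispartE; split.
  apply: (near_eq_is_derive _ (is_derive_cst 0 _ _)).
  by near=> z; rewrite /= (near nx z)//.
apply: (near_eq_is_derive _ (is_derive_cst 0 _ _)).
by near=> z; rewrite /= (near nx z)//.
Unshelve. all: by end_near. Qed.

Lemma vanish_partials w c r f : vanish_out c r f -> vanish_out c r (partials w f).
Proof. by move=> f0; elim: w => //= i w; exact: vanish_partial. Qed.

Lemma vanish_bounded c r f : continuous (Re \o f) -> continuous (Im \o f) ->
  vanish_out c r f -> exists2 M : R, 0 <= M & forall x, cabs (f x) <= M.
Proof.
move=> cR cI f0.
have key (F : V -> R) : continuous F -> exists2 M : R, 0 <= M & forall x, cube c r x -> `|F x| <= M.
  move=> cF; have : compact (F @` cube c r).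
    by apply: continuous_compact; [exact: continuous_subspaceT|exact: compact_cube].
  move=> /compact_bounded[M [_ hM]]; exists (`|M| + 1); first by rewrite addr_ge0.
  move=> x cx; apply: hM; last by exists x.
  by rewrite (le_lt_trans (ler_norm _))// ltrDl.
have [M1 M10 h1] := key _ cR; have [M2 M20 h2] := key _ cI.
exists (M1 + M2) => [|x]; first exact: addr_ge0.
have [cx|cx] := pselect (cube c r x).
  by rewrite (le_trans (le_cabs_ReIm _))// lerD//; [exact: h1|exact: h2].
by rewrite f0// cabs0 addr_ge0.
Qed.

Lemma vanish_integral_le c r f M : 0 <= r -> 0 <= M -> cmeas f -> vanish_out c r f ->
  (forall x, cabs (f x) <= M) ->
  (\int[lebV]_x (cabs (f x))%:E <= (M * (2 * r) ^+ n)%:E)%E.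
Proof.
move=> r0 M0 mf f0 fM.
apply: (@le_trans _ _ (\int[lebV]_x (M%:E * (\1_(cube c r) x)%:E))%E).
  apply: ge0_le_integral => //.
  - by move=> x _; rewrite lee_fin cabs_ge0.
  - exact: measurable_cabs_EFin.
  - apply/measurable_EFinP; apply: measurable_funM => //.
    by apply: measurable_indic; exact: measurable_cube.
  move=> x _; rewrite -EFinM lee_fin indicE.
  have [cx|/negP cx] := boolP (x \in cube c r); first by rewrite mulr1.
  rewrite mulr0 f0 ?cabs0// => cx'; apply: cx; rewrite inE; exact: cx'.
rewrite ge0_integralZl//; last first.
  by apply/measurable_EFinP; apply: measurable_indic; exact: measurable_cube.
rewrite integral_indic//; last exact: measurable_cube.
by rewrite setIT EFinM -(lebesgue_rV_cube c r0).
Qed.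

Lemma vanish_cintb c r f M : 0 <= r -> 0 <= M -> cmeas f -> vanish_out c r f ->
  (forall x, cabs (f x) <= M) -> cintb lebV f.
Proof.
move=> r0 M0 mf f0 fM; apply/cintbP; split => //.
by apply: le_lt_trans (vanish_integral_le r0 M0 mf f0 fM) _; rewrite ltry.
Qed.

Lemma smooth_vanish_cintb c r f : 0 <= r -> smooth f -> vanish_out c r f -> cintb lebV f.
Proof.
move=> r0 sf f0; have [c1 c2 _] := smooth_partially_derivable sf.
have [M M0 fM] := vanish_bounded c1 c2 f0.
by apply: (vanish_cintb r0 M0 _ f0 fM); exact: smooth_cmeas.
Qed.

Lemma enorm_ge0 x : 0 <= enorm x. Proof. exact: sqrtr_ge0. Qed.

Lemma enormZ (a : R) x : 0 < a -> enorm (a *: x) = a * enorm x.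
Proof.
move=> a0; rewrite /enorm (eq_bigr (fun i => a ^+ 2 * x ord0 i ^+ 2)).
  by rewrite -mulr_sumr sqrtrM ?sqr_ge0// sqrtr_sqr gtr0_norm.
by move=> i _; rewrite mxE exprMn.
Qed.

Lemma coord_le_enorm x i : `|x ord0 i| <= enorm x.
Proof.
rewrite -sqrtr_sqr ler_wsqrtr// (bigD1 i)//= lerDl sumr_ge0// => j _; exact: sqr_ge0.
Qed.

Lemma vanish_schwartz c r f : 0 <= r -> smooth f -> vanish_out c r f -> schwartz f.
Proof.
move=> r0 sf f0; split => // k a.
have sa : smooth (mderiv a f).
  by move=> w; have := sf (w ++ flatten [seq nseq (a i) i | i <- enum 'I_n]); rewrite /partials foldr_cat.
have [c1 c2 _] := smooth_partially_derivable sa.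
have [M M0 fM] := vanish_bounded c1 c2 (@vanish_partials _ c r f f0).
pose B : R := Num.sqrt (\sum_(i < n) (`|c ord0 i| + r) ^+ 2).
apply: (@le_lt_trans _ _ ((1 + B) ^+ k * M)%:E); last by rewrite ltry.
apply: ge_ereal_sup => _ [x _ <-]; rewrite lee_fin -[Normc.normc _]/(cabs _).
have [/cubeP cx|cx] := pselect (cube c r x); last first.
  rewrite [mderiv a f x](@vanish_partials _ c r f f0 x cx) cabs0 mulr0 mulr_ge0// exprn_ge0// addr_ge0//.
  exact: sqrtr_ge0.
apply: ler_pM; [|exact: cabs_ge0| |exact: fM].
  by rewrite exprn_ge0// addr_ge0// enorm_ge0.
rewrite lerXn2r ?nnegrE ?addr_ge0 ?enorm_ge0 ?sqrtr_ge0// lerD2l ler_wsqrtr//.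
apply: ler_sum => i _; rewrite -real_normK ?num_real// lerXn2r ?nnegrE ?addr_ge0//.
have -> : x ord0 i = (x ord0 i - c ord0 i) + c ord0 i by rewrite subrK.
by rewrite (le_trans (ler_normD _ _))// addrC lerD2l.
Qed.

(** Each difference enlarges the support by its step. *)
Lemma iter_diffop_vanish i (h : R) c r f N : vanish_out c r f ->
  vanish_out c (r + N%:R * `|h|) (iter N (diffop (h *: delta_mx ord0 i)) f).
Proof.
elim: N r f => [|N IH] r f f0; first by rewrite mul0r addr0.
rewrite iterSr -natr1 mulrDl mul1r [_ + `|h|]addrC addrA; apply: IH => x cx.
have nc (y : V) : (forall j, `|y ord0 j - x ord0 j| <= `|h|) -> ~ cube c r y.
  move=> yx /cubeP cy; apply: cx; apply/cubeP => j.
  rewrite (_ : _ - _ = (y ord0 j - c ord0 j) - (y ord0 j - x ord0 j)); last by ring.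
  by rewrite (le_trans (ler_normB _ _))// lerD.
have -> : diffop (h *: delta_mx ord0 i) f x = f (x + h *: delta_mx ord0 i) - f x by [].
rewrite (f0 x); last by apply: nc => j; rewrite subrr normr0.
rewrite f0 ?subrr//; apply: nc => j; rewrite !mxE eqxx addrAC subrr add0r.
by case: (_ == _); rewrite ?mulr1 ?mulr0 ?normr0.
Qed.

(** The decay of the transform of [m], from bounds on its pure derivatives of
    orders [0] and [2 n]: at [x], differences of step [pi / x_i] are taken in the
    direction in which [x] is largest. With [M = max_i |mu x_i| >= 1] this gains
    [M^(-2n)], which is at most the product of the factors [2 / (1 + (mu x_i)^2)]. *)
Lemma osc_decay (mu K : R) c (m : V -> C) : 0 < mu -> 0 <= K -> smooth m ->
  vanish_out c (2 * mu) m ->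
  (forall x, cabs (m x) <= K) ->
  (forall i x, cabs (iter (n.*2) (partial i) m x) <= K * mu^-1 ^+ (n.*2)) ->
  forall x, cabs (osc 1 m x) <=
    (2 * K * pi ^+ (n.*2) * (4 + 2 * (n.*2)%:R * pi) ^+ n) * mu ^+ n * poissonV (mu *: x).
Proof.
move=> mu0 K0 sm m0 mK dK x; set N := n.*2.
set D := (4 + 2 * N%:R * pi) ^+ n : R.
have pi1 : 1 <= pi :> R by rewrite (le_trans _ (pi_ge2 R))// ler1n.
have pi0 : 0 <= pi :> R by exact: pi_ge0.
have mu0' := ltW mu0.
have mm := smooth_cmeas sm.
have Im_ : cintb lebV m by apply: (vanish_cintb _ K0 mm m0 mK); rewrite mulr_ge0.
(* Without differences, from the size of the support; enough where [|mu x_i| <= 1]. *)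
have triv : cabs (osc 1 m x) <= 2 * K * pi ^+ N * D * mu ^+ n.
  apply: (le_trans (osc_bound _ _ Im_ (vanish_integral_le _ K0 mm m0 mK))).
    by rewrite mulr_ge0.
  rewrite [leRHS](_ : _ = 2 * (K * (pi ^+ N * ((4 + 2 * N%:R * pi) * mu) ^+ n))); last first.
    by rewrite exprMn /D; ring.
  rewrite ler_wpM2l// ler_wpM2l//.
  apply: (@le_trans _ _ (1 * (((4 + 2 * N%:R * pi) * mu) ^+ n))).
    rewrite mul1r lerXn2r ?nnegrE ?mulr_ge0 ?addr_ge0 ?mulr_ge0//.
    by rewrite mulrA ler_wpM2r// (_ : 2 * 2 = 4)%R ?lerDl ?mulr_ge0//; ring.
  by rewrite ler_wpM2r ?exprn_ge0 ?mulr_ge0 ?addr_ge0 ?mulr_ge0// exprn_ege1.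
(* The step [h = pi / x_i] has [|h| <= pi * mu], so the support stays of size [mu]. *)
have dir i : 1 <= `|mu * x ord0 i| ->
    cabs (osc 1 m x) <= 2 * K * pi ^+ N * D * mu ^+ n / `|mu * x ord0 i| ^+ N.
  move=> x1; have xi0 : x ord0 i != 0.
    by apply: contraTneq x1 => ->; rewrite mulr0 normr0 ler10.
  pose h := pi / x ord0 i.
  have hx : dotp (h *: delta_mx ord0 i) x = pi by rewrite dotp_delta /h divfK.
  have hmu : `|h| <= pi * mu.
    rewrite /h normrM normfV (ger0_norm pi0) ler_pdivrMr ?normr_gt0// -mulrA.
    by rewrite ler_peMr// -[X in X * _](ger0_norm mu0') -normrM.
  have := osc_diffop_iter N Im_ hx; set g := iter N _ m => E.
  have sg : cmeas g.
    by apply: smooth_cmeas; rewrite /g; elim: (N) => [|k IH]; [exact: sm|rewrite iterS; exact: smooth_diffop].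
  have gv : vanish_out c (2 * mu + N%:R * `|h|) g by exact: iter_diffop_vanish.
  have gb z : cabs (g z) <= (2 * `|h|) ^+ N * (K * mu^-1 ^+ N).
    by apply: iter_diffop_bound => // y; exact: dK.
  have r0 : 0 <= 2 * mu + N%:R * `|h| by rewrite addr_ge0 ?mulr_ge0.
  have gb0 : 0 <= (2 * `|h|) ^+ N * (K * mu^-1 ^+ N).
    by rewrite !mulr_ge0 ?exprn_ge0 ?mulr_ge0 ?invr_ge0.
  have Ig : cintb lebV g by exact: (vanish_cintb r0 gb0 sg gv gb).
  have := osc_bound 1 x Ig (vanish_integral_le r0 gb0 sg gv gb).
  rewrite E cabsM.
  have -> : cabs ((-2) ^+ N : C) = 2 ^+ N.
    elim: (N) => [|k IH]; first by rewrite !expr0 -[1]/(real_complex R 1) cabs_real normr1.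
    rewrite !exprS cabsM IH cabsN; congr (_ * _).
    by rewrite (_ : 2%:R = real_complex R 2) ?cabs_real ?ger0_norm// rmorph_nat.
  move=> h1; rewrite -(ler_pM2l (_ : 0 < 2 ^+ N)); last by rewrite exprn_gt0.
  apply: (le_trans h1).
  rewrite (_ : 2 ^+ N * _ = 2 * ((2 * `|h|) ^+ N * (K * mu^-1 ^+ N) * ((4 + 2 * N%:R * pi) * mu) ^+ n)); last first.
    have X0 : `|x ord0 i| != 0 by rewrite normr_eq0.
    rewrite /D /h !normrM normfV (ger0_norm pi0) (gtr0_norm mu0).
    move: X0; move: (`|x ord0 i|) => X X0; rewrite !exprMn !exprVn; field.
    by rewrite !expf_neq0// gt_eqF.
  rewrite ler_wpM2l// ler_wpM2l// lerXn2r ?nnegrE ?mulr_ge0 ?addr_ge0 ?mulr_ge0//.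
  have hN : N%:R * `|h| <= N%:R * (pi * mu) by rewrite ler_wpM2l.
  rewrite (_ : (4 + _) * mu = 4 * mu + 2 * (N%:R * (pi * mu))); last by ring.
  by move: hN; move: (N%:R * `|h|) (N%:R * (pi * mu)) => a b ab; lra.
have CD0 : 0 <= 2 * K * pi ^+ N * D * mu ^+ n.
  exact: le_trans (cabs_ge0 _) triv.
have Pge (M : R) : 1 <= M -> (forall i, `|mu * x ord0 i| <= M) -> (M ^+ N)^-1 <= poissonV (mu *: x).
  move=> M1 xM; rewrite /poissonV /N -mul2n exprM -exprVn -[X in _ ^+ X <= _](card_ord n) -prodr_const.
  apply: ler_prod => i _; rewrite invr_ge0 sqr_ge0/= mxE.
  have a0 : 0 < 1 + (mu * x ord0 i) ^+ 2 by rewrite ltr_pwDl// sqr_ge0.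
  have M0 : 0 < M ^+ 2 by rewrite exprn_gt0// (lt_le_trans ltr01).
  rewrite ler_pdivlMr// mulrC ler_pdivrMr// (_ : 2 = 1 + 1)// mulrDl mul1r lerD//.
    by rewrite exprn_ege1.
  by rewrite -real_normK ?num_real// lerXn2r ?nnegrE// (le_trans _ M1).
have [h|h] := pselect (forall i, `|mu * x ord0 i| <= 1).
  apply: (le_trans triv); rewrite ler_peMr//.
  have := Pge 1 (lexx _) h; rewrite expr1n invr1//.
have [i0 hi0] : exists i, 1 < `|mu * x ord0 i|.
  by apply: contrapT => h'; apply: h => i; rewrite leNgt; apply/negP => hi; apply: h'; exists i.
have [i _ imax] := @arg_maxP _ _ _ i0 predT (fun i => `|mu * x ord0 i|) isT.
have i1 : 1 <= `|mu * x ord0 i| by exact: (le_trans (ltW hi0) (imax i0 isT)).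
apply: (le_trans (dir i i1)); rewrite ler_wpM2l//; apply: Pge => // j; exact: imax.
Qed.

End cubes.

Section tempered_functions.
Context {R : realType} {n : nat}.
Local Notation V := 'rV[R]_n.
Local Notation C := R[i].
Local Notation lebV := (@lebesgue_rV R n).

Lemma mderiv0 (f : V -> C) : mderiv (fun=> 0%N) f = f.
Proof.
rewrite /mderiv (_ : flatten _ = [::])//.
by elim: (enum 'I_n).
Qed.

Lemma schwartz_decay (phi : V -> C) k : schwartz phi ->
  exists2 M : R, 0 <= M & forall x, (1 + enorm x) ^+ k * cabs (phi x) <= M.
Proof.
move=> [_ /(_ k (fun=> 0%N))]; rewrite /schwartz_seminorm mderiv0.
set S := ereal_sup _ => Soo.
have ub x : (((1 + enorm x) ^+ k * cabs (phi x))%:E <= S)%E.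
  by apply: ereal_sup_ubound; exists x.
have S0 : (0 <= S)%E.
  apply: le_trans (ub 0); rewrite lee_fin mulr_ge0 ?cabs_ge0// exprn_ge0//.
  by rewrite addr_ge0// enorm_ge0.
exists (fine S) => [|x]; first exact: fine_ge0.
by rewrite -lee_fin fineK// ge0_fin_numE.
Qed.

(** Coordinatewise, [1 + x_i^2 <= 2 (1 + |x|)^2]. *)
Lemma schwartz_le_poisson (phi : V -> C) : schwartz phi ->
  exists2 M : R, 0 <= M & forall x, cabs (phi x) <= M * poissonV x.
Proof.
move=> /(@schwartz_decay _ n.*2)[M M0 hM]; exists M => // x.
have e1 : 0 < (1 + enorm x) ^+ n.*2 by rewrite exprn_gt0// ltr_pwDl// enorm_ge0.
apply: (@le_trans _ _ (M * ((1 + enorm x) ^+ n.*2)^-1)).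
  by rewrite ler_pdivlMr// mulrC.
rewrite ler_wpM2l// /poissonV -mul2n exprM -exprVn -[X in _ ^+ X <= _](card_ord n) -prodr_const.
apply: ler_prod => i _; rewrite invr_ge0 sqr_ge0/=.
have a0 : 0 < 1 + x ord0 i ^+ 2 by rewrite ltr_pwDl// sqr_ge0.
have b0 : 0 < (1 + enorm x) ^+ 2 by rewrite exprn_gt0// ltr_pwDl// enorm_ge0.
rewrite ler_pdivlMr// mulrC ler_pdivrMr//.
have xi : x ord0 i ^+ 2 <= enorm x ^+ 2.
  by rewrite -real_normK ?num_real// lerXn2r ?nnegrE ?enorm_ge0// coord_le_enorm.
by have := enorm_ge0 x; nra.
Qed.

Lemma cintb_le_poisson (f : V -> C) (M : R) : cmeas f ->
  (forall x, cabs (f x) <= M * poissonV x) -> cintb lebV f.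
Proof.
move=> mf fM; apply: (cintb_le mf fM).
exact: (integrableZl measurableT M (@integrable_poissonV R n)).
Qed.

Lemma schwartz_cintb (phi : V -> C) : schwartz phi -> cintb lebV phi.
Proof.
move=> sp; have [M _ hM] := schwartz_le_poisson sp.
by apply: cintb_le_poisson hM; case: sp => sp _; exact: smooth_cmeas.
Qed.

Lemma schwartz_bounded (phi : V -> C) : schwartz phi ->
  exists2 M : R, 0 <= M & forall x, cabs (phi x) <= M.
Proof.
move=> /(@schwartz_decay _ 0)[M M0 hM]; exists M => // x.
by have := hM x; rewrite expr0 mul1r.
Qed.

Definition regdistr (f : V -> C) : @distr R n := fun phi => cint lebV (fun x => f x * phi x).

Lemma cintb_schwartz_mul f (phi : V -> C) : cintb lebV f -> schwartz phi ->
  cintb lebV (fun x => f x * phi x).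
Proof.
move=> If sp; have [M _ hM] := schwartz_bounded sp.
by apply: (cintbMr_bounded _ hM If); case: sp => sp _; exact: smooth_cmeas.
Qed.

(** The sup norm alone controls the pairing with an integrable function, so the order 0
    suffices in the definition of continuity. *)
Lemma tempered_regdistr f : cintb lebV f -> tempered (regdistr f).
Proof.
move=> If; split.
  move=> c phi psi sphi spsi; rewrite /regdistr -cintZ -?cintD.
  - by apply: eq_cint => x; ring.
  - by apply: cintbZ; exact: cintb_schwartz_mul.
  - exact: cintb_schwartz_mul.
  - exact: cintb_schwartz_mul.
move=> phi sphi e e0; exists 0%N.
pose B := fine (\int[lebV]_x (cabs (f x))%:E).
have BE : B%:E = (\int[lebV]_x (cabs (f x))%:E)%E.
  by rewrite fineK//; apply: integrable_fin_num => //; exact: cintb_norm_integrable.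
have B0 : 0 <= B.
  by rewrite -lee_fin BE; apply: integral_ge0 => x _; rewrite lee_fin cabs_ge0.
have d0 : 0 < e / (2 * B + 1) by rewrite divr_gt0// ltr_wpDl// mulr_ge0.
exists (e / (2 * B + 1)) => // psi spsi h.
have {}h x : cabs (psi x - phi x) <= e / (2 * B + 1).
  have := h 0%N (fun=> 0%N) (leqnn _); rewrite /mlen big1// => /(_ (leqnn _)).
  rewrite /schwartz_seminorm mderiv0 => /ltW H; rewrite -lee_fin; apply: le_trans H.
  by apply: ereal_sup_ubound; exists x => //; rewrite expr0 mul1r.
have Ip := cintb_schwartz_mul If sphi; have Iq := cintb_schwartz_mul If spsi.
have Id : cintb lebV (fun x => f x * (psi x - phi x)).
  under eq_fun do rewrite mulrBr -mulN1r.
  by apply: cintbD => //; exact: cintbZ.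
have -> : regdistr f psi - regdistr f phi = cint lebV (fun x => f x * (psi x - phi x)).
  rewrite /regdistr -mulN1r -cintZ// -cintD//; last exact: cintbZ.
  by apply: eq_cint => x; ring.
apply: (@le_lt_trans _ _ (2 * (B * (e / (2 * B + 1))))).
  apply: le_cabs_cint_bound => //; rewrite EFinM BE -ge0_integralZr//; last 3 first.
  - by apply: measurable_cabs_EFin; exact: cintb_cmeas If.
  - by move=> x _; rewrite lee_fin cabs_ge0.
  - by rewrite lee_fin ltW.
  apply: ge0_le_integral => //.
  - by move=> x _; rewrite lee_fin cabs_ge0.
  - by apply: measurable_cabs_EFin; exact: cintb_cmeas Id.
  - apply: emeasurable_funM => //.
    by apply: measurable_cabs_EFin; exact: cintb_cmeas If.
  by move=> x _; rewrite -EFinM lee_fin cabsM ler_wpM2l// cabs_ge0.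
have qe : e / (2 * B + 1) * (2 * B + 1) = e by rewrite divfK// gt_eqF// ltr_wpDl// mulr_ge0.
by move: d0 qe; move: (e / (2 * B + 1)) => q q0 qe; nra.
Qed.

End tempered_functions.

(** * Lorentz norms through integrals over sets *)

Section setbounds.
Context {R : realType} {n : nat}.
Local Notation V := 'rV[R]_n.
Local Notation C := R[i].
Local Notation lebV := (@lebesgue_rV R n).
Implicit Types (f g : V -> C) (E : set V).

(** [|E|^(-al) \int_E |f| <= D]: for [al = 1 - 1/p] this is a norm of weak L^p, and
    for [al = 1/p] it pairs with L^(p,1); unlike the quasi-norms of [lorentz_norm] it
    is visibly subadditive. *)
Definition setbound f (D al : R) := forall E, measurable E ->
  (\int[lebV]_(x in E) (cabs (f x))%:E <= D%:E * (lebV E `^ al))%E.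

(** The sets of measure 0 or [+oo] satisfy the bound automatically. *)
Lemma setboundP f (D al : R) : cmeas f -> 0 < D -> 0 < al ->
  (forall E (a : R), measurable E -> lebV E = a%:E -> 0 < a ->
    (\int[lebV]_(x in E) (cabs (f x))%:E <= (D * a `^ al)%:E)%E) ->
  setbound f D al.
Proof.
move=> mf D0 al0 h E mE.
have : (0 <= lebV E)%E by exact: measure_ge0.
case El : (lebV E) => [a| |]//.
  rewrite lee_fin le_eqVlt => /orP[/eqP a0|a0].
    rewrite null_set_integral => //.
    - by apply: mule_ge0; [rewrite lee_fin ltW|exact: poweR_ge0].
    - by apply: measurable_funTS; exact: measurable_cabs_EFin.
    - by rewrite -[LHS]/(lebV E) El -a0.
  by rewrite poweR_EFin -EFinM; exact: h.
by move=> _; rewrite poweRyr ?gt_eqF// gt0_muley ?lte_fin// leey.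
Qed.

(** Chebyshev on a level set: [t |E| <= \int_E |g| <= D |E|^(1 - 1/p)], and [|E|^(1 - 1/p)]
    cancels as [|E|] is finite. *)
Lemma lorentz_weak_le (p D : R) g : 1 < p -> 0 <= D -> cintb lebV g ->
  setbound g D (1 - p^-1) -> (lorentz_norm p +oo g <= D%:E)%E.
Proof.
move=> p1 D0 Ig hg; have mg := cintb_cmeas Ig.
have p0 : 0 < p by exact: lt_trans p1.
rewrite /lorentz_norm; apply: ge_ereal_sup => _ [t /= + <-].
rewrite in_itv/= andbT => t0.
set E := [set x | t < Normc.normc (g x)].
have mE : measurable E.
  rewrite (_ : E = (cabs \o g) @^-1` `]t, +oo[%classic).
    rewrite -[X in measurable X]setTI; apply: measurable_cabs => //; exact: measurable_itv.
  by apply/seteqP; split => x; rewrite /E /preimage/= in_itv/= andbT.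
rewrite /distribution_fun -/E.
have tE : (t%:E * lebV E <= \int[lebV]_(x in E) (cabs (g x))%:E)%E.
  rewrite -(integral_cst _ mE); apply: ge0_le_integral => //.
  - by move=> x _; rewrite lee_fin ltW.
  - by apply: measurable_funTS; exact: measurable_cabs_EFin.
  - by move=> x /= /ltW; rewrite lee_fin.
have fin : (lebV E < +oo)%E.
  have : (t%:E * lebV E < +oo)%E.
    apply: (le_lt_trans tE).
    apply: (@le_lt_trans _ _ (\int[lebV]_x (cabs (g x))%:E)%E).
      apply: ge0_subset_integral => //; first exact: measurable_cabs_EFin.
      by move=> x _; rewrite lee_fin cabs_ge0.
    by have /cintbP[] := Ig.
  have : (0 <= lebV E)%E by exact: measure_ge0.
  case: (lebV E) => [a _ _| |]//; first by rewrite ltry.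
  by move=> _; rewrite gt0_muley ?lte_fin.
have := hg E mE; move: tE fin; have : (0 <= lebV E)%E by exact: measure_ge0.
case: (lebV E) => [a| |]// a0 tE _ h.
rewrite lee_fin in a0; move: (le_trans tE h); rewrite !poweR_EFin -!EFinM !lee_fin.
move: a0; rewrite le_eqVlt => /orP[/eqP <- _|a0].
  by rewrite powR0 ?invr_eq0 ?gt_eqF// mulr0.
have aE : a = a `^ p^-1 * a `^ (1 - p^-1).
  by rewrite -powRD ?subrKC ?powRr1 ?ltW// gt_eqF ?implybT.
by rewrite {1}aE mulrA ler_pM2r// powR_gt0.
Qed.

(** By the layer-cake formula the left side is the integral over [t > 0] of the integrals
    of [|phi|] over the level sets [{|g| > t}], and the bound on the latter turns it into
    the Lorentz norm with second exponent 1. *)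
Lemma lorentz1_duality (p D : R) g (phi : V -> C) : 0 < p -> 0 <= D ->
  cmeas g -> cmeas phi -> setbound phi D p^-1 ->
  (\int[lebV]_x (cabs (g x) * cabs (phi x))%:E <= (D / p)%:E * lorentz_norm p 1 g)%E.
Proof.
move=> p0 D0 mg mphi hphi.
set leb := (@lebesgue_measure R).
pose A : set (measurableTypeR R * V) := [set z | 0 < z.1 /\ z.1 < cabs (g z.2)].
have mA : measurable A.
  rewrite (_ : A = (fst @^-1` `]0, +oo[%classic) `&` ((fun z : measurableTypeR R * V => z.1 < cabs (g z.2)) @^-1` [set true])).
    apply: measurableI.
      by rewrite -[X in measurable X]setTI; apply: measurable_fst => //; exact: measurable_itv.
    rewrite -[X in measurable X]setTI; apply: measurable_fun_ltr => //.
    by apply: (measurableT_comp (measurable_cabs mg)); exact: measurable_snd.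
  by apply/seteqP; split => z; rewrite /A /preimage/= in_itv/= andbT.
pose h (z : measurableTypeR R * V) : \bar R := (\1_A z * cabs (phi z.2))%:E.
have h0 z : (0 <= h z)%E by rewrite lee_fin mulr_ge0 ?cabs_ge0.
have mh : measurable_fun setT h.
  apply/measurable_EFinP; apply: measurable_funM; first exact: measurable_indic.
  by apply: (measurableT_comp (measurable_cabs mphi)); exact: measurable_snd.
have FT := fubini_tonelli (m1 := leb) (m2 := lebV) h mh h0.
have L x : (\int[leb]_t h (t, x) = (cabs (g x) * cabs (phi x))%:E)%E.
  rewrite /h /=; under eq_integral do rewrite EFinM.
  rewrite ge0_integralZr//; last 2 first.
  - by apply: (@measurableT_comp _ _ _ _ _ _ (fun z => (\1_A z)%:E) _ (fun t => (t, x))); [exact/measurable_EFinP/measurable_indic|exact: pair2_measurable].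
  - by rewrite lee_fin cabs_ge0.
  rewrite EFinM; congr (_ * _)%E.
  transitivity (\int[leb]_t (\1_(`]0%R, cabs (g x)[%classic) t)%:E)%E.
    apply: eq_integral => t _; rewrite !indicE; congr ((_ : bool)%:R)%:E.
    apply/idP/idP; rewrite !inE /A/= in_itv/=; first by move=> [-> ->].
    by move=> /andP[].
  transitivity (leb `]0%R, cabs (g x)[%classic).
    by rewrite integral_indic// setIT.
  rewrite /leb lebesgue_measure_itv/= lte_fin; case: ltP => [_|c0].
    by rewrite -EFinD subr0.
  by congr (_%:E); apply/eqP; rewrite eq_le c0 cabs_ge0.
under eq_integral do rewrite -L.
rewrite -FT.
pose E t : set V := [set x | t < cabs (g x)].
have mE t : measurable (E t).
  rewrite (_ : E t = (cabs \o g) @^-1` `]t, +oo[%classic).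
    rewrite -[X in measurable X]setTI; apply: measurable_cabs => //; exact: measurable_itv.
  by apply/seteqP; split => x; rewrite /E /preimage/= in_itv/= andbT.
pose d t : \bar R := (lebV (E t) `^ p^-1)%E.
have md : measurable_fun setT (fun t : measurableTypeR R => d t).
  apply: (measurableT_comp (measurable_poweR _)).
  pose B : set (measurableTypeR R * V) := [set z | z.1 < cabs (g z.2)].
  have mB : measurable B.
    rewrite -[X in measurable X]setTI; apply: (measurable_fun_ltr measurable_fst _ measurableT (Y := [set true])) => //.
    by apply: (measurableT_comp (measurable_cabs mg)); exact: measurable_snd.
  have := measurable_fun_xsection lebV mB.
  rewrite (_ : lebV \o xsection B = fun t => lebV (E t))//.
  apply/funext => t /=; congr (lebV _); apply/seteqP; split => x.
    by rewrite /xsection/= inE.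
  by rewrite /xsection/= inE.
have -> : lorentz_norm p 1 g = (p%:E * \int[leb]_(t in `]0%R, +oo[) d t)%E.
  rewrite /lorentz_norm invr1 poweRe1; last first.
    apply: mule_ge0; first by rewrite lee_fin ltW.
    apply: integral_ge0 => t /=; rewrite in_itv/= andbT => t0.
    by rewrite mule_ge0 ?poweR_ge0// lee_fin invr_ge0 ltW.
  congr (_ * _)%E; apply: eq_integral => t; rewrite inE/= in_itv/= andbT => t0.
  rewrite poweRe1; last by rewrite mule_ge0 ?poweR_ge0// lee_fin ltW.
  rewrite muleC muleA -EFinM mulVf ?gt_eqF// mul1e.
  by [].
rewrite muleA -EFinM divfK ?gt_eqF// -ge0_integralZl//; last 2 first.
- by apply: measurable_funTS; exact: md.
- by move=> t _; exact: poweR_ge0.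
rewrite [leRHS]integral_mkcond.
apply: ge0_le_integral => //.
- by move=> t _; exact: integral_ge0.
- exact: (measurable_fun_fubini_tonelli_F h).
- apply/(measurable_restrictT _ _).1 => //.
  by apply: measurable_funTS; exact: emeasurable_funM.
move=> t _; rewrite patchE; case: ifPn => [|nt].
  rewrite inE/= in_itv/= andbT => t0.
  apply: le_trans (hphi _ (mE t)).
  rewrite [leRHS]integral_mkcond; apply: ge0_le_integral => //.
  - exact: (measurableT_comp mh (pair1_measurable t)).
  - apply/(measurable_restrictT _ _).1 => //.
    by apply: measurable_funTS; exact: measurable_cabs_EFin.
  move=> x _; rewrite /h patchE/= indicE.
  case: ifPn => [xE|xE]; last first.
    rewrite memNset ?mul0r// => -[_ /= tx].
    by move: xE; rewrite notin_setE; apply.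
  by rewrite mem_set ?mul1r//; split => //; move: xE; rewrite inE.
rewrite integral0_eq// => x _; rewrite /h indicE memNset ?mul0r// => -[/= t0 _].
by move: nt; rewrite notin_setE/= in_itv/= andbT.
Qed.

Lemma cint_le_lorentz1 (p D : R) g (phi : V -> C) : 0 < p -> 0 <= D ->
  cmeas g -> cintb lebV (fun x => g x * phi x) -> cmeas phi -> setbound phi D p^-1 ->
  ((cabs (cint lebV (fun x => g x * phi x)))%:E <= (2 * (D / p))%:E * lorentz_norm p 1 g)%E.
Proof.
move=> p0 D0 mg Igp mphi hphi.
apply: (le_trans (le_cabs_cint Igp)); rewrite EFinM -muleA lee_wpmul2l ?lee_fin//.
by under eq_integral do rewrite cabsM; exact: lorentz1_duality.
Qed.

End setbounds.

Section dyadic_sums.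
Context {R : realType}.

Lemma powR_expn (q x : R) k : 0 <= q -> (q `^ x) ^+ k = (q ^+ k) `^ x.
Proof.
move=> q0; rewrite -(powR_mulrn k (powR_ge0 q x)) -(powR_mulrn k q0).
by rewrite -powRrM mulrC powRrM.
Qed.

(** The terms increase geometrically while [q^k <= a] and decrease geometrically
    afterwards, so that the sum is controlled by its largest term, of order [a^(1-be)],
    whatever the number of terms. *)
Lemma geometric_min_sum (q be a : R) N : 1 < q -> 0 < be < 1 -> 0 < a ->
  \sum_(k < N) (q `^ be) ^- k * Num.min a (q ^+ k) <=
  (q `^ (1 - be) / (q `^ (1 - be) - 1) + (1 - (q `^ be)^-1)^-1) * a `^ (1 - be).
Proof.
move=> q1 /andP[be0 be1] a0.
have q0 : 0 < q by exact: lt_trans q1.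
set r := q `^ be; set s := q `^ (1 - be).
have pw1 (x : R) : 0 < x -> 1 < q `^ x.
  by move=> x0; rewrite -[X in X < _](congr1 (fun f => f x) (@powR1 R)); apply: gt0_ltr_powR; rewrite ?nnegrE ?ltW.
have r1 : 1 < r by exact: pw1.
have s1 : 1 < s by apply: pw1; rewrite subr_gt0.
have rs : r * s = q by rewrite /r /s -powRD ?subrKC ?powRr1 ?ltW// gt_eqF ?implybT.
set c1 := (s - 1)^-1; set c2 := (1 - r^-1)^-1.
have c10 : 0 < c1 by rewrite invr_gt0 subr_gt0.
have c20 : 0 < c2 by rewrite invr_gt0 subr_gt0 invf_lt1// (lt_trans _ r1).
have c1E : c1 * s = c1 + 1 by rewrite /c1; field; rewrite subr_eq0 gt_eqF.
have r0 : 0 < r by exact: lt_trans r1.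
have c2E : c2 = c2 * r^-1 + 1.
  by rewrite /c2; field; apply/andP; split; rewrite ?subr_eq0 gt_eqF.
have s0 : 0 < s by exact: lt_trans s1.
have qk k : 0 <= q ^+ k by exact/exprn_ge0/ltW.
have sN k : q ^+ k <= a -> s ^+ k <= a `^ (1 - be).
  move=> qa; rewrite /s (powR_expn _ _ (ltW q0)).
  by apply: ge0_ler_powR; rewrite ?nnegrE ?subr_ge0//; exact: ltW.
have rN k : a <= q ^+ k -> a * r ^- k <= a `^ (1 - be).
  move=> qa; rewrite ler_pdivrMr ?exprn_gt0// /r (powR_expn _ _ (ltW q0)).
  rewrite -[X in X <= _](powRr1 (ltW a0)) -[X in _ `^ X <= _](subrK be 1).
  rewrite powRD; last by rewrite (gt_eqF a0) implybT.
  rewrite ler_pM2l ?powR_gt0//.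
  by apply: ge0_ler_powR; rewrite ?nnegrE//; exact: ltW.
(* The first part of the invariant covers the growing terms; in the second, the summand
   [c2 * (a * r ^- M)] is the whole geometric tail still to come. *)
pose S M := \sum_(k < M) r ^- k * Num.min a (q ^+ k).
have inv M : (q ^+ M <= a * q -> S M <= c1 * s ^+ M) /\
    (a < q ^+ M -> S M + c2 * (a * r ^- M) <= (s * c1 + c2) * a `^ (1 - be)).
  elim: M => [|M [IHA IHB]].
    rewrite /S big_ord0 !expr0 add0r; split; first by move=> _; rewrite mulr1 ltW.
    rewrite divr1 => a1; have := rN 0 (ltW a1); rewrite expr0 invr1 mulr1 => h.
    rewrite mulrDl (le_trans (ler_wpM2l (ltW c20) h))// lerDr mulr_ge0 ?powR_ge0//.
    by rewrite mulr_ge0 ?ltW.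
  rewrite /S big_ord_recr/= -/(S M); split.
    rewrite exprSr ler_pM2r// => qa; rewrite (min_idPr qa).
    have -> : r ^- M * q ^+ M = s ^+ M.
      by rewrite -rs exprMn mulrA mulVf ?mul1r// expf_neq0// gt_eqF.
    rewrite exprS mulrA c1E mulrDl mul1r lerD2r; apply: IHA.
    by rewrite (le_trans qa)// ler_peMr ?ltW.
  move=> aq; have [qa|qa] := leP (q ^+ M) a.
    have -> : r ^- M * q ^+ M = s ^+ M.
      by rewrite -rs exprMn mulrA mulVf ?mul1r// expf_neq0// gt_eqF.
    rewrite mulrDl lerD//; last by rewrite ler_pM2l// rN// ltW.
    apply: (@le_trans _ _ (c1 * s ^+ M + s ^+ M)).
      by rewrite lerD2r; apply: IHA; rewrite (le_trans qa)// ler_peMr ?ltW.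
    rewrite -[X in _ + X]mul1r -mulrDl -c1E [s * c1]mulrC ler_pM2l ?mulr_gt0//.
    exact: sN.
  rewrite (le_trans _ (IHB qa))// -addrA lerD2l.
  rewrite [leRHS](_ : _ = (c2 * r^-1 + 1) * (a * r ^- M)); last by rewrite -c2E.
  by rewrite exprSr invfM le_eqVlt; apply/orP; left; apply/eqP; ring.
have [IA IB] := inv N.
rewrite -/(S N); have [qa|qa] := leP (q ^+ N) a.
  apply: (@le_trans _ _ (c1 * s ^+ N)).
    by apply: IA; rewrite (le_trans qa)// ler_peMr ?ltW.
  apply: (@le_trans _ _ (c1 * a `^ (1 - be))); first by rewrite ler_pM2l// sN.
  rewrite ler_wpM2r ?powR_ge0// (le_trans (_ : c1 <= s * c1))//.
    by rewrite ler_peMl ?ltW.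
  by rewrite lerDl ltW.
apply: le_trans (IB qa); rewrite lerDl mulr_ge0 ?(ltW c20)//.
by rewrite mulr_ge0 ?invr_ge0 ?exprn_ge0 ?ltW.
Qed.

End dyadic_sums.

(** * Smooth functions of compact support and frequency blocks *)

Section bumps.
Context {R : realType} {n : nat}.
Local Notation V := 'rV[R]_n.
Local Notation C := R[i].
Local Notation RC := (real_complex R).
Local Notation lebV := (@lebesgue_rV R n).
Implicit Types (f F : V -> C).

Definition cbump F := smooth F /\ exists2 r : R, 0 < r & vanish_out 0 r F.

Lemma vanish_out_enorm (r : R) F : (forall x, F x != 0 -> enorm x <= r) -> vanish_out 0 r F.
Proof.
move=> h x cx; apply/eqP/negPn/negP => /h xr; apply: cx; apply/cubeP => i.
by rewrite mxE subr0 (le_trans (coord_le_enorm _ _)).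
Qed.

Lemma bump_cintb F : cbump F -> cintb lebV F.
Proof. by move=> [sF [r r0 F0]]; apply: smooth_vanish_cintb sF F0; exact: ltW. Qed.

Lemma bump_schwartz F : cbump F -> schwartz F.
Proof. by move=> [sF [r r0 F0]]; apply: vanish_schwartz sF F0; exact: ltW. Qed.

Lemma bumpM f F : smooth f -> cbump F -> cbump (fun x => f x * F x).
Proof.
move=> sf [sF [r r0 F0]]; split; first exact: smoothM.
by exists r => // x cx; rewrite F0// mulr0.
Qed.

Lemma bump_sum (I : Type) (s : seq I) (F : I -> V -> C) :
  (forall i, cbump (F i)) -> cbump (fun x => \sum_(i <- s) F i x).
Proof.
move=> bF; split; first by apply: smooth_sum => i; have [] := bF i.
elim: s => [|i s [r r0 IH]]; first by exists 1 => // x _; rewrite big_nil.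
have [_ [t t0 Ft]] := bF i.
exists (r + t); first exact: addr_gt0.
move=> x cx; rewrite big_cons IH ?Ft ?addr0//.
  by move: cx; apply: contra_not => /cubeP h; apply/cubeP => j; rewrite (le_trans (h j))// lerDr ltW.
by move: cx; apply: contra_not => /cubeP h; apply/cubeP => j; rewrite (le_trans (h j))// lerDl ltW.
Qed.

Lemma bump_affine F (a : R) y : 0 < a -> cbump F -> cbump (fun x => F (a *: x + y)).
Proof.
move=> a0 [sF [r r0 F0]]; split; first exact: smooth_affine.
exists ((r + \sum_i `|y ord0 i|) / a).
  by rewrite divr_gt0// ltr_pwDl// sumr_ge0.
move=> x cx; apply: F0; move: cx; apply: contra_not => /cubeP h; apply/cubeP => j.
have := h j; rewrite !mxE !subr0 ler_pdivlMr// mulrC => {}h.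
rewrite -(gtr0_norm a0) -normrM (_ : x ord0 j * a = (x ord0 j * a + y ord0 j) - y ord0 j); last by ring.
rewrite (le_trans (ler_normB _ _))// lerD// (bigD1 j)//= lerDl sumr_ge0//.
Qed.

Lemma bump_bounded F : cbump F -> exists2 M : R, 0 <= M & forall x, cabs (F x) <= M.
Proof. by move=> /bump_schwartz; exact: schwartz_bounded. Qed.

Lemma bump_iter_partial i k F : cbump F -> cbump (iter k (partial i) F).
Proof.
move=> bF; elim: k => //= k [sF [r r0 F0]].
by split; [exact: smooth_partial|exists r => //; exact: vanish_partial].
Qed.

(** [osc_decay] at a fixed scale, with a constant that absorbs the derivatives. *)
Lemma cintb_osc_bump F : cbump F -> cintb lebV (osc 1 F).
Proof.
move=> bF; have [sF [r r0 F0]] := bF.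
have [M M0 FM] := bump_bounded bF.
have : forall i, exists M : R, 0 <= M /\ forall x, cabs (iter n.*2 (partial i) F x) <= M.
  by move=> i; have [Mi ? ?] := bump_bounded (bump_iter_partial i n.*2 bF); exists Mi.
move=> /choice[Mi hMi].
pose mu := r / 2.
have mu0 : 0 < mu by rewrite divr_gt0.
have mN : 0 < mu ^+ n.*2 by rewrite exprn_gt0.
pose K := M + \sum_i Mi i * mu ^+ n.*2.
have S0 (P : pred 'I_n) : 0 <= \sum_(i | P i) Mi i * mu ^+ n.*2.
  by apply: sumr_ge0 => i _; rewrite mulr_ge0 ?(ltW mN)//; have [] := hMi i.
have K0 : 0 <= K by rewrite addr_ge0.
have F0' : vanish_out 0 (2 * mu) F by rewrite (_ : 2 * mu = r)// /mu mulrC divfK.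
have FK x : cabs (F x) <= K by rewrite (le_trans (FM x))// lerDl.
have dK i x : cabs (iter n.*2 (partial i) F x) <= K * mu^-1 ^+ n.*2.
  have [Mi0 hi] := hMi i; rewrite exprVn ler_pdivlMr//.
  rewrite (le_trans (ler_wpM2r (ltW mN) (hi x)))//.
  by rewrite /K (bigD1 i)//= addrCA lerDl addr_ge0.
have := osc_decay mu0 K0 sF F0' FK dK; set c := (X in X * mu ^+ n) => h.
apply: (@cintb_le _ _ _ lebV _ (fun x => (c * mu ^+ n) * poissonV (mu *: x + 0))) => //.
- by apply: cmeas_osc; exact: bump_cintb.
- by move=> x; rewrite addr0.
- exact: (integrableZl measurableT _ (integrable_affine 0 mu0 (@integrable_poissonV R n))).
Qed.

Lemma inv_fourierE F : inv_fourier F = fun x => RC ((2 * pi) ^- n) * osc 1 F x.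
Proof. by apply/funext => x; rewrite inv_fourier_osc. Qed.

Lemma cintb_inv_fourier F : cbump F -> cintb lebV (inv_fourier F).
Proof. by move=> bF; rewrite inv_fourierE; apply: cintbZ; exact: cintb_osc_bump. Qed.

Lemma osc_inv_fourier F y : cbump F -> osc (-1) (inv_fourier F) y = F y.
Proof.
move=> bF; have [sF _] := bF; have [c1 c2 _] := smooth_partially_derivable sF.
have [M _ FM] := bump_bounded bF.
rewrite inv_fourierE oscZ; last exact: cintb_osc_bump.
rewrite (osc_inversion _ c1 c2 FM (bump_cintb bF) (cintb_osc_bump bF)) mulrA.
rewrite -(rmorphM (real_complex R)) mulVf ?rmorph1 ?mul1r//.
by rewrite expf_neq0// gt_eqF// mulr_gt0// pi_gt0.
Qed.

(** The transposed definition of [Delta_i u] is the expected one when [u] is a function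
    with a smooth compactly supported Fourier transform [F]. *)
Lemma lp_block_regdistr (psi : nat -> V -> C) i F : cbump (psi i) -> cbump F ->
  distr_of_fun (lp_block psi i (regdistr (inv_fourier F)))
    (inv_fourier (fun xi => psi i xi * F xi)).
Proof.
move=> bpsi bF; have [sF _] := bF; have [spsi _] := bpsi.
have bG := bumpM spsi bF; set G := (fun xi => _) in bG *.
have If := cintb_inv_fourier bF; have Ig := cintb_inv_fourier bG.
split; first exact: cintb_cmeas Ig.
move=> phi sp; split; first exact: cintb_schwartz_mul.
rewrite /lp_block /distr_inv_fourier /distr_mul /distr_fourier /regdistr fourier_osc.
rewrite -[RHS]/(cint lebV _).
have Iphi := schwartz_cintb sp.
set h := (fun x => psi i x * inv_fourier phi x).
have [B hB] := osc_bounded 1 Iphi.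
have mo : cmeas (osc 1 phi) by exact: cmeas_osc.
have Ih : cintb lebV h.
  rewrite /h inv_fourierE.
  apply: (@cintbMr_bounded _ _ _ _ (`|(2 * pi) ^- n| * B)).
  - by apply: cmeasM => //; exact: cmeas_cst.
  - by move=> x; rewrite cabsM cabs_real ler_wpM2l.
  - exact: bump_cintb.
rewrite -osc_duality//.
transitivity (RC ((2 * pi) ^- n) * cint lebV (fun xi => G xi * osc 1 phi xi)).
  rewrite -cintZ; last exact: (cintbMr_bounded mo hB (bump_cintb bG)).
  by apply: eq_cint => xi; rewrite osc_inv_fourier// /h inv_fourierE /G; ring.
rewrite -osc_duality//; last exact: bump_cintb.
rewrite -cintZ; last by apply: cintb_schwartz_mul => //; exact: cintb_osc_bump.
by apply: eq_cint => x; rewrite inv_fourierE; ring.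
Qed.

Lemma inv_fourier_sum (I : Type) (s : seq I) (F : I -> V -> C) x :
  (forall i, cbump (F i)) ->
  inv_fourier (fun xi => \sum_(i <- s) F i xi) x = \sum_(i <- s) inv_fourier (F i) x.
Proof.
move=> bF; rewrite inv_fourierE osc_sum; last by move=> i; exact: bump_cintb.
by rewrite mulr_sumr; apply: eq_bigr => i _; rewrite inv_fourierE.
Qed.

Lemma inv_fourierZ c F x : cbump F -> inv_fourier (fun xi => c * F xi) x = c * inv_fourier F x.
Proof. by move=> bF; rewrite !inv_fourierE oscZ; [ring|exact: bump_cintb]. Qed.

Lemma inv_fourierD F G x : cbump F -> cbump G ->
  inv_fourier (fun xi => F xi + G xi) x = inv_fourier F x + inv_fourier G x.
Proof. by move=> bF bG; rewrite !inv_fourierE oscD ?mulrDr//; exact: bump_cintb. Qed.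

End bumps.

(** * Wave packets adapted to a Littlewood-Paley decomposition *)

Section wave_packets.
Context {R : realType} {n : nat}.
Local Notation V := 'rV[R]_n.
Local Notation C := R[i].
Local Notation RC := (real_complex R).
Local Notation Re := (@complex.Re R).
Local Notation Im := (@complex.Im R).
Local Notation lebV := (@lebesgue_rV R n).
Variable psi : nat -> V -> C.
Hypothesis psiP : lp_decomposition psi.
Implicit Types (mu : R) (c x xi : V).

Lemma lp_smooth j : smooth (psi j).
Proof. by have [/(_ j)[]] := psiP. Qed.

Lemma lp_supp_le j xi : psi j xi != 0 -> enorm xi <= 2 ^+ j.+1.
Proof.
have [_ h0 h _ _] := psiP => nz.
have : supp (psi j) xi by apply: subset_closure.
by case: j nz => [|j] nz; [move/h0; rewrite expr1|move/(h j.+1 isT) => /andP[]].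
Qed.

Lemma lp_supp_ge j xi : psi j.+1 xi != 0 -> 2 ^+ j <= enorm xi.
Proof.
have [_ h0 h _ _] := psiP => nz.
have : supp (psi j.+1) xi by apply: subset_closure.
by move/(h j.+1 isT) => /andP[].
Qed.

Lemma lp_bump j : cbump (psi j).
Proof.
split; first exact: lp_smooth.
by exists (2 ^+ j.+1); [rewrite exprn_gt0|apply: vanish_out_enorm => x; exact: lp_supp_le].
Qed.

(** The partial sums are eventually constant. *)
Lemma lp_sum N xi : (forall i, (N <= i)%N -> psi i xi = 0) -> \sum_(0 <= i < N) psi i xi = 1.
Proof.
move=> h; have [_ _ _ _ /(_ xi)[cR cI]] := psiP.
have ser (P : C -> R) (PD : {morph P : x y / x + y}) (P0 : P 0 = 0) l :
    series (fun j => P (psi j xi)) @ \oo --> l -> P (\sum_(0 <= i < N) psi i xi) = l.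
  move=> cl; rewrite (big_morph _ PD P0).
  have : series (fun j => P (psi j xi)) @ \oo --> \sum_(0 <= i < N) P (psi i xi).
    apply: cvg_near_cst; near=> m.
    have Nm : (N <= m)%N by near: m; exact: nbhs_infty_ge.
    rewrite /series/= (big_cat_nat (n := N))//= [X in _ + X]big_nat_cond [X in _ + X]big1 ?addr0//.
    by move=> i /andP[/andP[Ni _] _]; rewrite h.
  by move=> c; apply: cvg_unique c cl.
apply: complexP => /=; first by apply: ser cR => //; exact: cReD.
by apply: ser cI => //; exact: cImD.
Unshelve. all: by end_near. Qed.

(** The other supports end before the open annulus, or begin after it. *)
Lemma lp_annulus_other j i xi : 2 ^+ j < enorm xi < 2 ^+ j.+1 -> i != j -> i != j.+1 ->
  psi i xi = 0.
Proof.
move=> /andP[lo hi] ij ij1; apply/eqP/negPn/negP => nz.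
have := lp_supp_le nz; rewrite leNgt => /negP; apply.
have [ji|ij'] := ltnP i j.
  by apply: le_lt_trans lo; rewrite ler_weXn2l// ler1n.
case: i nz ij ij1 ij' => [|i] nz ij ij1 ij'.
  by move: ij' ij; rewrite leqn0 => /eqP ->.
have := lp_supp_ge nz; rewrite leNgt => /negP; case.
apply: (lt_le_trans hi); rewrite ler_weXn2l ?ler1n//.
by move: ij ij1 ij'; lia.
Qed.

Lemma lp_annulus_sum j xi : 2 ^+ j < enorm xi < 2 ^+ j.+1 -> psi j xi + psi j.+1 xi = 1.
Proof.
move=> h; rewrite -(@lp_sum j.+2 xi); last first.
  by move=> i ji; apply: (lp_annulus_other h); move: ji; lia.
rewrite big_nat_recr//= big_nat_recr//= big_nat_cond big1 ?add0r//.
move=> i /andP[/andP[_ ij] _]; apply: (lp_annulus_other h); move: ij; lia.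
Qed.

Lemma lp_psi0_0 : psi 0 0 = 1.
Proof.
rewrite -[RHS](@lp_sum 1 0) ?big_nat1// => -[//|i] _.
apply/eqP/negPn/negP => /lp_supp_ge; apply/negP; rewrite -ltNge.
rewrite /enorm big1 ?sqrtr0 ?exprn_gt0// => k _; by rewrite mxE expr0n.
Qed.

(** The pure derivatives are those which [osc_decay] consumes; a finite number of them is
    bounded by the same constant. *)
Lemma lp_deriv_bound N : exists A : R, [/\ 1 <= A, forall j x, cabs (psi j x) <= A &
  forall k i j x, (k <= N)%N -> cabs (iter k (partial i) (psi j) x) <= A * (2 ^+ j)^-1 ^+ k].
Proof.
have [_ _ _ hd _] := psiP.
have key (a : 'I_n -> nat) : exists A : R, 0 <= A /\
    forall j x, cabs (mderiv a (psi j) x) <= A * (2 ^+ j)^-1 ^+ mlen a.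
  have := hd a; set S := ereal_sup _ => Soo.
  have ub j x : ((2 ^+ (j * mlen a)%N * cabs (mderiv a (psi j) x))%:E <= S)%E.
    by apply: ereal_sup_ubound; exists (j, x).
  have S0 : (0 <= S)%E.
    by apply: le_trans (ub 0%N 0); rewrite lee_fin mulr_ge0 ?cabs_ge0 ?exprn_ge0.
  exists (fine S); split; first exact: fine_ge0.
  move=> j x; rewrite exprVn ler_pdivlMr ?exprn_gt0// -exprM mulrC.
  by rewrite -lee_fin fineK ?ge0_fin_numE.
have [A' [A'0 hA']] := key (fun=> 0%N).
have := fun ki : nat * 'I_n => key (fun l => if l == ki.2 then ki.1 else 0%N).
move=> /choice[A hA].
have S0 (P : pred 'I_n) k : 0 <= \sum_(i | P i) A (k, i).
  by apply: sumr_ge0 => i _; have [] := hA (k, i).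
have T0 (P : pred nat) : 0 <= \sum_(0 <= k < N.+1 | P k) \sum_i A (k, i).
  by rewrite sumr_ge0.
exists (1 + A' + \sum_(0 <= k < N.+1) \sum_i A (k, i)); split.
- by rewrite -addrA lerDl addr_ge0.
- move=> j x; have := hA' j x; rewrite mderiv0 /mlen big1// expr0 mulr1 => h.
  by apply: (le_trans h); rewrite addrAC lerDr addr_ge0.
move=> k i j x kN; have [A0 /(_ j x)] := hA (k, i).
have -> : mlen (fun l : 'I_n => if l == i then k else 0%N) = k.
  by rewrite /mlen -big_mkcond/= big_pred1_eq.
rewrite mderiv_nseq => h.
apply: (le_trans h); rewrite ler_wpM2r ?exprn_ge0 ?invr_ge0 ?exprn_ge0//.
rewrite (bigD1_seq k) ?iota_uniq ?mem_index_iota//= (bigD1 i)//=.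
by have := S0 (fun l => l != i) k; have := T0 (fun l => l != k); lra.
Qed.

(** The Fourier transform of a wave packet of frequency [c], spatial scale [mu^-1] and
    amplitude independent of both. *)
Definition atom (mu : R) (c xi : V) : C := RC (mu ^- n) * psi 0 (mu^-1 *: (xi - c)).

Lemma atom_supp mu c xi : 0 < mu -> atom mu c xi != 0 -> enorm (xi - c) <= 2 * mu.
Proof.
move=> mu0; rewrite /atom mulf_eq0 negb_or => /andP[_] /lp_supp_le.
by rewrite enormZ ?invr_gt0// expr1 mulrC ler_pdivrMr.
Qed.

Lemma bump_psi0_affine mu c : 0 < mu -> cbump (fun xi => psi 0 (mu^-1 *: (xi - c))).
Proof.
move=> mu0; under eq_fun do rewrite scalerBr.
by apply: bump_affine; [rewrite invr_gt0|exact: lp_bump].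
Qed.

Lemma bump_atom mu c : 0 < mu -> cbump (atom mu c).
Proof. by move=> mu0; apply: bumpM; [exact: smooth_cst|exact: bump_psi0_affine]. Qed.

Lemma inv_fourier_atom mu c x : 0 < mu ->
  inv_fourier (atom mu c) x = expi (dotp c x) * inv_fourier (psi 0) (mu *: x).
Proof.
move=> mu0; have mun : mu ^+ n != 0 by rewrite expf_neq0// gt_eqF.
rewrite inv_fourierZ; last exact: bump_psi0_affine.
rewrite !inv_fourierE osc_affine//; last by apply: bump_cintb; exact: lp_bump.
rewrite mul1r; set a := RC (mu ^- n).
have -> : a * (RC ((2 * pi) ^- n) * (RC (mu ^+ n) * expi (dotp c x) * osc 1 (psi 0) (mu *: x))) =
  a * RC (mu ^+ n) * (expi (dotp c x) * (RC ((2 * pi) ^- n) * osc 1 (psi 0) (mu *: x))) by ring.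
by rewrite /a -(rmorphM (real_complex R)) mulVf// rmorph1 mul1r.
Qed.

(** The symbols [psi_i(xi) psi_0((xi - c)/mu)] satisfy symbol estimates at scale [mu],
    uniformly in all parameters. *)
Lemma atom_block_decay : exists2 B : R, 0 < B & forall i mu c, 0 < mu <= 2 ^+ i ->
  forall x, cabs (inv_fourier (fun xi => psi i xi * atom mu c xi) x) <= B * poissonV (mu *: x).
Proof.
have [A [A1 bA hA]] := lp_deriv_bound n.*2.
have A0 : 0 < A by exact: lt_le_trans A1.
pose K := 2 ^+ n.*2 * (A * A).
have K0 : 0 < K by rewrite !mulr_gt0 ?exprn_gt0.
pose c0 := (2 * K * pi ^+ n.*2 * (4 + 2 * (n.*2)%:R * pi) ^+ n).
have p0 : 0 < pi :> R by exact: pi_gt0.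
exists ((2 * pi) ^- n * c0).
  rewrite mulr_gt0 ?invr_gt0 ?exprn_gt0 ?mulr_gt0// ?exprn_gt0// ltr_pwDl//.
  by rewrite !mulr_ge0// ltW.
move=> i mu c /andP[mu0 mui] x.
have mun : mu ^+ n != 0 by rewrite expf_neq0// gt_eqF.
set m := fun xi => psi i xi * psi 0 (mu^-1 *: (xi - c)).
have bm : cbump m by apply: bumpM; [exact: lp_smooth|exact: bump_psi0_affine].
have -> : (fun xi => psi i xi * atom mu c xi) = fun xi => RC (mu ^- n) * m xi.
  by apply/funext => xi; rewrite /atom /m mulrCA.
rewrite inv_fourierZ// inv_fourierE !cabsM !cabs_real !ger0_norm; last 2 first.
- by rewrite invr_ge0 exprn_ge0// ltW// mulr_gt0.
- by rewrite invr_ge0 exprn_ge0// ltW.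
have sa : smooth (fun xi => psi 0 (mu^-1 *: (xi - c))) by have [] := bump_psi0_affine c mu0.
have d1 l k y : (k <= n.*2)%N -> cabs (iter k (partial l) (psi i) y) <= A * mu^-1 ^+ k.
  move=> kN; rewrite (le_trans (hA _ _ _ _ kN))// ler_wpM2l ?(ltW A0)//.
  rewrite !exprVn lef_pV2 ?posrE ?exprn_gt0//.
  by rewrite lerXn2r ?nnegrE ?exprn_ge0 ?(ltW mu0).
have d2 l k y : (k <= n.*2)%N ->
    cabs (iter k (partial l) (fun xi => psi 0 (mu^-1 *: (xi - c))) y) <= A * mu^-1 ^+ k.
  move=> kN; rewrite (_ : (fun xi => _) = (fun xi => psi 0 (mu^-1 *: xi + (- (mu^-1 *: c))))); last first.
    by apply/funext => xi; rewrite scalerBr.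
  rewrite iter_partial_affine; last exact: lp_smooth.
  rewrite cabsM cabs_real ger0_norm ?exprn_ge0 ?invr_ge0 ?(ltW mu0)//.
  rewrite mulrC ler_wpM2r ?exprn_ge0 ?invr_ge0 ?(ltW mu0)//.
  by rewrite (le_trans (hA _ _ _ _ kN))// expr0 invr1 expr1n mulr1.
have mK y : cabs (m y) <= K.
  rewrite cabsM (le_trans (ler_pM _ _ (bA _ _) (bA _ _))) ?cabs_ge0//.
  by rewrite ler_peMl ?mulr_ge0 ?(ltW A0)// exprn_ege1// ler1n.
have vm : vanish_out c (2 * mu) m.
  move=> y cy; apply/eqP/negPn/negP => ny; apply: cy; apply/cubeP => l.
  have : atom mu c y != 0.
    move: ny; rewrite /m /atom !mulf_eq0 !negb_or => /andP[_ ->]; rewrite andbT.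
    by rewrite fmorph_eq0 invr_eq0.
  move=> /(atom_supp mu0); apply: le_trans.
  by have := coord_le_enorm (y - c) l; rewrite !mxE.
have dm l y : cabs (iter n.*2 (partial l) m y) <= K * mu^-1 ^+ n.*2.
  by apply: leibniz_bound; [rewrite invr_ge0 ltW|exact: lp_smooth|exact: sa|move=> k z kN; exact: d1|move=> k z kN; exact: d2].
have := osc_decay mu0 (ltW K0) bm.1 vm mK dm x; rewrite -/c0 => h.
apply: (le_trans (ler_wpM2l _ (ler_wpM2l _ h))).
- by rewrite invr_ge0 exprn_ge0// ltW.
- by rewrite invr_ge0 exprn_ge0// ltW// mulr_gt0.
set p1 := (2 * pi) ^- n; set p2 := poissonV _.
rewrite [leLHS](_ : _ = mu ^- n * mu ^+ n * (p1 * c0 * p2)); last by ring.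
by rewrite mulVf// mul1r.
Qed.

End wave_packets.

Section mass_bounds.
Context {R : realType} {n : nat}.
Local Notation V := 'rV[R]_n.
Local Notation C := R[i].
Local Notation lebV := (@lebesgue_rV R n).
Implicit Types (f g : V -> C) (E : set V).

(** The size of a bump of height [B] carried by a set of measure [M]. *)
Definition mass_bound (B M : R) f := [/\ cmeas f, forall x, cabs (f x) <= B &
  (\int[lebV]_x (cabs (f x))%:E <= (B * M)%:E)%E].

Lemma mass_bound_min (B M : R) f E (a : R) : 0 <= B -> mass_bound B M f ->
  measurable E -> lebV E = a%:E ->
  (\int[lebV]_(x in E) (cabs (f x))%:E <= (B * Num.min a M)%:E)%E.
Proof.
move=> B0 [mf fB fM] mE Ea.
have mc := measurable_cabs_EFin mf.
have [_|_] := leP a M.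
  rewrite EFinM -Ea -(integral_cst _ mE); apply: ge0_le_integral => //.
  - by move=> x _; rewrite lee_fin cabs_ge0.
  - exact: measurable_funTS.
  - by move=> x _; rewrite lee_fin.
apply: le_trans fM; apply: ge0_subset_integral => // x _.
by rewrite lee_fin cabs_ge0.
Qed.

Lemma min_le_powR (a M al : R) : 0 < a -> 0 < M -> 0 <= al <= 1 ->
  Num.min a M <= M `^ (1 - al) * a `^ al.
Proof.
move=> a0 M0 /andP[al0 al1]; have al1' : 0 <= 1 - al by rewrite subr_ge0.
have E (b : R) : 0 < b -> b = b `^ (1 - al) * b `^ al.
  by move=> b0; rewrite -powRD ?subrK ?powRr1 ?ltW// gt_eqF ?implybT.
have [h|h] := leP a M.
  rewrite {1}(E a a0) ler_wpM2r ?powR_ge0//; apply: ge0_ler_powR => //; rewrite nnegrE ltW//.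
rewrite {1}(E M M0) ler_wpM2l ?powR_ge0//; apply: ge0_ler_powR => //; rewrite ?nnegrE ltW//.
Qed.

(** From [min(a, M) <= M^(1-al) a^al]: the constant is the size of the function in the
    corresponding Lorentz space. *)
Lemma mass_bound_setbound (B M al : R) f : 0 < B -> 0 < M -> 0 < al <= 1 ->
  mass_bound B M f -> setbound f (B * M `^ (1 - al)) al.
Proof.
move=> B0 M0 /andP[al0 al1] mb; apply: setboundP => //; first by case: mb.
  by rewrite mulr_gt0// powR_gt0.
move=> E a mE Ea a0; apply: (le_trans (mass_bound_min (ltW B0) mb mE Ea)).
by rewrite lee_fin -mulrA ler_wpM2l ?(ltW B0)// min_le_powR// (ltW al0).
Qed.

Lemma setboundZ (c : C) f (D al : R) : cmeas f -> setbound f D al ->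
  setbound (fun x => c * f x) (cabs c * D) al.
Proof.
move=> mf h E mE; under eq_integral do rewrite cabsM EFinM.
rewrite ge0_integralZl//.
- by rewrite EFinM -muleA lee_wpmul2l ?lee_fin ?cabs_ge0// h.
- by apply: measurable_funTS; exact: measurable_cabs_EFin.
- by move=> x _; rewrite lee_fin cabs_ge0.
- by rewrite lee_fin cabs_ge0.
Qed.

Lemma setbound_le f (D D' al : R) : D <= D' -> setbound f D al -> setbound f D' al.
Proof.
move=> DD h E mE; apply: (le_trans (h E mE)).
by rewrite lee_wpmul2r ?lee_fin// poweR_ge0.
Qed.

Lemma setbound0 (D al : R) : 0 <= D -> setbound ((fun=> 0) : V -> C) D al.
Proof.
move=> D0 E mE; rewrite integral0_eq => [|x _]; last by rewrite cabs0.
by apply: mule_ge0; [rewrite lee_fin|exact: poweR_ge0].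
Qed.

Lemma integral_cabs_sum_le (I : Type) (s : seq I) (f : I -> V -> C) (b : I -> R) E :
  measurable E -> (forall i, cmeas (f i)) ->
  (forall i, \int[lebV]_(x in E) (cabs (f i x))%:E <= (b i)%:E)%E ->
  (\int[lebV]_(x in E) (cabs (\sum_(i <- s) f i x))%:E <= (\sum_(i <- s) b i)%:E)%E.
Proof.
move=> mE mf fb; elim: s => [|i s IH].
  by rewrite big_nil integral0_eq// => x _; rewrite big_nil cabs0.
have mg := measurable_cabs_EFin (mf i).
have ms : measurable_fun setT (fun x => (cabs (\sum_(i <- s) f i x))%:E).
  by apply: measurable_cabs_EFin; exact: cmeas_sum.
rewrite big_cons EFinD; apply: le_trans (leeD (fb i) IH).
rewrite -ge0_integralD//; last 4 first.
- by move=> x _; rewrite lee_fin cabs_ge0.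
- exact: measurable_funTS.
- by move=> x _; rewrite lee_fin cabs_ge0.
- exact: measurable_funTS.
apply: ge0_le_integral => //.
- by move=> x _; rewrite lee_fin cabs_ge0.
- apply: measurable_funTS; apply: measurable_cabs_EFin; exact: cmeas_sum.
- by apply: emeasurable_funD; exact: measurable_funTS.
- by move=> x _; rewrite big_cons -EFinD lee_fin ler_cabsD.
Qed.

Lemma poisson_mass_bound (B mu : R) f : 0 < mu -> 0 <= B -> cmeas f ->
  (forall x, cabs (f x) <= B * poissonV (mu *: x)) ->
  mass_bound (B * (2 * pi) ^+ n) (mu ^- n) f.
Proof.
move=> mu0 B0 mf h; split => //.
  move=> x; apply: (le_trans (h x)); rewrite ler_wpM2l// (le_trans (poissonV_le _))//.
  by rewrite lerXn2r ?nnegrE ?mulr_ge0 ?pi_ge0// ler_peMr// (le_trans _ (@pi_ge2 R))// ler1n.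
have mp : measurable_fun setT (fun x : V => (poissonV x)%:E).
  by apply/measurable_EFinP; exact: measurable_poissonV.
have ma : measurable_fun setT (fun x : V => (poissonV (mu *: x + 0))%:E).
  exact: (measurableT_comp mp (measurable_affine mu 0)).
apply: (@le_trans _ _ (\int[lebV]_x (B%:E * (poissonV (mu *: x + 0))%:E))%E).
  apply: ge0_le_integral => //.
  - by move=> x _; rewrite lee_fin cabs_ge0.
  - exact: measurable_cabs_EFin.
  - by apply: measurable_funeM.
  - by move=> x _; rewrite addr0 -EFinM lee_fin.
rewrite ge0_integralZl ?lee_fin//; last by move=> x _; rewrite lee_fin poissonV_ge0.
have := @ge0_integral_affine R n mu 0 _ mu0 mp (fun x => poissonV_ge0 x).
rewrite integral_poissonV => /esym e.
have -> : (\int[lebV]_x (poissonV (mu *: x + 0))%:E = (mu ^- n)%:E * ((2 * pi) ^+ n)%:E)%E.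
  by rewrite -e muleA -EFinM mulVf ?mul1e// expf_neq0// gt_eqF.
by rewrite -!EFinM lee_fin le_eqVlt; apply/orP; left; apply/eqP; ring.
Qed.

End mass_bounds.

Section packets.
Context {R : realType} {n : nat}.
Local Notation V := 'rV[R]_n.
Local Notation C := R[i].
Local Notation RC := (real_complex R).
Local Notation Re := (@complex.Re R).
Local Notation Im := (@complex.Im R).
Local Notation lebV := (@lebesgue_rV R n).
Variable psi : nat -> V -> C.
Hypothesis psiP : lp_decomposition psi.
Variable i0 : 'I_n.
Implicit Types (mu : R) (c x xi : V).

(** The middle of the annulus on which only [psi_j] and [psi_(j+1)] live. *)
Definition freq j : V := (3 / 2 * 2 ^+ j) *: delta_mx ord0 i0.

(** The support has radius [2 mu <= 2^j / 4] around a point at distance [2^j / 2] from the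
    boundary of the annulus. *)
Lemma atom_annulus j mu xi : 0 < mu <= 2 ^+ j / 8 -> atom psi mu (freq j) xi != 0 ->
  2 ^+ j < enorm xi < 2 ^+ j.+1.
Proof.
move=> /andP[mu0 muj] /(atom_supp psiP mu0); set eta := xi - freq j => he.
set T : R := 2 ^+ j in muj *; have T0 : 0 < T by rewrite exprn_gt0.
have e4 : enorm eta <= T / 4 by lra.
have ce : eta ord0 i0 = xi ord0 i0 - 3 / 2 * T by rewrite !mxE !eqxx mulr1.
have := le_trans (coord_le_enorm eta i0) e4; rewrite ce ler_distl => /andP[lo hi].
apply/andP; split.
  have := le_trans (ler_norm _) (coord_le_enorm xi i0); lra.
have S0 (z : V) : 0 <= \sum_(i < n) z ord0 i ^+ 2 by apply: sumr_ge0 => i _; exact: sqr_ge0.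
have SE : \sum_(i < n) xi ord0 i ^+ 2 =
    \sum_(i < n) eta ord0 i ^+ 2 + 2 * (3 / 2 * T) * xi ord0 i0 - (3 / 2 * T) ^+ 2.
  rewrite (bigD1 i0)//= [in RHS](bigD1 i0)//= ce.
  rewrite [in RHS](eq_bigr (fun i => xi ord0 i ^+ 2)); last first.
    by move=> i ii; rewrite !mxE (negbTE ii) andbF mulr0 subr0.
  by ring.
have e2 : \sum_(i < n) eta ord0 i ^+ 2 <= (T / 4) ^+ 2.
  rewrite -(sqr_sqrtr (S0 eta)) lerXn2r ?nnegrE ?sqrtr_ge0//.
  by rewrite divr_ge0// ltW.
have : enorm xi ^+ 2 <= (7 / 4 * T) ^+ 2 by rewrite sqr_sqrtr// SE; nra.
rewrite ler_pXn2r ?nnegrE ?enorm_ge0 ?mulr_ge0 ?(ltW T0)// => /le_lt_trans; apply.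
by rewrite exprS -/T; lra.
Qed.

Lemma atom_block_eq0 i j mu xi : 0 < mu <= 2 ^+ j / 8 -> i != j -> i != j.+1 ->
  psi i xi * atom psi mu (freq j) xi = 0.
Proof.
move=> hmu ij ij1; have [->|nz] := eqVneq (atom psi mu (freq j) xi) 0; first by rewrite mulr0.
by rewrite (lp_annulus_other psiP (atom_annulus hmu nz))// mul0r.
Qed.

Lemma atom_block_sum j mu xi : 0 < mu <= 2 ^+ j / 8 ->
  psi j xi * atom psi mu (freq j) xi + psi j.+1 xi * atom psi mu (freq j) xi =
  atom psi mu (freq j) xi.
Proof.
move=> hmu; have [->|nz] := eqVneq (atom psi mu (freq j) xi) 0; first by rewrite !mulr0 addr0.
by rewrite -mulrDl (lp_annulus_sum psiP (atom_annulus hmu nz)) mul1r.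
Qed.

Lemma atom_block_mass : exists2 B : R, 0 < B & forall i mu c, 0 < mu <= 2 ^+ i ->
  mass_bound B (mu ^- n) (inv_fourier (fun xi => psi i xi * atom psi mu c xi)).
Proof.
have [B B0 hB] := atom_block_decay psiP.
exists (B * (2 * pi) ^+ n); first by rewrite mulr_gt0// exprn_gt0// mulr_gt0// pi_gt0.
move=> i mu c hmu; have /andP[mu0 _] := hmu.
apply: poisson_mass_bound => //; [exact: ltW| |exact: hB].
apply: cintb_cmeas; apply: cintb_inv_fourier; apply: bumpM; first exact: lp_smooth.
exact: bump_atom.
Qed.

(** The phase cancels that of a packet of frequency [c], at the same scale; taking [psi_0]
    as profile makes it a Schwartz function without further construction. *)
Definition tester (eps mu : R) c x : C := expi (dotp (- c) x) * psi 0 ((eps * mu) *: x).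

Lemma bump_tester eps mu c : 0 < eps -> 0 < mu -> cbump (tester eps mu c).
Proof.
move=> e0 mu0; apply: bumpM; first exact: smooth_expi.
have := bump_affine 0 (mulr_gt0 e0 mu0) (lp_bump psiP 0).
by under eq_fun do rewrite addr0.
Qed.

Lemma tester_mass eps : 0 < eps -> exists2 B : R, 0 < B & forall mu c, 0 < mu ->
  mass_bound B (mu ^- n) (tester eps mu c).
Proof.
move=> e0; have [M M0 hM] := bump_bounded (lp_bump psiP 0).
exists (M * (4 / eps) ^+ n + M + 1); first by rewrite ltr_wpDl// addr_ge0// mulr_ge0// exprn_ge0// divr_ge0// ltW.
move=> mu c mu0; have mt := smooth_cmeas (bump_tester c e0 mu0).1.
have e4 : 0 <= (4 / eps) ^+ n by rewrite exprn_ge0// divr_ge0// ltW.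
have le1 x : cabs (tester eps mu c x) <= M by rewrite cabsM cabs_expi mul1r.
split => //; first by move=> x; rewrite (le_trans (le1 x))// -addrA addrCA lerDl addr_ge0// mulr_ge0.
have em : 0 < eps * mu by exact: mulr_gt0.
have := @vanish_integral_le R n 0 (2 / (eps * mu)) (tester eps mu c) M _ M0 mt _ le1.
have r0 : 0 <= 2 / (eps * mu) by rewrite divr_ge0// ltW.
have vt : vanish_out 0 (2 / (eps * mu)) (tester eps mu c).
  apply: vanish_out_enorm => x; rewrite /tester mulf_eq0 negb_or => /andP[_ /(lp_supp_le psiP)].
  by rewrite enormZ// expr1 ler_pdivlMr// mulrC.
move=> /(_ r0 vt) /le_trans; apply; rewrite lee_fin.
have -> : 2 * (2 / (eps * mu)) = (4 / eps) * mu^-1.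
  by rewrite invfM; ring.
rewrite exprMn exprVn mulrA ler_wpM2r ?invr_ge0 ?exprn_ge0 ?(ltW mu0)//.
by rewrite -addrA lerDl addr_ge0.
Qed.

Definition pairing eps := cint lebV (fun x => inv_fourier (psi 0) x * psi 0 (eps *: x)).

(** All the packets have the same pairing with their testers, up to scaling. *)
Lemma cint_atom_tester eps mu c : 0 < eps -> 0 < mu ->
  cint lebV (fun x => inv_fourier (atom psi mu c) x * tester eps mu c x) =
  RC (mu ^- n) * pairing eps.
Proof.
move=> e0 mu0; have mun : mu ^+ n != 0 by rewrite expf_neq0// gt_eqF.
have [M M0 hM] := bump_bounded (lp_bump psiP 0).
have Ip : cintb lebV (fun x => inv_fourier (psi 0) x * psi 0 (eps *: x)).
  apply: (@cintbMr_bounded _ _ _ _ M) => //; last exact: (cintb_inv_fourier (lp_bump psiP 0)).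
  have := smooth_cmeas (smooth_affine eps 0 (lp_smooth psiP 0)).
  by under eq_fun do rewrite addr0.
have -> : pairing eps = RC (mu ^+ n) * cint lebV (fun x => inv_fourier (atom psi mu c) x * tester eps mu c x).
  rewrite /pairing (cint_affine 0 mu0 Ip); congr (_ * _); apply: eq_cint => x.
  rewrite addr0 inv_fourier_atom// /tester dotpNl scalerA.
  have e1 : expi (dotp c x) * expi (- dotp c x) = 1 by rewrite -expiD subrr expi0.
  by rewrite mulrACA e1 mul1r.
by rewrite mulrA -(rmorphM (real_complex R)) mulVf// rmorph1 mul1r.
Qed.

(** As [eps -> 0] the pairing tends to the integral of the inverse transform of [psi_0],
    which is [psi_0(0) = 1]. *)
Lemma pairing_ge : exists2 eps : R, 0 < eps & 1 / 2 <= Re (pairing eps).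
Proof.
have b0 := lp_bump psiP 0; have If := cintb_inv_fourier b0.
have [M M0 hM] := bump_bounded b0.
have [c1 c2 _] := smooth_partially_derivable (lp_smooth psiP 0).
pose f_ (k : nat) x := inv_fourier (psi 0) x * psi 0 ((k.+1%:R^-1 : R) *: x).
have ca (F : V -> R) x : continuous F -> (fun k : nat => F ((k.+1%:R^-1 : R) *: x)) @ \oo --> F 0.
  move=> cF; apply: (@cvg_comp _ _ _ (fun k : nat => (k.+1%:R^-1 : R) *: x) F _ (nbhs (0 : V))); last exact: cF.
  rewrite -(scale0r x); apply: cvgZr_tmp; exact: cvg_harmonic.
have mf k : cmeas (f_ k).
  apply: cmeasM; first exact: cintb_cmeas If.
  have := smooth_cmeas (smooth_affine (k.+1%:R^-1) 0 (lp_smooth psiP 0)).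
  by under eq_fun do rewrite addr0.
have z0 := lp_psi0_0 psiP.
have [] := @cint_dominated _ _ _ lebV f_ (inv_fourier (psi 0)) (fun x => M * cabs (inv_fourier (psi 0) x)) mf (cintb_cmeas If).
- move=> x; set I := inv_fourier (psi 0) x; pose xk (k : nat) := (k.+1%:R^-1 : R) *: x.
  have : (fun k => Re I * Re (psi 0 (xk k)) - Im I * Im (psi 0 (xk k))) @ \oo -->
      Re I * Re (psi 0 0) - Im I * Im (psi 0 0).
    by apply: cvgB; apply: cvgM; [exact: cvg_cst|exact: (ca _ x c1)|exact: cvg_cst|exact: (ca _ x c2)].
  rewrite z0 /= mulr1 mulr0 subr0; apply: cvg_trans; apply: near_eq_cvg.
  by near=> k; rewrite /f_ cReM.
- move=> x; set I := inv_fourier (psi 0) x; pose xk (k : nat) := (k.+1%:R^-1 : R) *: x.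
  have : (fun k => Re I * Im (psi 0 (xk k)) + Im I * Re (psi 0 (xk k))) @ \oo -->
      Re I * Im (psi 0 0) + Im I * Re (psi 0 0).
    by apply: cvgD; apply: cvgM; [exact: cvg_cst|exact: (ca _ x c2)|exact: cvg_cst|exact: (ca _ x c1)].
  rewrite z0 /= mulr1 mulr0 add0r; apply: cvg_trans; apply: near_eq_cvg.
  by near=> k; rewrite /f_ cImM.
- exact: (integrableZl measurableT M (cintb_norm_integrable If)).
- by move=> k x; rewrite cabsM mulrC ler_wpM2r// cabs_ge0.
have -> : cint lebV (inv_fourier (psi 0)) = 1.
  rewrite -z0 -(osc_inv_fourier 0 b0); apply: eq_cint => y.
  by rewrite dotpC -(scale0r 0) dotpZl mul0r mulr0 expi0 mulr1.
move=> /= cv _; have : \forall k \near \oo, 1 / 2 <= Re (cint lebV (f_ k)).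
  apply: (cvgr_ge _ cv); lra.
move=> [N _ /(_ N (leqnn N)) h].
by exists N.+1%:R^-1 => //; rewrite invr_gt0.
Unshelve. all: by end_near. Qed.

(** The two blocks which see a given annulus together return the whole function. *)
Lemma lp_block_pairing j F G phi : cbump F -> cbump G -> schwartz phi ->
  (forall xi, psi j xi * F xi + psi j.+1 xi * F xi = G xi) ->
  lp_block psi j (regdistr (inv_fourier F)) phi +
  lp_block psi j.+1 (regdistr (inv_fourier F)) phi =
  cint lebV (fun x => inv_fourier G x * phi x).
Proof.
move=> bF bG sp FG.
have bb i : cbump (fun xi => psi i xi * F xi) by apply: bumpM => //; exact: lp_smooth.
have [_ /(_ phi sp)[i1 ->]] := lp_block_regdistr (lp_bump psiP j) bF.
have [_ /(_ phi sp)[i2 ->]] := lp_block_regdistr (lp_bump psiP j.+1) bF.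
rewrite -[LHS]/(cint lebV _ + cint lebV _) -cintD//; apply: eq_cint => x.
by rewrite -mulrDl -inv_fourierD//; congr (inv_fourier _ x * _); apply/funext => xi; rewrite FG.
Qed.

End packets.

Section besov_bounds.
Context {R : realType} {n : nat}.
Local Notation V := 'rV[R]_n.
Local Notation C := R[i].
Local Notation lebV := (@lebesgue_rV R n).
Variable psi : nat -> V -> C.
Implicit Types (u : @distr R n) (s p D : R).

Lemma distr_lorentz_ge0 p q u : (0 <= distr_lorentz_norm p q u)%E.
Proof.
apply: le_ereal_inf_tmp => _ [g _ <-]; rewrite /lorentz_norm; case: q => [r| |]//.
  exact: poweR_ge0.
apply: (@le_trans _ _ (1%:E * distribution_fun g 1 `^ p^-1)%E).
  by apply: mule_ge0 => //; exact: poweR_ge0.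
by apply: ereal_sup_ubound; exists 1 => //=; rewrite in_itv/= ltr01.
Qed.

Lemma besov_weak_le s p D u : 0 <= D ->
  (forall i, exists2 g, distr_of_fun (lp_block psi i u) g &
     (lorentz_norm p +oo g <= (D * 2 `^ (- (i%:R * s)))%:E)%E) ->
  (besov_norm psi s +oo p +oo u <= D%:E)%E.
Proof.
move=> D0 h; rewrite /besov_norm unlock; case: ifP => _; last by rewrite lee_fin.
apply/ess_sup_inf.ess_supP; apply: aeW => i /=.
have t0 : 0 < 2 `^ (i%:R * s) :> R by exact: powR_gt0.
rewrite gee0_abs; last by rewrite mule_ge0 ?lee_fin ?(ltW t0)// distr_lorentz_ge0.
have [g dg gD] := h i.
have : (distr_lorentz_norm p +oo (lp_block psi i u) <= (D * 2 `^ (- (i%:R * s)))%:E)%E.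
  by apply: le_trans gD; apply: ereal_inf_lbound; exists g.
move=> /(lee_wpmul2l (x := (2 `^ (i%:R * s))%:E)) -/(_ (ltW t0)) /le_trans; apply.
by rewrite -EFinM powRN mulrCA mulfV ?mulr1// gt_eqF.
Qed.

Lemma besov_strong_ge s p u N :
  (\sum_(0 <= j < N) (2 `^ (j%:R * s))%:E * distr_lorentz_norm p 1 (lp_block psi j u) <=
   besov_norm psi s 1 p 1 u)%E.
Proof.
have t0 (j : nat) : (0 <= (2 `^ (j%:R * s))%:E * distr_lorentz_norm p 1 (lp_block psi j u))%E.
  by rewrite mule_ge0 ?lee_fin ?powR_ge0// distr_lorentz_ge0.
rewrite /besov_norm Lnorm1 (eq_integral (fun j : nat => (2 `^ (j%:R * s))%:E * distr_lorentz_norm p 1 (lp_block psi j u)))%E; last first.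
  by move=> j _; rewrite gee0_abs.
rewrite ge0_integral_count//; exact: nneseries_lim_ge.
Qed.

(** The norm of a block is an infimum over the functions representing it, and the bound
    holds for each of them. *)
Lemma lp_block_pair_le p D i u phi : 0 < p -> 0 < D -> schwartz phi -> setbound phi D p^-1 ->
  ((cabs (lp_block psi i u phi))%:E <=
   (2 * (D / p))%:E * distr_lorentz_norm p 1 (lp_block psi i u))%E.
Proof.
move=> p0 D0 sp hphi; have c0 : 0 < 2 * (D / p) by rewrite mulr_gt0// divr_gt0.
rewrite -lee_pdivrMl//; apply: le_ereal_inf_tmp => _ [g [mg /(_ phi sp)[Ig E]] <-].
rewrite lee_pdivrMl// E.
by apply: (@cint_le_lorentz1 R n p D g phi p0 (ltW D0)) => //; apply: smooth_cmeas; case: sp.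
Qed.

End besov_bounds.

(** * Superpositions of wave packets *)

Section superpositions.
Context {R : realType} {n : nat}.
Local Notation V := 'rV[R]_n.
Local Notation C := R[i].
Local Notation RC := (real_complex R).
Local Notation Re := (@complex.Re R).
Local Notation lebV := (@lebesgue_rV R n).
Variable psi : nat -> V -> C.
Hypothesis psiP : lp_decomposition psi.
Variable i0 : 'I_n.

Definition packets (N : nat) (a : nat -> R) (mu : nat -> R) (j : nat -> nat) (xi : V) : C :=
  \sum_(k < N) RC (a k) * atom psi (mu k) (freq i0 (j k)) xi.

Lemma bump_packets N a mu j : (forall k, 0 < mu k) -> cbump (packets N a mu j).
Proof.
move=> mu0; apply: bump_sum => k; apply: bumpM; first exact: smooth_cst.
exact: bump_atom.
Qed.

Lemma tempered_packets N a mu j : (forall k, 0 < mu k) ->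
  tempered (regdistr (inv_fourier (packets N a mu j))).
Proof. by move=> mu0; apply: tempered_regdistr; apply: cintb_inv_fourier; exact: bump_packets. Qed.

Lemma bumpM_packets i N a mu j : (forall k, 0 < mu k) ->
  cbump (fun xi => psi i xi * packets N a mu j xi).
Proof. by move=> mu0; apply: bumpM; [exact: lp_smooth|exact: bump_packets]. Qed.

Lemma powR2_shift (s : R) : 2 `^ (- `|s|) <= 1 /\ 2 `^ (- `|s|) <= 2 `^ s :> R.
Proof.
split; last by apply: ler_powR; rewrite ?ler1n// lerNl -normrN ler_norm.
by rewrite -[leRHS](powRr0 2); apply: ler_powR; rewrite ?ler1n// oppr_le0.
Qed.

(** A lower bound for the contribution of two consecutive blocks to the strong norm, by
    testing their sum; [2^(-|s|)] absorbs the discrepancy between their weights. *)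
Lemma two_blocks_ge (s p D X : R) j u phi : 0 < p -> 0 < D -> schwartz phi ->
  setbound phi D p^-1 ->
  X <= cabs (lp_block psi j u phi + lp_block psi j.+1 u phi) ->
  ((2 `^ (j%:R * s) * (2 `^ (- `|s|) * (p / (2 * D) * X)))%:E <=
   (2 `^ (j%:R * s))%:E * distr_lorentz_norm p 1 (lp_block psi j u) +
   (2 `^ (j.+1%:R * s))%:E * distr_lorentz_norm p 1 (lp_block psi j.+1 u))%E.
Proof.
move=> p0 D0 sp hphi XB.
have l0 i : (0 <= distr_lorentz_norm p 1 (lp_block psi i u))%E by exact: distr_lorentz_ge0.
have h i := lp_block_pair_le psi i u p0 D0 sp hphi.
have t0 : 0 < 2 `^ (j%:R * s) :> R by exact: powR_gt0.
have [s1 s2] := powR2_shift s.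
rewrite (_ : j.+1%:R * s = j%:R * s + s); last by rewrite -natr1 mulrDl mul1r.
rewrite powRD ?pnatr_eq0 ?implybT// EFinM.
rewrite [X in (_ <= _ + X)%E](_ : _ = (2 `^ (j%:R * s))%:E *
  ((2 `^ s)%:E * distr_lorentz_norm p 1 (lp_block psi j.+1 u)))%E; last by rewrite EFinM muleA.
rewrite -ge0_muleDr//; last by rewrite mule_ge0 ?lee_fin ?powR_ge0.
rewrite lee_wpmul2l ?lee_fin ?(ltW t0)//.
apply: (@le_trans _ _ ((2 `^ (- `|s|))%:E * (distr_lorentz_norm p 1 (lp_block psi j u) + distr_lorentz_norm p 1 (lp_block psi j.+1 u)))%E); last first.
  rewrite ge0_muleDr// leeD// ?lee_wpmul2r ?lee_fin//.
  by rewrite -[leRHS]mul1e lee_wpmul2r ?lee_fin.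
rewrite EFinM lee_wpmul2l ?lee_fin ?powR_ge0//.
have c0 : 0 < 2 * (D / p) by rewrite mulr_gt0// divr_gt0.
have -> : p / (2 * D) = (2 * (D / p))^-1 by rewrite !invfM invrK; ring.
rewrite EFinM lee_pdivrMl// ge0_muleDr//.
apply: le_trans (leeD (h j) (h j.+1)); rewrite -EFinD lee_fin.
by rewrite (le_trans XB)// ler_cabsD.
Qed.

Lemma powR_inv_expn (m : R) (al : R) : 0 < m -> (m ^- n) `^ al = m `^ (- (n%:R * al)).
Proof.
by move=> m0; rewrite -powR_mulrn ?ltW// -powRN -powRrM mulNr.
Qed.

(** Packets at well separated frequencies: each block sees at most one of them, so that the
    weak norms are suprema and the strong ones sums of the same quantities. *)
Section separated.

Lemma sum_double N (f : nat -> \bar R) :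
  (\sum_(0 <= j < N.*2) f j = \sum_(k < N) (f k.*2 + f k.*2.+1))%E.
Proof.
elim: N => [|N IH]; first by rewrite big_nil big_ord0.
by rewrite doubleS big_nat_recr//= big_nat_recr//= IH big_ord_recr/= addeA.
Qed.

(** The size in [B^s_p] of the packet of index [k], whose frequency is about [2^(2k)]; even
    indices keep the pairs of blocks seen by different packets disjoint. *)
Definition weight (s p : R) (a mu : nat -> R) (k : nat) : R :=
  `|a k| * 2 `^ (k.*2%:R * s) * mu k `^ (- (n%:R / p)).

Lemma separated_weak_le (s p : R) : 1 < p -> exists2 K : R, 0 < K &
  forall N (a mu : nat -> R) (D : R), 0 <= D -> (forall k, 0 < mu k <= 2 ^+ k.*2 / 8) ->
    (forall k, (k < N)%N -> weight s p a mu k <= D) ->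
    (besov_norm psi s +oo p +oo (regdistr (inv_fourier (packets N a mu double))) <=
     (K * D)%:E)%E.
Proof.
move=> p1; have [B B0 hB] := atom_block_mass psiP.
have p0 : 0 < p by exact: lt_trans p1.
exists (B * 2 `^ `|s|); first by rewrite mulr_gt0// powR_gt0.
move=> N a mu D D0 hmu hw; have mu0 k : 0 < mu k by have /andP[] := hmu k.
have KD : 0 <= B * 2 `^ `|s| * D by rewrite !mulr_ge0 ?powR_ge0// ltW.
apply: besov_weak_le => // i.
have bg := bumpM_packets i N a double mu0; set g := (fun xi => _) in bg.
exists (inv_fourier g); first exact: (lp_block_regdistr (lp_bump psiP i) (bump_packets _ _ _ mu0)).
apply: lorentz_weak_le => //; first by rewrite mulr_ge0// powR_ge0.
  exact: cintb_inv_fourier.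
have il : i = (i./2.*2 + odd i)%N by rewrite addnC odd_double_half.
pose k := i./2.
have other (l : nat) : l != k -> forall xi, psi i xi * atom psi (mu l) (freq i0 l.*2) xi = 0.
  move=> lk xi; apply: (atom_block_eq0 psiP i0 xi (hmu l)); move: lk il; rewrite /k; case: (odd i) => /=; lia.
have [kN|Nk] := ltnP k N; last first.
  have -> : inv_fourier g = fun=> 0.
    have -> : g = fun xi => 0 * psi i xi.
      apply/funext => xi; rewrite /g /packets mulr_sumr mul0r big1// => l _.
      by rewrite mulrCA other ?mulr0// neq_ltn (leq_trans _ Nk).
    by apply/funext => x; rewrite inv_fourierZ ?mul0r//; exact: lp_bump.
  by apply: setbound0; rewrite mulr_ge0// powR_ge0.
have -> : inv_fourier g = fun x => RC (a k) *
    inv_fourier (fun xi => psi i xi * atom psi (mu k) (freq i0 k.*2) xi) x.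
  have -> : g = fun xi => RC (a k) * (psi i xi * atom psi (mu k) (freq i0 k.*2) xi).
    apply/funext => xi; rewrite /g /packets mulr_sumr (bigD1 (Ordinal kN))//= [X in _ + X]big1.
      by rewrite addr0 mulrCA.
    by move=> l lk; rewrite mulrCA other ?mulr0.
  apply/funext => x; rewrite inv_fourierZ//; apply: bumpM; first exact: lp_smooth.
  exact: bump_atom.
have hmui : 0 < mu k <= 2 ^+ i.
  have /andP[-> h] := hmu k; rewrite (le_trans h)// ler_pdivrMr//.
  apply: (@le_trans _ _ (2 ^+ i)); first by rewrite ler_weXn2l ?ler1n// /k; move: il; lia.
  by rewrite ler_peMr ?exprn_ge0// ler1n.
have mb := hB i (mu k) (freq i0 k.*2) hmui.
have al : 0 < 1 - p^-1 <= 1 by rewrite subr_gt0 invf_lt1// p1 gerBl invr_ge0 ltW.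
have mk0 : 0 < mu k ^- n by rewrite invr_gt0 exprn_gt0.
apply: setbound_le (setboundZ (RC (a k)) _ (mass_bound_setbound B0 mk0 al mb)); last by case: mb.
rewrite cabs_real opprB addrC subrK powR_inv_expn// -/(n%:R / p).
have := hw k kN; rewrite /weight => wD.
have t0 : 0 < 2 `^ (k.*2%:R * s) :> R by exact: powR_gt0.
have -> : `|a k| * (B * mu k `^ (- (n%:R / p))) =
    B * ((`|a k| * 2 `^ (k.*2%:R * s) * mu k `^ (- (n%:R / p))) * (2 `^ (k.*2%:R * s))^-1).
  by field; rewrite gt_eqF.
rewrite -!mulrA ler_wpM2l ?(ltW B0)// [leRHS]mulrCA.
apply: (@le_trans _ _ (D * (2 `^ (k.*2%:R * s))^-1)).
  by rewrite !mulrA ler_wpM2r// invr_ge0 ltW.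
rewrite ler_wpM2l// -powRN -powRD ?pnatr_eq0 ?implybT//.
apply: ler_powR; first by rewrite ler1n.
have -> : i%:R = k.*2%:R + (odd i)%:R :> R by rewrite {1}il natrD.
rewrite mulrDl opprD addrCA lerDl.
by case: (odd i); rewrite ?mul1r ?mul0r ?subr0// subr_ge0 ler_norm.
Qed.

Lemma separated_strong_ge (s p : R) : 1 < p -> exists2 K : R, 0 < K &
  forall N (a mu : nat -> R), (forall k, 0 < mu k <= 2 ^+ k.*2 / 8) ->
    ((K * \sum_(k < N) weight s p a mu k)%:E <=
     besov_norm psi s 1 p 1 (regdistr (inv_fourier (packets N a mu double))))%E.
Proof.
move=> p1; have p0 : 0 < p by exact: lt_trans p1.
have [eps e0 he] := pairing_ge psiP.
have [B B0 hB] := tester_mass psiP e0.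
pose K := 2 `^ (- `|s|) * (p / (4 * B)).
have K0 : 0 < K by rewrite mulr_gt0 ?powR_gt0// divr_gt0// mulr_gt0.
exists K => // N a mu hmu; have mu0 k : 0 < mu k by have /andP[] := hmu k.
have bF := bump_packets N a double mu0.
apply: le_trans (besov_strong_ge psi s p _ N.*2).
set u := regdistr _.
set f := fun j : nat => ((2 `^ (j%:R * s))%:E * distr_lorentz_norm p 1 (lp_block psi j u))%E.
rewrite sum_double.
rewrite mulr_sumr -sumEFin; apply: lee_sum => -[k kN] _ /=.
pose phi := tester psi eps (mu k) (freq i0 k.*2).
have sp : schwartz phi by apply: bump_schwartz; exact: bump_tester.
have mk0 : 0 < mu k ^- n by rewrite invr_gt0 exprn_gt0.
have al : 0 < p^-1 <= 1 by rewrite invr_gt0 p0 invf_le1// ltW.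
pose D := B * (mu k ^- n) `^ (1 - p^-1).
have D0 : 0 < D by rewrite mulr_gt0// powR_gt0.
have hphi : setbound phi D p^-1 by apply: mass_bound_setbound => //; exact: hB.
pose G xi := RC (a k) * atom psi (mu k) (freq i0 k.*2) xi.
have bG : cbump G by apply: bumpM; [exact: smooth_cst|exact: bump_atom].
have FG xi : psi k.*2 xi * packets N a mu double xi + psi k.*2.+1 xi * packets N a mu double xi = G xi.
  rewrite -mulrDl /packets mulr_sumr (bigD1 (Ordinal kN))//= [X in _ + X]big1 ?addr0.
    by rewrite mulrCA mulrDl atom_block_sum.
  move=> l lk; have {}lk : nat_of_ord l != k by [].
  have E i : i != l.*2 -> i != l.*2.+1 -> psi i xi * atom psi (mu l) (freq i0 l.*2) xi = 0.
    by move=> h1 h2; exact: (atom_block_eq0 psiP i0 xi (hmu l)).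
  have : psi k.*2 xi * atom psi (mu l) (freq i0 l.*2) xi = 0 by apply: E; clear -lk; lia.
  have : psi k.*2.+1 xi * atom psi (mu l) (freq i0 l.*2) xi = 0 by apply: E; clear -lk; lia.
  move: (psi k.*2 xi) (psi k.*2.+1 xi) (atom _ _ _ _) (RC (a l)) => x y z w yz xz.
  by rewrite mulrCA mulrDl xz yz addr0 mulr0.
have := lp_block_pairing psiP bF bG sp FG; rewrite -/u.
have -> : cint lebV (fun x => inv_fourier G x * phi x) =
    RC (a k) * (RC (mu k ^- n) * pairing psi eps).
  rewrite -(cint_atom_tester psiP (freq i0 k.*2) e0 (mu0 k)) -cintZ.
    by apply: eq_cint => x; rewrite inv_fourierZ ?mulrA//; exact: bump_atom.
  by apply: cintb_schwartz_mul => //; apply: cintb_inv_fourier; exact: bump_atom.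
move=> E; have XB : `|a k| * (mu k ^- n) * (1 / 2) <= cabs (lp_block psi k.*2 u phi + lp_block psi k.*2.+1 u phi).
  rewrite E !cabsM !cabs_real mulrA ler_pM ?mulr_ge0//; first by rewrite ltW.
    by rewrite (ger0_norm (ltW mk0)).
  by rewrite (le_trans he)// (le_trans (ler_norm _))// le_Re_cabs.
apply: le_trans (two_blocks_ge s p0 D0 sp hphi XB); rewrite lee_fin.
rewrite le_eqVlt; apply/orP; left; apply/eqP.
have mE : mu k ^- n = mu k `^ (- (n%:R / p)) * (mu k ^- n) `^ (1 - p^-1).
  rewrite -powR_inv_expn// -powRD ?subrKC ?powRr1 ?ltW// gt_eqF ?implybT//.
rewrite /weight /K /D {2}mE; set z := _ `^ (1 - p^-1).
have z0 : z != 0 by rewrite gt_eqF// powR_gt0.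
by field; rewrite z0 gt_eqF.
Qed.

End separated.

End superpositions.

Section clusters.
Context {R : realType} {n : nat}.
Local Notation V := 'rV[R]_n.
Local Notation C := R[i].
Local Notation RC := (real_complex R).
Local Notation Re := (@complex.Re R).
Local Notation lebV := (@lebesgue_rV R n).
Variable psi : nat -> V -> C.
Hypothesis psiP : lp_decomposition psi.
Variable i0 : 'I_n.

(** Packets at a common frequency, with scales in geometric progression: they overlap in
    the same two blocks, but live at very different heights and masses. *)
Definition cscale (k : nat) : R := (8 * 2 ^+ k)^-1.

Lemma cscale_gt0 k : 0 < cscale k.
Proof. by rewrite invr_gt0 mulr_gt0// exprn_gt0. Qed.

Lemma cscale_le k : 0 < cscale k <= 2 ^+ 0 / 8.
Proof.
rewrite cscale_gt0/= expr0 mul1r lef_pV2 ?posrE ?mulr_gt0 ?exprn_gt0//.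
by rewrite ler_peMr// exprn_ege1// ler1n.
Qed.

Lemma cscaleVn k : cscale k ^- n = 8 ^+ n * (2 ^+ n) ^+ k.
Proof. by rewrite /cscale exprVn invrK exprMn -!exprM mulnC. Qed.

(** The coefficients give all terms the same size in the Lorentz space of exponent
    [1 / al]. On a set of measure [a] the terms are bounded by [min(a, mass)] times their
    height, and [geometric_min_sum] makes the sum independent of [N]. *)
Lemma cluster_setbound (B al : R) : 0 < B -> 0 < al < 1 -> exists2 K : R, 0 < K &
  forall N (f : nat -> V -> C) (c : nat -> C),
    (forall k, mass_bound B (cscale k ^- n) (f k)) ->
    (forall k, cabs (c k) <= (cscale k ^+ n) `^ al) ->
    setbound (fun x => \sum_(k < N) c k * f k x) K (1 - al).
Proof.
move=> B0 al01; have /andP[al0 al1] := al01.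
pose q : R := 2 ^+ n; pose t : R := 8 ^+ n.
have t0 : 0 < t by rewrite exprn_gt0.
have q1 : 1 < q by rewrite exprn_egt1 ?ltr1n//; case: (n) i0 => [[]|].
pose Cg := q `^ (1 - al) / (q `^ (1 - al) - 1) + (1 - (q `^ al)^-1)^-1.
have geo a N : 0 < a -> \sum_(k < N) (q `^ al) ^- k * Num.min a (q ^+ k) <= Cg * a `^ (1 - al).
  by move=> a0; exact: geometric_min_sum.
have Cg0 : 0 < Cg.
  have := geo 1 1%N ltr01; rewrite big_ord1 expr0 invr1 mul1r minxx powR1 mulr1.
  exact: lt_le_trans.
exists (B * Cg); first exact: mulr_gt0.
move=> N f c hf hc.
have mf k : cmeas (fun x => c k * f k x).
  by apply: cmeasM; [exact: cmeas_cst|have [] := hf k].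
apply: setboundP; rewrite ?subr_gt0//; [exact: cmeas_sum|exact: mulr_gt0|].
move=> E a mE Ea a0.
have at0 : 0 < a / t by rewrite divr_gt0.
have ck k : (cscale k ^+ n) `^ al = (t `^ al)^-1 * (q `^ al) ^- k.
  have -> : cscale k ^+ n = (t * q ^+ k)^-1 by rewrite -cscaleVn invrK.
  have tq : 0 < t * q ^+ k by rewrite mulr_gt0// exprn_gt0// (lt_trans _ q1).
  have q0 : 0 <= q by rewrite ltW// (lt_trans _ q1).
  have h : ((t * q ^+ k)^-1) `^ al * (t * q ^+ k) `^ al = 1.
    by rewrite -powRM ?invr_ge0 ?ltW// mulVf ?powR1// gt_eqF.
  rewrite -invfM powR_expn// -powRM ?exprn_ge0 ?ltW//.
  by apply: (mulIf (x := (t * q ^+ k) `^ al)); rewrite ?h ?mulVf// gt_eqF// powR_gt0.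
apply: (@le_trans _ _ (\sum_(k < N) (cscale k ^+ n) `^ al * (B * Num.min a (cscale k ^- n)))%:E).
  apply: integral_cabs_sum_le => // k.
  have mb := hf k; have [mfk _ _] := mb.
  under eq_integral do rewrite cabsM EFinM.
  rewrite ge0_integralZl//; last 3 first.
  - by apply: measurable_funTS; exact: measurable_cabs_EFin.
  - by move=> x _; rewrite lee_fin cabs_ge0.
  - by rewrite lee_fin cabs_ge0.
  rewrite EFinM; apply: lee_pmul; rewrite ?lee_fin ?cabs_ge0//.
    by apply: integral_ge0 => x _; rewrite lee_fin cabs_ge0.
  exact: (mass_bound_min (ltW B0) mb mE Ea).
rewrite lee_fin.
have E1 k : (cscale k ^+ n) `^ al * (B * Num.min a (cscale k ^- n)) =
    (B * (t `^ al)^-1 * t) * ((q `^ al) ^- k * Num.min (a / t) (q ^+ k)).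
  rewrite ck cscaleVn -/q -/t (_ : Num.min a (t * q ^+ k) = t * Num.min (a / t) (q ^+ k)); first by ring.
  by rewrite minr_pMr ?(ltW t0)// mulrCA mulfV ?mulr1// gt_eqF.
under eq_bigr do rewrite E1.
rewrite -mulr_sumr.
have c0 : 0 <= B * (t `^ al)^-1 * t by rewrite !mulr_ge0 ?invr_ge0 ?powR_ge0 ?ltW.
apply: (le_trans (ler_wpM2l c0 (geo _ N at0))).
have tE : t = t `^ al * t `^ (1 - al) by rewrite -powRD ?subrKC ?powRr1 ?ltW// gt_eqF ?implybT.
have aE : a `^ (1 - al) = (a / t) `^ (1 - al) * t `^ (1 - al).
  by rewrite -powRM ?ltW// divfK// gt_eqF.
rewrite aE {2}tE le_eqVlt; apply/orP; left; apply/eqP.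
by field; rewrite gt_eqF// powR_gt0.
Qed.

Lemma inv_fourier_packets i N (a mu : nat -> R) j x : (forall k, 0 < mu k) ->
  inv_fourier (fun xi => psi i xi * packets psi i0 N a mu j xi) x =
  \sum_(k < N) RC (a k) * inv_fourier (fun xi => psi i xi * atom psi (mu k) (freq i0 (j k)) xi) x.
Proof.
move=> mu0.
have bk k : cbump (fun xi => psi i xi * atom psi (mu k) (freq i0 (j k)) xi).
  by apply: bumpM; [exact: lp_smooth|exact: bump_atom].
have -> : (fun xi => psi i xi * packets psi i0 N a mu j xi) =
    fun xi => \sum_(k < N) RC (a k) * (psi i xi * atom psi (mu k) (freq i0 (j k)) xi).
  by apply/funext => xi; rewrite mulr_sumr; apply: eq_bigr => k _; rewrite mulrCA.
rewrite inv_fourier_sum; last by move=> k; apply: bumpM; [exact: smooth_cst|exact: bk].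
by apply: eq_bigr => k _; rewrite inv_fourierZ//; exact: bk.
Qed.

Definition cluster (p : R) N (eps : nat -> R) : V -> C :=
  packets psi i0 N (fun k => eps k * (cscale k ^+ n) `^ p^-1) cscale (fun=> 0%N).

Lemma cluster_weak_le (s p : R) : 1 < p -> exists2 K : R, 0 < K &
  forall N (eps : nat -> R), (forall k, `|eps k| <= 1) ->
    (besov_norm psi s +oo p +oo (regdistr (inv_fourier (cluster p N eps))) <=
     K%:E)%E.
Proof.
move=> p1; have [B B0 hB] := atom_block_mass psiP.
have p0 : 0 < p by exact: lt_trans p1.
have al : 0 < p^-1 < 1 by rewrite invr_gt0 p0 invf_lt1.
have [K0 K00 hK] := cluster_setbound B0 al.
have K1 : 0 < K0 * 2 `^ `|s| by rewrite mulr_gt0// powR_gt0.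
exists (K0 * 2 `^ `|s|) => // N eps he.
rewrite /cluster; set a := fun k => _.
apply: besov_weak_le; first exact: ltW.
move=> i; have bF := bump_packets psiP i0 N a (fun=> 0%N) cscale_gt0.
exists (inv_fourier (fun xi => psi i xi * packets psi i0 N a cscale (fun=> 0%N) xi)).
  exact: (lp_block_regdistr (lp_bump psiP i) bF).
have D0 : 0 <= K0 * 2 `^ `|s| * 2 `^ (- (i%:R * s)) by rewrite mulr_ge0 ?powR_ge0 ?(ltW K1).
apply: lorentz_weak_le => //.
  by apply: cintb_inv_fourier; apply: bumpM => //; exact: lp_smooth.
have -> : inv_fourier (fun xi => psi i xi * packets psi i0 N a cscale (fun=> 0%N) xi) =
    fun x => \sum_(k < N) RC (a k) * inv_fourier (fun xi => psi i xi * atom psi (cscale k) (freq i0 0) xi) x.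
  by apply/funext => x; rewrite inv_fourier_packets//; exact: cscale_gt0.
have [i2|i2] := ltnP 1 i.
  rewrite (_ : (fun x => _) = fun=> 0); first exact: setbound0.
  apply/funext => x; rewrite big1// => k _.
  have -> : (fun xi => psi i xi * atom psi (cscale k) (freq i0 0) xi) = fun xi => 0 * psi i xi.
    apply/funext => xi; rewrite mul0r; apply: (atom_block_eq0 psiP i0 xi (cscale_le k)); clear -i2; lia.
  by rewrite inv_fourierZ ?mul0r ?mulr0//; exact: lp_bump.
apply: (@setbound_le _ _ _ K0).
  rewrite -mulrA -[leLHS]mulr1 ler_wpM2l ?(ltW K00)// -powRD ?pnatr_eq0 ?implybT//.
  rewrite -[leLHS](powRr0 2); apply: ler_powR; first by rewrite ler1n.
  by case: i i2 {bF D0} => [|[|//]] _; rewrite ?mul0r ?subr0 ?mul1r ?subr_ge0 ?ler_norm.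
apply: (hK N (fun k => inv_fourier (fun xi => psi i xi * atom psi (cscale k) (freq i0 0) xi)) (fun k => RC (a k))).
- move=> k; apply: hB; have /andP[-> h] := cscale_le k.
  rewrite (le_trans h)// expr0 mul1r (@le_trans _ _ 1)// ?exprn_ege1 ?ler1n//.
  by rewrite invf_le1// ler1n.
- move=> k; rewrite cabs_real /a normrM (ger0_norm (powR_ge0 _ _)).
  by rewrite ler_piMl ?powR_ge0.
Qed.

(** Signs chosen one after another, each making the new off-diagonal terms contribute a
    nonnegative amount. *)
Lemma sign_choice (M : nat -> nat -> R) N : exists2 eps : nat -> R, (forall k, `|eps k| = 1) &
  \sum_(k < N) M k k <= \sum_(k < N) \sum_(l < N) eps k * eps l * M k l.
Proof.
elim: N => [|N [eps he IH]].
  by exists (fun=> 1) => [k|]; rewrite ?normr1// !big_ord0.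
pose X := \sum_(k < N) eps k * M k N + \sum_(l < N) eps l * M N l.
have [sg [sg1 sgX]] : exists sg : R, `|sg| = 1 /\ 0 <= sg * X.
  have [X0|X0] := leP 0 X; first by exists 1; rewrite normr1 mul1r.
  by exists (-1); rewrite normrN1 mulN1r oppr_ge0 ltW.
exists (fun k => if k == N then sg else eps k) => [k|]; first by case: ifP.
have sg2 : sg * sg = 1 by rewrite -expr2 -real_normK ?num_real// sg1 expr1n.
rewrite !big_ord_recr/= !eqxx sg2 mul1r.
rewrite [in leRHS](eq_bigr (fun k : 'I_N => \sum_(l < N) eps k * eps l * M k l + sg * (eps k * M k N))); last first.
  move=> k _; rewrite big_ord_recr/= eqxx (ltn_eqF (ltn_ord k)); congr (_ + _); last by ring.
  by apply: eq_bigr => l _; rewrite (ltn_eqF (ltn_ord l)).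
rewrite big_split/= -mulr_sumr [X in _ + (X + _)](_ : _ = sg * \sum_(l < N) eps l * M N l); last first.
  by rewrite mulr_sumr; apply: eq_bigr => l _; rewrite (ltn_eqF (ltn_ord l)) mulrA.
rewrite addrA lerD2r -addrA -mulrDr -/X (le_trans IH)// lerDl//.
Qed.

(** Dually, the cluster of testers with the same signs and the conjugate exponent is bounded
    uniformly in [N], whereas its pairing with the cluster of packets is at least the
    diagonal sum, [N / 2]. *)
Lemma cluster_strong_ge (s p : R) : 1 < p -> exists2 K : R, 0 < K &
  forall N, exists2 eps : nat -> R, (forall k, `|eps k| = 1) &
    ((K * N%:R)%:E <= besov_norm psi s 1 p 1 (regdistr (inv_fourier (cluster p N eps))))%E.
Proof.
move=> p1; have p0 : 0 < p by exact: lt_trans p1.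
have [ep ep0 hep] := pairing_ge psiP.
have [B B0 hB] := tester_mass psiP ep0.
have pV : 0 < p^-1 < 1 by rewrite invr_gt0 p0 invf_lt1.
have al : 0 < 1 - p^-1 < 1 by rewrite subr_gt0 gtrBl andbC.
have [D D0 hD] := cluster_setbound B0 al.
exists (2 `^ (- `|s|) * (p / (2 * D) * (1 / 2))).
  by rewrite !mulr_gt0 ?powR_gt0 ?invr_gt0 ?mulr_gt0.
move=> N.
pose f k := inv_fourier (atom psi (cscale k) (freq i0 0)).
pose tst k := tester psi ep (cscale k) (freq i0 0).
pose I_ k l := cint lebV (fun x => f k x * tst l x).
pose M k l := (cscale k ^+ n) `^ p^-1 * (cscale l ^+ n) `^ (1 - p^-1) * Re (I_ k l).
have [eps he hM] := sign_choice M N; exists eps => //.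
rewrite /cluster; set a := fun k => _; set u := regdistr _.
pose d k := eps k * (cscale k ^+ n) `^ (1 - p^-1).
pose phi x := \sum_(l < N) RC (d l) * tst l x.
have btst l : cbump (tst l) by apply: bump_tester => //; exact: cscale_gt0.
have sp : schwartz phi.
  by apply: bump_schwartz; apply: bump_sum => l; apply: bumpM; [exact: smooth_cst|exact: btst].
have hphi : setbound phi D p^-1.
  rewrite -[p^-1](subKr 1); apply: (hD N tst (fun l => RC (d l))).
    by move=> k; apply: hB; exact: cscale_gt0.
  by move=> k; rewrite cabs_real /d normrM he mul1r ger0_norm ?powR_ge0.
have bF := bump_packets psiP i0 N a (fun=> 0%N) cscale_gt0.
have bf k : cbump (atom psi (cscale k) (freq i0 0)) by apply: bump_atom => //; exact: cscale_gt0.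
have FG xi : psi 0 xi * packets psi i0 N a cscale (fun=> 0%N) xi +
    psi 1 xi * packets psi i0 N a cscale (fun=> 0%N) xi = packets psi i0 N a cscale (fun=> 0%N) xi.
  rewrite -mulrDl /packets mulr_sumr; apply: eq_bigr => k _.
  by rewrite mulrCA mulrDl atom_block_sum//; exact: cscale_le.
have E := lp_block_pairing psiP bF bF sp FG.
have Ift k l : cintb lebV (fun x => f k x * tst l x).
  by apply: cintb_schwartz_mul; [exact: cintb_inv_fourier|exact: bump_schwartz].
have EI : cint lebV (fun x => inv_fourier (packets psi i0 N a cscale (fun=> 0%N)) x * phi x) =
    \sum_(k < N) \sum_(l < N) RC (a k * d l) * I_ k l.
  transitivity (cint lebV (fun x => \sum_(k < N) \sum_(l < N) RC (a k * d l) * (f k x * tst l x))).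
    apply: eq_cint => x; rewrite inv_fourier_sum; last first.
      by move=> k; apply: bumpM; [exact: smooth_cst|exact: bf].
    rewrite mulr_suml; apply: eq_bigr => k _; rewrite inv_fourierZ; last exact: bf.
    rewrite /phi mulr_sumr; apply: eq_bigr => l _.
    have -> : RC (a k * d l) = RC (a k) * RC (d l) by exact: rmorphM.
    by rewrite /f; ring.
  rewrite cint_sum; last by move=> k; apply: cintb_sum => l; exact: cintbZ.
  apply: eq_bigr => k _; rewrite cint_sum; last by move=> l; exact: cintbZ.
  by apply: eq_bigr => l _; rewrite cintZ.
have X : N%:R / 2 <= cabs (lp_block psi 0 u phi + lp_block psi 1 u phi).
  rewrite E EI; apply: le_trans (le_trans (ler_norm _) (le_Re_cabs _)).
  have -> : Re (\sum_(k < N) \sum_(l < N) RC (a k * d l) * I_ k l) =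
      \sum_(k < N) \sum_(l < N) eps k * eps l * M k l.
    rewrite (big_morph _ cReD (erefl (Re 0))); apply: eq_bigr => k _.
    rewrite (big_morph _ cReD (erefl (Re 0))); apply: eq_bigr => l _.
    by rewrite cReRM /a /d /M; ring.
  apply: le_trans hM.
  have -> : N%:R / 2 = \sum_(k < N) (1 / 2 : R).
    by rewrite sumr_const card_ord mul1r mulr_natl.
  apply: ler_sum => k _; rewrite /M.
  have cn : 0 < cscale k ^+ n by rewrite exprn_gt0// cscale_gt0.
  rewrite -powRD; last by rewrite (gt_eqF cn) implybT.
  rewrite subrKC powRr1 ?(ltW cn)// /I_ /f /tst cint_atom_tester ?cscale_gt0//.
  by rewrite cReRM mulVKf ?(gt_eqF cn).
apply: le_trans (besov_strong_ge psi s p u 2).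
have := two_blocks_ge s p0 D0 sp hphi X.
rewrite !mul0r powRr0 !mul1r big_nat_recl// big_nat1 mul0r powRr0 !mul1r mul1e.
rewrite (_ : 2 `^ (- `|s|) * (p / (2 * D) * (N%:R / 2)) =
  2 `^ (- `|s|) * (p / (2 * D) / 2) * N%:R)//; by ring.
Qed.

End clusters.

(** * Necessary conditions on the exponents *)

Section growth.
Context {R : realType}.

Lemma le_natr_bound (x K : R) : (forall m : nat, m%:R * x <= K) -> x <= 0.
Proof.
move=> h; rewrite leNgt; apply/negP => x0.
have := h (Num.truncn (K / x)).+1; rewrite leNgt => /negP; apply.
by rewrite -ltr_pdivrMr// truncnS_gt.
Qed.

Lemma powR2_bound (d e K : R) : (forall m : nat, 2 `^ (m%:R * d + e) <= K) -> d <= 0.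
Proof.
move=> h; have l2 : 0 < ln (2 : R) by rewrite ln_gt0// ltr1n.
have e0 : 0 < 2 `^ e :> R by exact: powR_gt0.
rewrite -(pmulr_lle0 _ l2); apply: (@le_natr_bound _ (K / 2 `^ e)) => m.
rewrite ler_pdivlMr//; apply: le_trans (h m).
rewrite powRD ?pnatr_eq0 ?implybT// ler_pM2r// /powR pnatr_eq0/= mulrA.
by apply: le_trans (expR_ge1Dx _); rewrite lerDr.
Qed.

End growth.

Section necessity.
Context {R : realType} {n : nat}.
Local Notation V := 'rV[R]_n.
Local Notation weight := (@weight R n).
Variable psi : nat -> V -> R[i].
Hypothesis psiP : lp_decomposition psi.
Variable i0 : 'I_n.
Variables (s s1 s2 p p1 p2 theta C : R).
Hypotheses (p_gt1 : 1 < p) (p1_gt1 : 1 < p1) (p2_gt1 : 1 < p2).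
Hypotheses (theta01 : 0 < theta < 1) (C0 : 0 < C).
Hypothesis interp : forall u : distr,
  besov psi s1 +oo%E p1 +oo%E u -> besov psi s2 +oo%E p2 +oo%E u ->
  (besov_norm psi s 1 p 1 u <=
     C%:E * besov_norm psi s1 +oo p1 +oo u `^ (1 - theta)%R
          * besov_norm psi s2 +oo p2 +oo u `^ theta)%E.

(** The hypothesis is used only through upper bounds of the two weak norms. *)
Lemma interp_bound (u : distr) (D1 D2 : R) : tempered u ->
  (besov_norm psi s1 +oo p1 +oo u <= D1%:E)%E ->
  (besov_norm psi s2 +oo p2 +oo u <= D2%:E)%E ->
  (besov_norm psi s 1 p 1 u <= (C * D1 `^ (1 - theta) * D2 `^ theta)%:E)%E.
Proof.
move=> tu h1 h2; have /andP[th0 th1] := theta01.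
have key (x : \bar R) (D t : R) : (0 <= x)%E -> 0 < t -> (x <= D%:E)%E -> (x `^ t <= (D `^ t)%:E)%E.
  case: x => [r| |]//; rewrite !lee_fin => r0 t0 rD.
  apply: ge0_ler_powR; rewrite ?nnegrE ?(ltW t0)//.
  exact: le_trans rD.
have g1 : (0 <= besov_norm psi s1 +oo p1 +oo u)%E by exact: Lnorm_ge0.
have g2 : (0 <= besov_norm psi s2 +oo p2 +oo u)%E by exact: Lnorm_ge0.
apply: le_trans (interp _ _) _.
- by split => //; apply: le_lt_trans h1 _; rewrite ltry.
- by split => //; apply: le_lt_trans h2 _; rewrite ltry.
rewrite EFinM; apply: lee_pmul.
- by apply: mule_ge0; [rewrite lee_fin ltW|exact: poweR_ge0].
- exact: poweR_ge0.
- by rewrite EFinM lee_wpmul2l ?lee_fin ?(ltW C0)//; apply: key => //; rewrite subr_gt0.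
- exact: key.
Qed.

Lemma separated_interp : exists2 K : R, 0 < K &
  forall N (a mu : nat -> R) (D1 D2 : R), 0 <= D1 -> 0 <= D2 ->
    (forall k, 0 < mu k <= 2 ^+ k.*2 / 8) ->
    (forall k, (k < N)%N -> weight s1 p1 a mu k <= D1) ->
    (forall k, (k < N)%N -> weight s2 p2 a mu k <= D2) ->
    \sum_(k < N) weight s p a mu k <= K * (D1 `^ (1 - theta) * D2 `^ theta).
Proof.
have [K1 K10 h1] := separated_weak_le psiP i0 s1 p1_gt1.
have [K2 K20 h2] := separated_weak_le psiP i0 s2 p2_gt1.
have [K K0 h] := separated_strong_ge psiP i0 s p_gt1.
exists (C * K1 `^ (1 - theta) * K2 `^ theta / K).
  by rewrite divr_gt0// !mulr_gt0// powR_gt0.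
move=> N a mu D1 D2 D10 D20 hmu w1 w2.
have mu0 k : 0 < mu k by have /andP[] := hmu k.
have := interp_bound (tempered_packets psiP i0 N a double mu0)
  (h1 N a mu D1 D10 hmu w1) (h2 N a mu D2 D20 hmu w2).
move=> /(le_trans (h N a mu hmu)); rewrite lee_fin !powRM ?(ltW K10) ?(ltW K20)//.
rewrite mulrC -ler_pdivlMr// => /le_trans; apply.
by rewrite le_eqVlt; apply/orP; left; apply/eqP; ring.
Qed.

Lemma weightE s' p' a mu (b t : R) k : a k = 2 `^ b -> mu k = 2 `^ t ->
  weight s' p' a mu k = 2 `^ (b + k.*2%:R * s' - t * (n%:R / p')).
Proof.
rewrite /weight => -> ->; rewrite ger0_norm ?powR_ge0// -powRrM -!powRD ?pnatr_eq0 ?implybT//.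
by rewrite mulrN.
Qed.

Let sstar := (1 - theta) * s1 + theta * s2.
Let rstar := (1 - theta) / p1 + theta / p2.

Lemma powR2_interp (x y : R) :
  (2 `^ x) `^ (1 - theta) * (2 `^ y) `^ theta = 2 `^ ((1 - theta) * x + theta * y) :> R.
Proof. by rewrite -!powRrM -powRD ?pnatr_eq0 ?implybT// [x * _]mulrC [y * _]mulrC. Qed.

(** A single packet of frequency about [2^(2m)] and spatial scale [2^(-t)]: both exponents
    in the bound may be sent to infinity. *)
Lemma single_packet : exists2 K : R, 0 < K & forall (m : nat) (t : R), t <= m.*2%:R - 3 ->
  2 `^ (m.*2%:R * (s - sstar) - t * (n%:R / p - n%:R * rstar)) <= K.
Proof.
have [K K0 hK] := separated_interp; exists K => // m t tm.
pose a k : R := (k == m)%:R.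
pose mu k : R := if k == m then 2 `^ t else 2 ^+ k.*2 / 8.
have am : a m = 2 `^ 0 by rewrite /a eqxx powRr0.
have mum : mu m = 2 `^ t by rewrite /mu eqxx.
have e8 : 2 ^+ 3 = 8 :> R by ring.
have hmu k : 0 < mu k <= 2 ^+ k.*2 / 8.
  rewrite /mu; case: eqP => [->|_]; last by rewrite lexx divr_gt0// exprn_gt0.
  rewrite powR_gt0//= -e8 -!powR_mulrn// -powRN -powRD ?pnatr_eq0 ?implybT//.
  by apply: ler_powR => //; rewrite ler1n.
have w0 s' p' k : k != m -> weight s' p' a mu k = 0.
  by move=> km; rewrite /weight /a (negbTE km) normr0 !mul0r.
have wm s' p' := weightE s' p' am mum.
have le s' p' k : weight s' p' a mu k <= weight s' p' a mu m.
  have [->//|km] := eqVneq k m; rewrite w0// wm powR_ge0//.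
have := hK m.+1 a mu _ _ _ _ hmu (fun k _ => le s1 p1 k) (fun k _ => le s2 p2 k).
rewrite !wm !powR_ge0 => /(_ isT isT).
rewrite big_ord_recr/= big1 ?add0r; last by move=> k _; rewrite w0// ltn_eqF.
rewrite wm powR2_interp -ler_pdivrMr ?powR_gt0// -powRN -powRD ?pnatr_eq0 ?implybT//.
apply: le_trans; rewrite le_eqVlt; apply/orP; left; apply/eqP; congr (2 `^ _).
by rewrite /sstar /rstar; ring.
Qed.

(** The packet of index [k] is given the frequency width [2^(2k eta) / 8] and the
    amplitude which makes its weight independent of [k] in all three spaces. Then the
    weak norms of the sum of [N] packets stay bounded, and the strong one grows like [N]. *)
Lemma not_collinear (eta tau : R) : 0 <= eta <= 1 ->
  s1 - eta * (n%:R / p1) = tau -> s2 - eta * (n%:R / p2) = tau ->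
  s - eta * (n%:R / p) = tau -> False.
Proof.
move=> /andP[eta0 eta1] E1 E2 E.
have [K K0 hK] := separated_interp.
pose a (k : nat) : R := 2 `^ (- (k.*2%:R * tau)).
pose mu (k : nat) : R := 2 `^ (k.*2%:R * eta - 3).
have e8 : 2 ^+ 3 = 8 :> R by ring.
have hmu k : 0 < mu k <= 2 ^+ k.*2 / 8.
  rewrite /mu powR_gt0//= -e8 -!powR_mulrn// -powRN -powRD ?pnatr_eq0 ?implybT//.
  by apply: ler_powR; rewrite ?ler1n// lerD2r ler_piMr.
have wE s' p' k : s' - eta * (n%:R / p') = tau -> weight s' p' a mu k = 2 `^ (3 * (n%:R / p')).
  move=> e; rewrite (@weightE s' p' a mu (- (k.*2%:R * tau)) (k.*2%:R * eta - 3))//.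
  by congr (2 `^ _); rewrite -e; ring.
have := fun N => hK N a mu (2 `^ (3 * (n%:R / p1))) (2 `^ (3 * (n%:R / p2)))
  (powR_ge0 _ _) (powR_ge0 _ _) hmu.
move=> h; have : 2 `^ (3 * (n%:R / p)) <= 0 :> R.
  apply: le_natr_bound => N; apply: le_trans (h N _ _).
  - rewrite (eq_bigr (fun=> 2 `^ (3 * (n%:R / p)))); last by move=> k _; exact: wE.
    by rewrite sumr_const card_ord mulr_natl.
  - by move=> k _; rewrite wE.
  - by move=> k _; rewrite wE.
by rewrite leNgt powR_gt0.
Qed.

(** Packets at one frequency do not see the smoothness indices, so that with equal
    integrability exponents the three norms differ, up to constants, only by the second
    Lorentz exponent; the clusters tell weak [L^p] from [L^(p,1)]. *)
Lemma not_all_equal_exponents : p1 = p -> p2 = p -> False.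
Proof.
move=> e1 e2.
have [K1 K10 h1] := cluster_weak_le psiP i0 s1 p_gt1.
have [K2 K20 h2] := cluster_weak_le psiP i0 s2 p_gt1.
have [K K0 h] := cluster_strong_ge psiP i0 s p_gt1.
suff : K <= 0 by rewrite leNgt K0.
apply: (@le_natr_bound _ _ (C * K1 `^ (1 - theta) * K2 `^ theta)) => N.
have [eps he hN] := h N; rewrite -lee_fin mulrC; apply: (le_trans hN).
have he' k : `|eps k| <= 1 by rewrite he.
apply: interp_bound; rewrite ?e1 ?e2; [|exact: h1|exact: h2].
by apply: tempered_packets => // k; exact: cscale_gt0.
Qed.

(** Obtained, in order, from a single packet at low frequency and large spatial scale, from
    one at high frequency and the smallest spatial scale, from a family on a line of slope
    [n], from a cluster at one frequency, and from a family on a line of slope 0. *)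
Lemma interp_exponents :
  [/\ n%:R / p <= n%:R * rstar, n%:R * rstar - n%:R / p <= sstar - s,
      sstar - s = n%:R * rstar - n%:R / p -> s1 - n%:R / p1 != s2 - n%:R / p2,
      n%:R / p = n%:R * rstar -> p1 != p2 &
      n%:R / p = n%:R * rstar -> sstar = s -> s1 != s2].
Proof.
have /andP[th0 th1] := theta01.
have n0 : (n%:R : R) != 0 by rewrite pnatr_eq0; case: (n) i0 => [[]|].
have [K K0 hK] := single_packet.
split.
- have : n%:R / p - n%:R * rstar <= 0.
    apply: (@powR2_bound _ _ (3 * (n%:R / p - n%:R * rstar)) K) => m.
    have tm : - m%:R - 3 <= 0.*2%:R - 3 :> R by rewrite double0 lerD2r oppr_le0 ler0n.
    have := hK 0%N _ tm.
    apply: le_trans; rewrite le_eqVlt; apply/orP; left; apply/eqP; congr (2 `^ _).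
    by rewrite double0; ring.
  by rewrite subr_le0.
- have : 2 * ((s - sstar) - (n%:R / p - n%:R * rstar)) <= 0.
    apply: (@powR2_bound _ _ (3 * (n%:R / p - n%:R * rstar)) K) => m.
    have := hK m (m.*2%:R - 3) (lexx _).
    apply: le_trans; rewrite le_eqVlt; apply/orP; left; apply/eqP; congr (2 `^ _).
    by rewrite -mul2n natrM; ring.
  by lra.
- move=> SA; apply/eqP => E; apply: (@not_collinear 1 (s1 - n%:R / p1)).
  + by rewrite ler01 lexx.
  + by rewrite mul1r.
  + by rewrite mul1r.
  + rewrite mul1r; move: SA; rewrite /sstar /rstar => SA.
    have : s2 = s1 - n%:R / p1 + n%:R / p2 by rewrite E subrK.
    move=> E2; rewrite E2 in SA; move: SA.
    have -> : n%:R * ((1 - theta) / p1 + theta / p2) =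
        (1 - theta) * (n%:R / p1) + theta * (n%:R / p2) by ring.
    by move: (n%:R / p) (n%:R / p1) (n%:R / p2) => x y z; lra.
- move=> pE; apply/eqP => e12; have e1 : p1 = p.
    move: pE; rewrite /rstar e12 -mulrDl subrK mul1r => /(mulfI n0)/invr_inj ->.
    by [].
  by apply: not_all_equal_exponents => //; rewrite -e12.
- move=> pE sE; apply/eqP => e12; apply: (@not_collinear 0 s1).
  + by rewrite lexx ler01.
  + by rewrite mul0r subr0.
  + by rewrite mul0r subr0.
  + by rewrite mul0r subr0 -sE /sstar -e12 -mulrDl subrK mul1r.
Qed.

End necessity.

Theorem theorem4p7 (R : realType) (n : nat) (n_gt0 : (0 < n)%N)
    (psi : nat -> 'rV[R]_n -> R[i]) (psiP : lp_decomposition psi)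
    (s s1 s2 p p1 p2 theta sstar pstar : R)
    (p_gt1 : 1 < p) (p1_gt1 : 1 < p1) (p2_gt1 : 1 < p2)
    (theta01 : 0 < theta < 1)
    (sstarE : sstar = (1 - theta) * s1 + theta * s2)
    (pstarE : 1 / pstar = (1 - theta) / p1 + theta / p2)
    (interp : exists2 C : R, 0 < C &
       forall u : distr,
         besov psi s1 +oo%E p1 +oo%E u -> besov psi s2 +oo%E p2 +oo%E u ->
         (besov_norm psi s 1 p 1 u <=
            C%:E * besov_norm psi s1 +oo p1 +oo u `^ (1 - theta)%R
                 * besov_norm psi s2 +oo p2 +oo u `^ theta)%E) :
  [\/ [/\ sstar = s, pstar = p, s1 != s2, p1 != p2 &
           s2 - s1 != n%:R / p2 - n%:R / p1],
      [/\ sstar > s, pstar = p & p1 != p2],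
      [/\ sstar - s = n%:R / pstar - n%:R / p, 0 < n%:R / pstar - n%:R / p &
           s2 - s1 != n%:R / p2 - n%:R / p1] |
      (sstar - s > n%:R / pstar - n%:R / p) /\
      (n%:R / pstar - n%:R / p > 0)].
Proof.
have [C C0 interpC] := interp.
have n0 : (n%:R : R) != 0 by rewrite pnatr_eq0 -lt0n.
have := interp_exponents psiP (Ordinal n_gt0) p_gt1 p1_gt1 p2_gt1 theta01 C0 interpC.
rewrite -sstarE -pstarE mul1r => -[A0 SA Hnd Hp Hs].
have nd : sstar - s = n%:R / pstar - n%:R / p -> s2 - s1 != n%:R / p2 - n%:R / p1.
  move=> /Hnd; apply: contra_neq => E.
  by move: E; set x := n%:R / p1; set y := n%:R / p2 => E; lra.
move: A0; rewrite le_eqVlt => /orP[/eqP A0|A0]; last first.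
  have pos : 0 < n%:R / pstar - n%:R / p by rewrite subr_gt0.
  move: SA; rewrite le_eqVlt => /orP[/eqP S0|S0]; last by constructor 4.
  by constructor 3; split => //; exact: nd.
have ps : pstar = p by apply: invr_inj; apply: (mulfI n0).
move: SA; rewrite -A0 subrr subr_ge0 le_eqVlt => /orP[/eqP S0|S0].
  constructor 1; split => //; [exact: Hs|exact: Hp|].
  by apply: nd; rewrite -A0 S0 !subrr.
by constructor 2; split => //; exact: Hp.
Qed.
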